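(* Let $(X,\rho,\mu)$ be a doubling metric measure space with doubling constant $C_\mu$ which supports the weak $p$-Poincaré inequality, let $\nu=\log_2 C_\mu$, $1<p<\nu$, $p^{\ast}=\frac{\nu p}{\nu-p}$, and let $\Omega\subset X$ be a Sobolev $(p,p^{\ast})$-embedding domain. Let $1<q<p^{\ast}$ and define $$\lambda_{p,q}(\Omega)=\inf\left\{\frac{\|\nabla_{min} w\|_{L^p(\Omega)}^p}{\|w\|_{L^q(\Omega)}^p} : w\in N^{1,p}(\Omega)\setminus\{0\},\ \int_\Omega |w|^{q-2}w\,d\mu=0\right\}.$$ Then there exists $u\in N^{1,p}(\Omega)\setminus\{0\}$ such that $\int_\Omega |u|^{q-2}u\,d\mu=0$ and $$\lambda_{p,q}(\Omega)=\frac{\|\nabla_{min} u\|_{L^p(\Omega)}^p}{\|u\|_{L^q(\Omega)}^p}.$$ Further, $\lambda_{p,q}(\Omega)>0$.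
   Context: $(X,\rho,\mu)$ is a metric space $(X,\rho)$ with a Borel regular measure $\mu$ (balls have positive finite measure). It is doubling if there is a constant, the minimal one being denoted $C_\mu>0$, with $\mu(B(x,2r))\le C_\mu\,\mu(B(x,r))$ for all $x\in X$, $r>0$. A domain is a nonempty connected open set; a domain $\Omega\subset X$ is regarded as a metric measure space with the induced metric and measure. Upper gradients: for a function $f:Y\to\mathbb R$ on a metric measure space $Y$, a Borel function $g:Y\to[0,\infty]$ is a $p$-weak upper gradient of $f$ if $|f(\gamma(a))-f(\gamma(b))|\le\int_\gamma g\,ds$ for $p$-a.e. rectifiable curve $\gamma:[a,b]\to Y$, i.e. for all rectifiable curves outside a family of $p$-modulus zero. For $1<p<\infty$, if $f$ has a $p$-weak upper gradient in $L^p(Y)$, there is a minimal one, unique up to a set of measure zero, denoted $\nabla_{min}f$. Newtonian-Sobolev space: $N^{1,p}(Y)$, $1<p<\infty$, is the space of measurable $f:Y\to\mathbb R$ with $f\in L^p(Y)$ having a $p$-weak upper gradient in $L^p(Y)$, with norm $\|f\|_{N^{1,p}(Y)}=\|f\|_{L^p(Y)}+\|\nabla_{min}f\|_{L^p(Y)}$ (functions whose difference has norm zero are identified). Weak $p$-Poincaré inequality: $X$ supports it if there are constants $\sigma>1$ and $C_p$ such that for all balls $B\subset X$, all $f\in L^1(\sigma B)$ and all $p$-weak upper gradients $g$ of $f$ in $\sigma B$, $$\frac1{\mu(B)}\int_B|f-f_B|\,d\mu\le C_p\,\mathrm{diam}(B)\left(\frac1{\mu(\sigma B)}\int_{\sigma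 B}g^p\,d\mu\right)^{1/p},$$ where $f_B=\frac1{\mu(B)}\int_B f\,d\mu$. A domain $\Omega\subset X$ is a Sobolev $(p,p^{\ast})$-embedding domain if the embedding operator $i:N^{1,p}(\Omega)\to L^s(\Omega)$ is bounded for every $1<s\le p^{\ast}$ and compact for every $1<s<p^{\ast}$. *)

(* Defs.v *)
From HB Require Import structures.
From mathcomp Require Import all_boot all_order all_algebra.
From mathcomp Require Import all_classical all_reals all_analysis.
From mathcomp Require Import measurable_realfun.

Set Implicit Arguments.
Unset Strict Implicit.
Unset Printing Implicit Defensive.

Import Order.TTheory GRing.Theory Num.Theory.
Import numFieldNormedType.Exports.

Local Open Scope classical_set_scope.
Local Open Scope ring_scope.

(* The library's measurable types are pointed, so the metric space has to be
   nonempty; this costs nothing here, since domains are nonempty. *)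
#[short(type="pmetricType")]
HB.structure Definition PointedMetric (K : numDomainType) :=
  {M of Metric K M & isPointed M}.

Section MetricMeasureSpace.
Context {R : realType} {X : pmetricType R}.
Implicit Types (A D : set X) (mu : {outer_measure set X -> \bar R}).

Definition borel : set (set X) := <<s @open X >>.

Definition borel_fun D (g : X -> \bar R) : Prop :=
  measurable_fun (T := g_sigma_algebraType (@open X)) D g.

(* A Borel regular measure in the sense of metric measure theory: an outer
   measure on all subsets, for which Borel sets are Caratheodory measurable and
   every set has a Borel hull of the same measure. *)
Definition borel_regular mu : Prop :=
  borel `<=` mu.-caratheodory /\
  forall A, exists B, [/\ borel B, A `<=` B & mu A = mu B].

Definition metric_measure mu : Prop :=
  borel_regular mu /\
  forall (x : X) (r : R), 0 < r -> (0 < mu (ball x r) < +oo)%E.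

(* The measure induced on the sigma-algebra of Caratheodory measurable sets. *)
Definition cmeas mu : {measure set (caratheodory_type mu) -> \bar R} := mu.

Definition doubling_constants mu : set R :=
  [set C | forall (x : X) (r : R), 0 < r ->
     (mu (ball x (2 * r)) <= C%:E * mu (ball x r))%E].

Definition doubling mu : Prop := doubling_constants mu !=set0.

(* The infimum is attained, hence is the minimal doubling constant, because
   balls have positive finite measure. *)
Definition doubling_constant mu : R := inf (doubling_constants mu).

Definition hom_dim mu : R := ln (doubling_constant mu) / ln 2.

Definition diam A : \bar R :=
  ereal_sup [set (mdist z.1 z.2)%:E | z in A `*` A].

Definition domain D : Prop := [/\ D !=set0, open D & connected D].

End MetricMeasureSpace.

Section Curves.
Context {R : realType} {X : pmetricType R}.

(* Only the restriction of curve_map to [cstart, cend] is meaningful. *)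
Record curve := Curve {
  cstart : R;
  cend : R;
  curve_map :> R -> X;
  curve_le : cstart <= cend;
  curve_cont : {within `[cstart, cend], continuous curve_map} }.

Definition curve_length (gamma : R -> X) (a b : R) : \bar R :=
  ereal_sup [set (\sum_(0 <= n < size s)
                    mdist (gamma (nth b (a :: s) n))
                          (gamma (nth b (a :: s) n.+1)))%:E
            | s in [set s | itv_partition a b s]].

Definition length (gamma : curve) : \bar R :=
  curve_length gamma (cstart gamma) (cend gamma).

Definition rectifiable_curves_in (D : set X) : set curve :=
  [set gamma | (length gamma < +oo)%E /\
     forall t, t \in `[cstart gamma, cend gamma] -> D (gamma t)].

(* Arc-length parametrization on [0, length gamma]: the point reached at the
   last time at which the length travelled is t. *)
Definition arc_param (gamma : curve) (t : R) : X :=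
  gamma (sup [set u | u \in `[cstart gamma, cend gamma] /\
                      curve_length gamma (cstart gamma) u = t%:E]).

Definition line_integral (gamma : curve) (g : X -> \bar R) : \bar R :=
  (\int[lebesgue_measure]_(t in `[0%R, fine (length gamma)])
     g (arc_param gamma t))%E.

End Curves.

(* In what follows a subset D of X stands for the metric measure space D with the
   induced metric and measure. Functions on D are represented by functions on
   X whose values outside D are never used. *)
Section Newtonian.
Context {R : realType} {X : pmetricType R}.
Variable mu : {outer_measure set X -> \bar R}.
Implicit Types (D : set X) (f : X -> R) (g : X -> \bar R) (p q s r : R).

Definition Lp_norm p D g : \bar R := ('N[cmeas mu]_(p%:E)[g \_ D])%E.

Definition Lp_normr p D f : \bar R := Lp_norm p D (EFin \o f).

Definition in_Lp p D f : Prop :=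
  measurable_fun (T := caratheodory_type mu) D f /\
  (Lp_normr p D f < +oo)%E.

Definition nonneg_borel D g : Prop :=
  borel_fun D g /\ forall x, D x -> (0 <= g x)%E.

(* To be used for families Gamma of rectifiable curves in D. *)
Definition modulus p D (Gamma : set (@curve R X)) : \bar R :=
  ereal_inf [set (\int[cmeas mu]_(x in D) (rho x `^ p))%E
            | rho in [set rho | nonneg_borel D rho /\
                forall gamma, Gamma gamma -> (1 <= line_integral gamma rho)%E]].

Definition ae_curve p D (P : @curve R X -> Prop) : Prop :=
  exists Gamma : set (@curve R X),
    [/\ Gamma `<=` rectifiable_curves_in D,
        modulus p D Gamma = 0%E
      & forall gamma, rectifiable_curves_in D gamma -> ~ Gamma gamma ->
          P gamma].

Definition weak_upper_gradient p D f g : Prop :=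
  nonneg_borel D g /\
  ae_curve p D (fun gamma =>
    (`|f (gamma (cstart gamma)) - f (gamma (cend gamma))|%:E
       <= line_integral gamma g)%E).

Definition Lp_weak_upper_gradient p D f g : Prop :=
  weak_upper_gradient p D f g /\ (Lp_norm p D g < +oo)%E.

Definition minimal_weak_upper_gradient p D f g : Prop :=
  Lp_weak_upper_gradient p D f g /\
  forall h, Lp_weak_upper_gradient p D f h ->
    {ae cmeas mu, forall x, D x -> (g x <= h x)%E}.

(* A choice of a minimal weak upper gradient, which is unique up to a null set;
   the default value is irrelevant for functions that have one. *)
Definition nabla_min p D f : X -> \bar R :=
  xget (fun=> +oo%E) [set g | minimal_weak_upper_gradient p D f g].

(* Elements of N^{1,p}(D) are represented by functions; two of them are
   identified when the norm of their difference is zero. *)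
Definition newtonian p D : set (X -> R) :=
  [set f | in_Lp p D f /\ exists g, Lp_weak_upper_gradient p D f g].

Definition newtonian_norm p D f : \bar R :=
  (Lp_normr p D f + Lp_norm p D (nabla_min p D f))%E.

Definition mean D f : R :=
  fine (\int[cmeas mu]_(x in D) (f x)%:E)%E / fine (mu D).

Definition weak_poincare p : Prop :=
  exists sigma Cp : R, [/\ 1 < sigma, 0 < Cp &
    forall (x : X) (r : R), 0 < r ->
    let B := ball x r in
    let sB := ball x (sigma * r) in
    forall f g,
      (cmeas mu).-integrable sB (EFin \o f) ->
      weak_upper_gradient p sB f g ->
      ((mu B)^-1 * \int[cmeas mu]_(y in B) `|f y - mean B f|%:E
        <= Cp%:E * diam B *
           ((mu sB)^-1 * \int[cmeas mu]_(y in sB) (g y `^ p)) `^ p^-1)%E].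

Definition bounded_embedding p s D : Prop :=
  exists C : R, forall f, newtonian p D f ->
    in_Lp s D f /\ (Lp_normr s D f <= C%:E * newtonian_norm p D f)%E.

(* Bounded sequences are mapped to sequences with a convergent subsequence. *)
Definition compact_embedding p s D : Prop :=
  (forall f, newtonian p D f -> in_Lp s D f) /\
  forall (f_ : nat -> X -> R) (M : R),
    (forall n, newtonian p D (f_ n) /\ (newtonian_norm p D (f_ n) <= M%:E)%E) ->
    exists (phi : nat -> nat) (h : X -> R),
      [/\ increasing_seq phi, in_Lp s D h
        & (fun n => Lp_normr s D (f_ (phi n) \- h)) @ \oo --> 0%E].

Definition sobolev_embedding_domain p r D : Prop :=
  [/\ domain D,
      forall s, 1 < s -> s <= r -> bounded_embedding p s D
    & forall s, 1 < s -> s < r -> compact_embedding p s D].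

Definition sobolev_exponent p : R := hom_dim mu * p / (hom_dim mu - p).

(* Nonzero elements of N^{1,p}(D) satisfying the constraint. The integral is
   extended-real valued, and vanishes only if the positive and the negative
   parts of the integrand have the same finite integral. *)
Definition admissible p q D : set (X -> R) :=
  [set w | [/\ newtonian p D w, newtonian_norm p D w <> 0%E
    & (\int[cmeas mu]_(x in D) (`|w x| `^ (q - 2) * w x)%:E = 0)%E]].

Definition rayleigh p q D f : \bar R :=
  (Lp_norm p D (nabla_min p D f) `^ p / Lp_normr q D f `^ p)%E.

Definition lambda p q D : \bar R :=
  ereal_inf [set rayleigh p q D w | w in admissible p q D].

End Newtonian.

(* Main.v *)
(** The direct method. Testing the embedding into L^s, s < p, on cutoffs of balls
    of radius 4^k forces doubly exponential volume growth unless mu(Omega) is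
    finite, so doubling gives mu(Omega) < +oo. A minimizing sequence normalized in
    L^q is bounded in L^p, for otherwise a rescaled subsequence would converge to a
    function of norm 1 in L^p and 0 in L^q; by compactness a subsequence then
    converges in L^p and L^q, and dominated convergence preserves the constraint.
    Lower semicontinuity of the energy avoids reflexivity and Mazur's lemma:
    functions of nearly minimal energy in shrinking convex L^p-neighbourhoods of
    the limit have gradients that are Cauchy by uniform convexity, and tail suprema
    of these gradients are weak upper gradients of the pointwise upper limit. If
    lambda were 0, the Poincare inequality and connectedness would make the
    minimizer constant, and the constraint would make it 0. *)
Require Import Defs.
From HB Require Import structures.
From mathcomp Require Import all_boot all_order all_algebra.
From mathcomp Require Import all_classical all_reals all_analysis.
From mathcomp Require Import measurable_realfun.
From mathcomp Require Import ring lra.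

Set Implicit Arguments.
Unset Strict Implicit.
Unset Printing Implicit Defensive.

Import Order.TTheory GRing.Theory Num.Theory.
Import numFieldNormedType.Exports.

Local Open Scope classical_set_scope.
Local Open Scope ring_scope.

(** Three obstacles shape the proof. First, [nabla_min] is a choice that means something only once
    minimal weak upper gradients are known to exist. Existence rests on closure of upper gradients
    under minima, hence on control of all subcurves of almost every curve; exceptional families are
    therefore handled through weights of finite energy instead of the modulus itself. Second, weak
    upper gradients are Borel functions tested on individual curves, while [L^p] limits are classes
    modulo null sets. Tail suprema bridge the two: they are Borel, defined at every point, and
    dominate all later gradients along every curve. Third, the infimum is finite only if the
    constraint admits a function with nonzero [L^q] norm, which takes two points in [Omega].
    Positive dimension excludes a one-point space, and in a larger space the Poincare inequality
    excludes isolated points. Finiteness of the measure of [Omega] makes [|u| ^ (q - 1)] integrable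
    for [u] in [L^q], and bounded Lipschitz functions Newtonian. *)

(** * Length of curves and its additivity *)

Section CurveLength.
Context {R : realType} {X : pmetricType R}.
Implicit Types (f : R -> X) (a b c s t : R).

(** Recursive form of the indexed sum in [curve_length], so that partitions can be cut and
    concatenated by induction. *)
Fixpoint variation_sum f a (l : seq R) : R :=
  if l is b :: l' then mdist (f a) (f b) + variation_sum f b l' else 0.

Lemma variation_sumE f a b l :
  \sum_(0 <= n < size l) mdist (f (nth b (a :: l) n)) (f (nth b (a :: l) n.+1))
  = variation_sum f a l.
Proof.
elim: l a => [|c l ih] a; first by rewrite big_geq.
by rewrite [size _]/= big_nat_recl//= -ih.
Qed.

Lemma variation_sum_cat f a l l' : variation_sum f a (l ++ l') =
  variation_sum f a l + variation_sum f (last a l) l'.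
Proof. by elim: l a => [|c l ih] a /=; rewrite ?add0r// ih addrA. Qed.

Lemma curve_lengthE f a b : curve_length f a b =
  ereal_sup [set (variation_sum f a l)%:E | l in itv_partition a b].
Proof.
by congr ereal_sup; apply/seteqP; split=> _ [l abl <-]; exists l => //;
  rewrite variation_sumE.
Qed.

Lemma curve_length_sum f a b l : itv_partition a b l ->
  ((variation_sum f a l)%:E <= curve_length f a b)%E.
Proof. by move=> abl; rewrite curve_lengthE; apply: ereal_sup_ubound; exists l. Qed.

Lemma curve_lengthxx f a : curve_length f a a = 0%E.
Proof.
rewrite curve_lengthE; apply/eqP; rewrite eq_le; apply/andP; split.
  apply: ge_ereal_sup => _ [[|c l] [acl /eqP la] <-]; first exact: lexx.
  (* A strictly increasing path from [a] cannot end at [a], so only the empty partition is left. *)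
  have /allP/(_ a) := order_path_min lt_trans acl.
  by rewrite -[X in X \in _]la /= mem_last ltxx => /(_ isT).
by apply: ereal_sup_ubound; exists [::] => //; split => /=.
Qed.

Lemma mdist_le_curve_length f a b : a <= b ->
  ((mdist (f a) (f b))%:E <= curve_length f a b)%E.
Proof.
rewrite le_eqVlt => /predU1P[->|ab]; first by rewrite mdistxx curve_lengthxx.
have := @curve_length_sum f a b [:: b].
by rewrite /= addr0; apply; split => //=; rewrite ab.
Qed.

Lemma curve_length_ge0 f a b : a <= b -> (0 <= curve_length f a b)%E.
Proof.
by move=> ab; apply: le_trans (mdist_le_curve_length f ab); rewrite lee_fin mdist_ge0.
Qed.

Lemma curve_length_superadd f a b c : a <= c -> c <= b ->
  (curve_length f a c + curve_length f c b <= curve_length f a b)%E.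
Proof.
move=> ac cb; have ab := le_trans ac cb.
case E : (curve_length f a b) => [r||]; last 2 first.
- by rewrite leey.
- by have := curve_length_ge0 f ab; rewrite E.
have H l l' : itv_partition a c l -> itv_partition c b l' ->
    variation_sum f a l + variation_sum f c l' <= r.
  move=> [al /eqP lc] [cl' l'b].
  rewrite -lee_fin -E -[in variation_sum f c l']lc -variation_sum_cat.
  by apply: curve_length_sum; split; rewrite ?cat_path ?last_cat lc ?al.
have H1 l : itv_partition a c l ->
    (curve_length f c b <= (r - variation_sum f a l)%:E)%E.
  move=> al; rewrite curve_lengthE; apply: ge_ereal_sup => _ [l' cl' <-].
  by rewrite lee_fin lerBrDl H.
(* A single partition of [[a, c]] makes the bound [H1] finite, hence also [curve_length f c b],
   which can then be moved across the inequality before the second supremum is taken. *)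
have acn0 : exists l, itv_partition a c l.
  move: ac; rewrite le_eqVlt => /predU1P[->|ac].
    by exists [::]; split => /=.
  by exists [:: c]; split; rewrite //= ac.
have cbfin : curve_length f c b \is a fin_num.
  rewrite ge0_fin_numE ?curve_length_ge0//.
  by have [l /H1 h] := acn0; rewrite (le_lt_trans h)// ltry.
rewrite -leeBrDr//= curve_lengthE; apply: ge_ereal_sup => _ [l al <-].
rewrite leeBrDr//; move: (H1 _ al); rewrite -(fineK cbfin) -EFinD !lee_fin.
by rewrite lerBrDl.
Qed.

(** Induction on the partition: only the step that jumps over [c] has to be split, by the triangle
    inequality. *)
Lemma curve_length_subadd f a b c : a <= c -> c <= b ->
  (curve_length f a b <= curve_length f a c + curve_length f c b)%E.
Proof.
move=> ac cb; rewrite [leLHS]curve_lengthE; apply: ge_ereal_sup => _ [l abl <-].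
elim: l a ac abl => [|y l ih] a ac [al /eqP lb].
  by rewrite /= adde_ge0// curve_length_ge0.
move: al => /= /andP[ay yl]; have [yc|cy] := leP y c.
  have {}ih := ih _ yc (conj yl (introT eqP lb)).
  rewrite EFinD (le_trans (leeD2l _ ih))// addeA leeD2r//.
  apply: le_trans (curve_length_superadd f (ltW ay) yc).
  by rewrite leeD2r// mdist_le_curve_length// ltW.
have cyl : itv_partition c b (y :: l) by split; rewrite /= ?cy//; apply/eqP.
apply: le_trans (leeD (mdist_le_curve_length f ac) (curve_length_sum f cyl)).
by rewrite /= -EFinD lee_fin addrA lerD2r metric_triangle.
Qed.

Lemma curve_lengthD f a b c : a <= c -> c <= b ->
  curve_length f a b = (curve_length f a c + curve_length f c b)%E.
Proof.
move=> ac cb; apply/eqP; rewrite eq_le curve_length_subadd//=.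
by rewrite curve_length_superadd.
Qed.

End CurveLength.

(** * Arc-length parametrization *)

Lemma curve_continuousP {R : realType} {X : pmetricType R} (a b : R) (f : R -> X) :
  {within `[a, b], continuous f} ->
  forall t, t \in `[a, b] -> forall e : R, 0 < e -> exists2 d : R, 0 < d &
    forall s, s \in `[a, b] -> `|s - t| < d -> mdist (f t) (f s) < e.
Proof.
move=> fc t tab e e0; have tab' : t \in [set` `[a, b]] by rewrite inE.
move: (fc t) => /cvg_ballP/(_ e e0).
rewrite {1}/nbhs/= -(nbhs_subspace_in (A := `[a, b]%classic) (x := t))//.
case/nbhs_ballP => d d0 dP.
exists d => // s sab std; have := dP s; rewrite ballEmdist; apply.
- by rewrite /ball/= distrC.
- by [].
Qed.

Lemma path_le_last {R : realType} (x : R) l : path <%R x l -> x <= last x l.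
Proof.
elim: l x => //= y l ih x /andP[xy /ih]; exact: le_trans (ltW xy).
Qed.

Section ArcLength.
Context {R : realType} {X : pmetricType R}.
Variable gamma : @curve R X.
Implicit Types s t u x y e r : R.
Hypothesis rect : (length gamma < +oo)%E.
Local Notation a := (cstart gamma).
Local Notation b := (cend gamma).
Let len u : R := fine (curve_length gamma a u).
Let L : R := fine (length gamma).
Let arc_time (t : R) : R :=
  sup [set u | u \in `[a, b] /\ curve_length gamma a u = t%:E].

Let curve_length_fin s t : a <= s -> s <= t -> t <= b ->
  curve_length gamma s t \is a fin_num.
Proof.
move=> as_ st tb; rewrite ge0_fin_numE ?curve_length_ge0//.
apply: le_lt_trans rect; rewrite /length (curve_lengthD gamma as_ (le_trans st tb)).
rewrite (curve_lengthD gamma st tb).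
rewrite (@le_trans _ _ (curve_length gamma s t + curve_length gamma t b)%E)//.
  by rewrite leeDl ?curve_length_ge0.
by rewrite leeDr ?curve_length_ge0.
Qed.

Let curve_length_diff s t : a <= s -> s <= t -> t <= b ->
  curve_length gamma s t = (len t - len s)%:E.
Proof.
move=> as_ st tb; rewrite /len (curve_lengthD gamma as_ st) fineD ?curve_length_fin//.
  by rewrite addrC addKr fineK// curve_length_fin.
exact: le_trans st tb.
Qed.

Let len_le s t : a <= s -> s <= t -> t <= b -> len s <= len t.
Proof.
move=> as_ st tb; rewrite -subr_ge0 -lee_fin -curve_length_diff//.
exact: curve_length_ge0.
Qed.

Let len0 : len a = 0. Proof. by rewrite /len curve_lengthxx. Qed.

Let curve_length_right x y e : a <= x -> x < y -> y <= b -> 0 < e ->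
  exists2 c, x < c < y & len c - len x < e.
Proof.
move=> ax xy yb e0.
have xab : x \in `[a, b] by rewrite in_itv/= ax (le_trans (ltW xy)).
have fin := curve_length_fin ax (ltW xy) yb.
move: (fin); rewrite curve_lengthE => fin'.
have e20 : 0 < e / 2 by rewrite divr_gt0.
have [_ [[|z l] pl <-]] := ub_ereal_sup_adherent e20 fin'.
  by case: pl => _ /= /eqP xe; move: xy; rewrite xe ltxx.
rewrite -curve_lengthE => le.
have [d d0 dP] := curve_continuousP (@curve_cont _ _ gamma) xab e20.
case: pl => /= /andP[xz zl] /eqP lz.
have zy : z <= y.
  by rewrite -lz; exact: path_le_last.
pose c := x + Num.min d (z - x) / 2.
have m0 : 0 < Num.min d (z - x) by rewrite lt_min d0 subr_gt0.
have xc : x < c by rewrite ltrDl divr_gt0.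
have cz : c < z.
  have : Num.min d (z - x) <= z - x by rewrite ge_min lexx orbT.
  by rewrite /c; move: m0; set m := Num.min _ _; lra.
have cd : c - x < d.
  have : Num.min d (z - x) <= d by rewrite ge_min lexx.
  by rewrite /c; move: m0; set m := Num.min _ _; lra.
have cy : c < y by rewrite (lt_le_trans cz).
exists c; first by rewrite xc.
have cab : c \in `[a, b].
  by rewrite in_itv/= (le_trans ax (ltW xc)) (le_trans (ltW cy)).
have xce : mdist (gamma x) (gamma c) < e / 2.
  by apply: dP => //; rewrite gtr0_norm// subr_gt0.
have cl : itv_partition c y (z :: l) by split; rewrite /= ?cz//; apply/eqP.
have := curve_length_sum gamma cl; move: le.
have ac := le_trans ax (ltW xc).
rewrite !curve_length_diff// ?(ltW xy)// ?(ltW cy)// -EFinB !lte_fin !lee_fin /=.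
have := metric_triangle (gamma x) (gamma c) (gamma z).
lra.
Qed.

(** The mirror image, with the last point of the partition moved. *)
Let curve_length_left x y e : a <= x -> x < y -> y <= b -> 0 < e ->
  exists2 c, x < c < y & len y - len c < e.
Proof.
move=> ax xy yb e0.
have yab : y \in `[a, b] by rewrite in_itv/= yb (le_trans ax (ltW xy)).
have fin := curve_length_fin ax (ltW xy) yb.
move: (fin); rewrite curve_lengthE => fin'.
have e20 : 0 < e / 2 by rewrite divr_gt0.
have [_ [l + <-]] := ub_ereal_sup_adherent e20 fin'.
rewrite -curve_lengthE; case: (lastP l) => [|{}l z].
  by case=> _ /= /eqP xe; move: xy; rewrite xe ltxx.
case; rewrite rcons_path last_rcons => /andP[xl lz] /eqP zy; subst z.
rewrite -cats1 variation_sum_cat /= addr0 => le.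
have [d d0 dP] := curve_continuousP (@curve_cont _ _ gamma) yab e20.
set v := last x l in lz le.
have xv : x <= v.
  exact: path_le_last.
pose c := y - Num.min d (y - v) / 2.
have m0 : 0 < Num.min d (y - v) by rewrite lt_min d0 subr_gt0.
have cy : c < y by rewrite /c; move: m0; set m := Num.min _ _; lra.
have vc : v < c.
  have : Num.min d (y - v) <= y - v by rewrite ge_min lexx orbT.
  by rewrite /c; move: m0; set m := Num.min _ _; lra.
have cd : y - c < d.
  have : Num.min d (y - v) <= d by rewrite ge_min lexx.
  by rewrite /c; move: m0; set m := Num.min _ _; lra.
have xc : x < c by rewrite (le_lt_trans xv).
exists c; first by rewrite xc.
have cab : c \in `[a, b].
  by rewrite in_itv/= (le_trans ax (ltW xc)) (le_trans (ltW cy)).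
have yce : mdist (gamma y) (gamma c) < e / 2.
  by apply: dP => //; rewrite distrC gtr0_norm// subr_gt0.
have cl : itv_partition x c (rcons l c).
  by split; rewrite ?rcons_path ?last_rcons// xl.
have := curve_length_sum gamma cl; rewrite -cats1 variation_sum_cat /= addr0 -/v.
move: le.
rewrite !curve_length_diff// ?(ltW xy)// ?(ltW cy)// ?(ltW xc)//; last first.
  by rewrite (le_trans (ltW cy)).
rewrite -EFinB !lte_fin !lee_fin /=.
have := metric_triangle (gamma v) (gamma c) (gamma y).
rewrite (metric_sym (gamma c)).
lra.
Qed.

(** Intermediate value theorem by hand: at the supremum of the times with [len <= t], continuity
    from the right excludes a value below [t] and continuity from the left a value above it. *)
Let len_surj t : 0 <= t <= L -> exists2 u, u \in `[a, b] & len u = t.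
Proof.
move=> /andP[t0 tL]; have ab := curve_le gamma.
pose A := [set u | u \in `[a, b] /\ len u <= t].
have Aa : A a by rewrite /A/= in_itv/= lexx ab len0.
have ubA : ubound A b by move=> u [/=]; rewrite in_itv/= => /andP[].
have hsA : has_sup A by split; [exists a | exists b].
set u := sup A.
have au : a <= u by apply: ub_le_sup => //; exists b.
have ub : u <= b by apply: ge_sup => //; exists a.
exists u; first by rewrite in_itv/= au.
have [lt|lt|//] := ltgtP (len u) t.
- have ltb : u < b.
    rewrite lt_neqAle ub andbT; apply/eqP => E.
    by move: tL; rewrite leNgt -[L]/(len b) -E lt.
  have := curve_length_right au ltb (lexx _).
  move=> /(_ (t - len u)); rewrite subr_gt0 lt => /(_ isT)[c /andP[uc cb]].
  rewrite ltrD2r => ct.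
  have : c <= u.
    apply: ub_le_sup; first by exists b.
    by rewrite /A/= in_itv/= (ltW cb) (le_trans au (ltW uc)) (ltW ct).
  by rewrite leNgt uc.
- have lta : a < u.
    rewrite lt_neqAle au andbT; apply/eqP => E.
    by move: lt; rewrite -E len0 ltNge t0.
  have := curve_length_left (lexx _) lta ub.
  move=> /(_ (len u - t)); rewrite subr_gt0 lt => /(_ isT)[c /andP[ac cu]].
  rewrite ltrD2l ltrN2 => tc.
  have : u <= c.
    apply: ge_sup; first by exists a.
    move=> v [/=]; rewrite in_itv/= => /andP[av vb] vt.
    rewrite leNgt; apply/negP => cv.
    by have := len_le (ltW ac) (ltW cv) vb; rewrite leNgt (le_lt_trans vt).
  by rewrite leNgt cu.
Qed.

Let arc_setE t : [set u | u \in `[a, b] /\ curve_length gamma a u = t%:E] =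
  [set u | u \in `[a, b] /\ len u = t].
Proof.
apply/seteqP; split=> u [uab]; move: (uab); rewrite in_itv/= => /andP[au ub].
  by rewrite /len => ->.
by move=> <-; split => //; rewrite /len fineK// curve_length_fin.
Qed.

(** The level set of [len] is nonempty by [len_surj], and its supremum still has the value [t]
    because [len] is continuous from the left. *)
Let arc_timeP t : 0 <= t <= L ->
  [/\ a <= arc_time t, arc_time t <= b & len (arc_time t) = t].
Proof.
move=> tL; have [u0 u0ab u0t] := len_surj tL.
rewrite /arc_time arc_setE; set A := [set _ | _].
have Au0 : A u0 by [].
have ubA : ubound A b by move=> u [/=]; rewrite in_itv/= => /andP[].
have aA u : A u -> a <= u by move=> [/=]; rewrite in_itv/= => /andP[].
set u := sup A.
have u0u : u0 <= u by apply: ub_le_sup => //; exists b.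
have au : a <= u by apply: le_trans u0u; apply: aA.
have ub : u <= b by apply: ge_sup => //; exists u0.
split => //; apply/eqP; rewrite eq_le; apply/andP; split; last first.
  by rewrite -[leLHS]u0t len_le// aA.
rewrite leNgt; apply/negP => lt.
have lta : a < u.
  rewrite lt_neqAle au andbT; apply/eqP => E.
  by move: lt; rewrite -E len0 ltNge; case/andP: tL => ->.
have := curve_length_left (lexx _) lta ub.
move=> /(_ (len u - t)); rewrite subr_gt0 lt => /(_ isT)[c /andP[ac cu]].
rewrite ltrD2l ltrN2 => tc.
have : u <= c.
  apply: ge_sup; first by exists u0.
  move=> v [/=]; rewrite in_itv/= => /andP[av vb] vt.
  rewrite leNgt; apply/negP => cv.
  by have := len_le (ltW ac) (ltW cv) vb; rewrite leNgt vt tc.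
by rewrite leNgt cu.
Qed.

Let arc_time_ub t u : u \in `[a, b] -> len u = t -> u <= arc_time t.
Proof.
move=> uab ut; rewrite /arc_time arc_setE; apply: ub_le_sup => //.
by exists b => v [/=]; rewrite in_itv/= => /andP[].
Qed.

Let arc_time_le s t : 0 <= s -> s <= t -> t <= L -> arc_time s <= arc_time t.
Proof.
move=> s0 st tL.
have [as1 sb ls] : [/\ a <= arc_time s, arc_time s <= b & len (arc_time s) = s].
  by apply: arc_timeP; rewrite s0 (le_trans st).
have [at1 tb lt] : [/\ a <= arc_time t, arc_time t <= b & len (arc_time t) = t].
  by apply: arc_timeP; rewrite tL (le_trans s0).
move: st; rewrite le_eqVlt => /predU1P[->//|st].
rewrite leNgt; apply/negP => ts.
by have := len_le at1 (ltW ts) sb; rewrite lt ls leNgt st.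
Qed.

Lemma fine_length_ge0 : 0 <= fine (length gamma).
Proof. by rewrite fine_ge0// curve_length_ge0// curve_le. Qed.

Lemma fine_lengthK : (fine (length gamma))%:E = length gamma.
Proof. by rewrite fineK// curve_length_fin ?curve_le. Qed.

Lemma mdist_arc_param s t : 0 <= s -> s <= t -> t <= L ->
  mdist (arc_param gamma s) (arc_param gamma t) <= t - s.
Proof.
move=> s0 st tL.
have [as1 sb ls] : [/\ a <= arc_time s, arc_time s <= b & len (arc_time s) = s].
  by apply: arc_timeP; rewrite s0 (le_trans st).
have [at1 tb lt] : [/\ a <= arc_time t, arc_time t <= b & len (arc_time t) = t].
  by apply: arc_timeP; rewrite tL (le_trans s0).
have stt := arc_time_le s0 st tL.
by have := mdist_le_curve_length gamma stt; rewrite curve_length_diff// lt ls lee_fin.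
Qed.

Lemma arc_param_end : arc_param gamma L = gamma b.
Proof.
have ab := curve_le gamma.
rewrite /arc_param; congr (gamma _).
have [aL Lb lL] : [/\ a <= arc_time L, arc_time L <= b & len (arc_time L) = L].
  by apply: arc_timeP; rewrite lexx fine_length_ge0.
apply/eqP; rewrite eq_le Lb arc_time_ub//.
by rewrite in_itv/= ab lexx.
Qed.

(** The last time at which the travelled length is [0] may lie after [a], but the curve has not
    moved until then. *)
Lemma arc_param_start : arc_param gamma 0 = gamma a.
Proof.
have ab := curve_le gamma.
have [aL Lb lL] : [/\ a <= arc_time 0, arc_time 0 <= b & len (arc_time 0) = 0].
  by apply: arc_timeP; rewrite lexx fine_length_ge0.
apply/esym/mdist_positivity/eqP; rewrite eq_le mdist_ge0 andbT.
rewrite -lee_fin (le_trans (mdist_le_curve_length _ aL))//.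
by rewrite curve_length_diff// lL len0 subrr.
Qed.

Lemma arc_param_in t : 0 <= t <= L ->
  exists2 u, u \in `[a, b] & arc_param gamma t = gamma u.
Proof.
by move=> /arc_timeP[at1 tb lt]; exists (arc_time t); rewrite // in_itv/= at1.
Qed.

(** Restricting [gamma] to the times between [arc_time s] and [arc_time t] gives a curve whose own
    arc-length parametrization is a translate of the old one. *)
Lemma subcurve s t : 0 <= s -> s <= t -> t <= L ->
  exists eta : @curve R X, [/\ length eta = (t - s)%:E,
    forall u, u \in `[cstart eta, cend eta] ->
      exists2 v, v \in `[a, b] & eta u = gamma v,
    eta (cstart eta) = arc_param gamma s, eta (cend eta) = arc_param gamma t &
    forall r : R, 0 <= r <= t - s -> arc_param eta r = arc_param gamma (s + r)].
Proof.
move=> s0 st tL.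
have [as1 sb ls] : [/\ a <= arc_time s, arc_time s <= b & len (arc_time s) = s].
  by apply: arc_timeP; rewrite s0 (le_trans st).
have [at1 tb lt] : [/\ a <= arc_time t, arc_time t <= b & len (arc_time t) = t].
  by apply: arc_timeP; rewrite tL (le_trans s0).
have stt := arc_time_le s0 st tL.
have cont : {within `[arc_time s, arc_time t], continuous gamma}.
  apply: continuous_subspaceW (@curve_cont _ _ gamma).
  move=> u /=; rewrite !in_itv/= => /andP[h1 h2].
  by rewrite (le_trans as1)//= (le_trans h2).
exists (Curve stt cont); split => //.
- by rewrite /length/= curve_length_diff// lt ls.
- move=> u /=; rewrite in_itv/= => /andP[h1 h2]; exists u => //.
  by rewrite in_itv/= (le_trans as1)//= (le_trans h2).
move=> r /andP[r0 rts]; rewrite /arc_param /=; congr (gamma _).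
have srL : s + r <= L by lra.
have sr0 : 0 <= s + r by lra.
have [ar1 rb lr] : [/\ a <= arc_time (s + r), arc_time (s + r) <= b &
    len (arc_time (s + r)) = s + r].
  by apply: arc_timeP; rewrite sr0.
(* The length along the restriction is [len u - s], so the last time at which it equals [r] is the
   last time at which [len] equals [s + r]. *)
rewrite -/(arc_time (s + r)); set A := [set _ | _].
have ubA : ubound A (arc_time (s + r)).
  move=> u [/=]; rewrite in_itv/= => /andP[su ut].
  have au := le_trans as1 su.
  rewrite curve_length_diff//; last exact: le_trans tb.
  move=> [] ur; apply: arc_time_ub; last by lra.
  by rewrite in_itv/= au (le_trans ut).
have Ar : A (arc_time (s + r)).
  have h1 : arc_time s <= arc_time (s + r) by apply: arc_time_le => //; lra.
  have h2 : arc_time (s + r) <= arc_time t by apply: arc_time_le => //; lra.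
  split; first by rewrite in_itv/= h1.
  by rewrite curve_length_diff// lr ls addrC addKr.
apply/eqP; rewrite eq_le; apply/andP; split.
  by apply: ge_sup => //; exists (arc_time (s + r)).
by apply: ub_le_sup => //; exists (arc_time (s + r)).
Qed.

End ArcLength.

(** * Line integrals and subcurves *)

Section IntegralShift.
Context {R : realType}.
Local Notation mu := (@lebesgue_measure R).

Let measurable_shift (s : R) :
  measurable_fun [set: R] (fun x => s + x : measurableTypeR R).
Proof. exact: measurable_funD. Qed.

Lemma lebesgue_measure_shift (s : R) (A : set R) : measurable A ->
  pushforward mu (fun x => s + x : measurableTypeR R) A = mu A.
Proof.
move=> mA; apply/esym/lebesgue_measure_unique => //; first exact: measurable_shift.
move=> ? _ [[a b]] _ <- /=.
rewrite /pushforward.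
have -> : (fun x => s + x) @^-1` [set` `]a, b]] = [set` `]a - s, b - s]].
  by apply/seteqP; split=> x /=; rewrite !in_itv/=; lra.
rewrite !lebesgue_measure_itv/= !lte_fin ltrD2r.
by case: ifPn => // _; rewrite -!EFinB; congr EFin; lra.
Qed.

Lemma ge0_integral_shift (s u v : R) (f : R -> \bar R) :
  measurable_fun `[u, v] f -> (forall x, `[u, v]%classic x -> (0 <= f x)%E) ->
  (\int[mu]_(x in `[(u - s)%R, (v - s)%R]) f (s + x)%R = \int[mu]_(x in `[u, v]) f x)%E.
Proof.
move=> mf f0.
have -> : [set` `[u - s, v - s]] =
    (fun x => s + x : measurableTypeR R) @^-1` [set` `[u, v]].
  by apply/seteqP; split=> x /=; rewrite !in_itv/=; lra.
have ms : measurable_fun [set: measurableTypeR R] (fun x => s + x : measurableTypeR R).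
  exact: measurable_shift.
rewrite -[LHS](ge0_integral_pushforward ms _ _ mf)//; last first.
  by move=> x; rewrite inE => /f0.
by apply: eq_measure_integral => //= A mA AS; exact: lebesgue_measure_shift.
Qed.

End IntegralShift.

Section LineIntegral.
Context {R : realType} {X : pmetricType R}.
Implicit Types (D : set X) (g h : X -> \bar R) (gamma : @curve R X).
Local Notation leb := (@lebesgue_measure R).

Lemma arc_param_in_set D gamma : rectifiable_curves_in D gamma ->
  forall t, t \in `[0, fine (length gamma)] -> D (arc_param gamma t).
Proof.
move=> [rg gD] t; rewrite in_itv/= => tL.
by have [u uab ->] := arc_param_in rg tL; exact: gD.
Qed.

Lemma measurable_arc_param D gamma g : open D -> borel_fun D g ->
  rectifiable_curves_in D gamma ->
  measurable_fun `[0, fine (length gamma)] (g \o arc_param gamma).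
Proof.
move=> oD mg gD; have rg := gD.1; set L := fine _.
have L0 : 0 <= L by exact: fine_length_ge0.
(* Clamping the parameter to [[0, L]] extends the arc-length parametrization to a 1-Lipschitz map on
   the whole line, so preimages of open sets are open. *)
pose clamp (t : R) := Num.max 0 (Num.min t L).
have clampP t : 0 <= clamp t <= L.
  by rewrite /clamp le_max lexx/= ge_max L0 ge_min lexx orbT.
have clamp_id t : t \in `[0, L] -> clamp t = t.
  rewrite in_itv/= => /andP[t0 tL]; rewrite /clamp min_l// max_r//.
have clamp_lip s t : s <= t -> clamp s <= clamp t <= clamp s + (t - s).
  clear -L0; rewrite /clamp /Order.max /Order.min => st.
  by case: (ltP s L) => ?; case: (ltP t L) => ?; repeat case: ltP => ?; lra.
pose f t := arc_param gamma (clamp t) : g_sigma_algebraType (@open X).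
have f_lip s t : s <= t -> mdist (f s) (f t) <= t - s.
  move=> st; have /andP[cst cts] := clamp_lip _ _ st.
  have /andP[s0 sL] := clampP s; have /andP[t0 tL] := clampP t.
  by rewrite (le_trans (mdist_arc_param rg s0 cst tL))// lerBlDl.
have f_lip' s t : mdist (f s) (f t) <= `|s - t|.
  have [st|/ltW ts] := leP s t.
    by rewrite distrC ger0_norm ?subr_ge0// f_lip.
  by rewrite ger0_norm ?subr_ge0// metric_sym f_lip.
have mf : measurable_fun [set: R] f.
  apply: measurability => //.
  move=> _ [U oU <-]; rewrite setTI; apply: open_measurable.
  rewrite openE => t Ut; have := oU; rewrite openE => /(_ _ Ut).
  move=> /nbhs_ballP[e e0 eU]; apply/nbhs_ballP; exists e => // s ts.
  by apply: eU; rewrite ballEmdist/= (le_lt_trans (f_lip' _ _)).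
move=> mL Y mY.
(* [g] is Borel on [D] only; intersecting with [D] changes nothing because the curve stays in
   [D]. *)
have -> : `[0, L] `&` (g \o arc_param gamma) @^-1` Y =
   `[0, L] `&` f @^-1` (D `&` g @^-1` Y).
  apply/seteqP; split => t [tL]/=; rewrite /f clamp_id//.
    by move=> gY; do 2 split => //; exact: arc_param_in_set gD _ tL.
  by case.
apply: measurableI => //; rewrite -[X in measurable X]setTI.
apply: mf => //; apply: mg => //.
by apply: sub_sigma_algebra.
Qed.

Lemma line_integral_ge0 D gamma g : nonneg_borel D g ->
  rectifiable_curves_in D gamma -> (0 <= line_integral gamma g)%E.
Proof.
by move=> [_ g0] gD; apply: integral_ge0 => t tL; exact/g0/(arc_param_in_set gD).
Qed.

Lemma le_line_integral D gamma g h : open D -> nonneg_borel D g ->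
  nonneg_borel D h -> rectifiable_curves_in D gamma ->
  (forall x, D x -> (g x <= h x)%E) ->
  (line_integral gamma g <= line_integral gamma h)%E.
Proof.
move=> oD [mg g0] [mh h0] gD gh; apply: ge0_le_integral => //.
- by move=> t tL; exact/g0/(arc_param_in_set gD).
- exact: measurable_arc_param gD.
- exact: measurable_arc_param gD.
- by move=> t tL; exact/gh/(arc_param_in_set gD).
Qed.

Lemma line_integral_cst gamma (c : R) : (length gamma < +oo)%E -> 0 <= c ->
  line_integral gamma (cst c%:E) = (c%:E * length gamma)%E.
Proof.
move=> rg c0; have := fine_length_ge0 gamma.
rewrite /line_integral integral_cst//= lebesgue_measure_itv/= => L0.
rewrite lte_fin; case: ltP => L1; first by rewrite oppr0 adde0 fine_lengthK.
by rewrite -(fine_lengthK rg) (le_anti (introT andP (conj L1 L0))).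
Qed.

Lemma line_integralZ D gamma g (c : R) : open D -> nonneg_borel D g ->
  rectifiable_curves_in D gamma -> 0 <= c ->
  line_integral gamma (fun x => c%:E * g x)%E = (c%:E * line_integral gamma g)%E.
Proof.
move=> oD [mg g0] gD c0; rewrite /line_integral ge0_integralZl_EFin//.
- by move=> t tL; exact/g0/(arc_param_in_set gD).
- exact: measurable_arc_param gD.
Qed.

Lemma line_integralD D gamma g h : open D -> nonneg_borel D g ->
  nonneg_borel D h -> rectifiable_curves_in D gamma ->
  line_integral gamma (fun x => g x + h x)%E =
  (line_integral gamma g + line_integral gamma h)%E.
Proof.
move=> oD [mg g0] [mh h0] gD; rewrite /line_integral ge0_integralD//.
- by move=> t tL; exact/g0/(arc_param_in_set gD).
- exact: measurable_arc_param gD.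
- by move=> t tL; exact/h0/(arc_param_in_set gD).
- exact: measurable_arc_param gD.
Qed.

Lemma line_integral_subcurve D gamma (s t : R) : open D ->
  rectifiable_curves_in D gamma -> 0 <= s -> s <= t -> t <= fine (length gamma) ->
  exists eta, [/\ rectifiable_curves_in D eta,
    eta (cstart eta) = arc_param gamma s, eta (cend eta) = arc_param gamma t &
    forall g, nonneg_borel D g ->
      line_integral eta g = (\int[leb]_(r in `[s, t]) g (arc_param gamma r))%E].
Proof.
move=> oD gD s0 st tL; have [eta [le sub es et arc]] := subcurve gD.1 s0 st tL.
exists eta; split => //.
  split; first by rewrite le ltry.
  by move=> u uab; have [v vab ->] := sub _ uab; exact: gD.2.
move=> g [mg g0]; rewrite /line_integral le/=.
have stL : `[s, t] `<=` `[0, fine (length gamma)].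
  by move=> r /=; rewrite !in_itv/= => /andP[sr rt]; rewrite (le_trans s0)// (le_trans rt).
rewrite -[RHS](@ge0_integral_shift _ s).
- rewrite subrr; apply: eq_integral => r; rewrite inE/= in_itv/= => rst.
  by rewrite arc.
- by apply: measurable_funS (measurable_arc_param oD mg gD).
- by move=> r /stL rL; exact/g0/(arc_param_in_set gD).
Qed.

End LineIntegral.

(** * Suprema of Borel weights, modulus and exceptional curve families *)

Lemma le_poweR {R : realType} (x y : \bar R) (r : R) :
  0 <= r -> (0 <= x)%E -> (x <= y)%E -> (x `^ r <= y `^ r)%E.
Proof.
move=> r0 x0 xy; apply: gt0_ler_poweR => //; rewrite in_itv/= leey andbT//.
exact: le_trans xy.
Qed.

Lemma poweRK {R : realType} (x : \bar R) (r : R) :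
  0 < r -> (0 <= x)%E -> ((x `^ r) `^ r^-1 = x)%E.
Proof. by move=> r0 x0; rewrite -poweRrM divff ?gt_eqF// poweRe1. Qed.

Lemma poweRVK {R : realType} (x : \bar R) (r : R) :
  0 < r -> (0 <= x)%E -> ((x `^ r^-1) `^ r = x)%E.
Proof. by move=> r0 x0; rewrite -poweRrM mulVf ?gt_eqF// poweRe1. Qed.

Lemma esups_ub {R : realType} (u : (\bar R)^nat) (n m : nat) : (n <= m)%N ->
  (u m <= esups u n)%E.
Proof. by move=> nm; apply: ereal_sup_ubound; exists m. Qed.

Lemma esups_le {R : realType} (u : (\bar R)^nat) (n : nat) (l : \bar R) :
  (forall m, (n <= m)%N -> (u m <= l)%E) -> (esups u n <= l)%E.
Proof. by move=> ul; apply: ge_ereal_sup => _ [m nm <-]; exact: ul. Qed.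

(** Integrated, this bounds the energy of a supremum of weights by the sum of their energies. *)
Lemma esups_poweR_le {R : realType} (u : (\bar R)^nat) (n : nat) (r : R) :
  0 < r -> (forall m, (0 <= u m)%E) ->
  ((esups u n) `^ r <= \sum_(n <= m <oo) (u m `^ r))%E.
Proof.
move=> r0 u0; set s := (\sum_(n <= m <oo) _)%E.
have s0 : (0 <= s)%E by apply: nneseries_ge0 => *; exact: poweR_ge0.
rewrite -[leRHS](poweRVK r0 s0); apply: le_poweR; first exact: ltW.
  by apply: le_trans (esups_ub u (leqnn n)); exact: u0.
apply: esups_le => m nm; rewrite -[leLHS](poweRK r0 (u0 m)).
apply: le_poweR; [by rewrite invr_ge0 ltW|exact: poweR_ge0|].
apply: le_trans (nneseries_lim_ge m.+1 _); last by move=> *; exact: poweR_ge0.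
by rewrite big_nat_recr//= leeDr// sume_ge0// => i _; exact: poweR_ge0.
Qed.

Section BorelMeasurability.
Context {R : realType} {X : pmetricType R}.
Variable mu : {outer_measure set X -> \bar R}.
Hypothesis mmu : metric_measure mu.
Implicit Types (D : set X) (g h : X -> \bar R).

Lemma borel_measurable D : borel D -> measurable (D : set (caratheodory_type mu)).
Proof. exact: mmu.1.1. Qed.

Lemma open_borel D : open D -> borel D.
Proof. exact: sub_sigma_algebra. Qed.

Lemma measurable_open D : open D -> measurable (D : set (caratheodory_type mu)).
Proof. by move=> /open_borel/borel_measurable. Qed.

Lemma borel_fun_measurable D g : open D -> borel_fun D g ->
  measurable_fun (T := caratheodory_type mu) D g.
Proof.
move=> oD mg _ Y mY; apply: borel_measurable; apply: mg => //.
exact: open_borel.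
Qed.

Lemma measurable_fun_poweR d (T : measurableType d) (A : set T) (f : T -> \bar R) (r : R) :
  measurable_fun A f -> measurable_fun A (fun x => (f x `^ r)%E).
Proof. by move=> mf; exact: (measurableT_comp (measurable_poweR r)). Qed.

Lemma nonneg_borelZ D g (c : R) : 0 <= c -> nonneg_borel D g ->
  nonneg_borel D (fun x => c%:E * g x)%E.
Proof.
move=> c0 [mg g0]; split; first exact: measurable_funeM.
by move=> x Dx; rewrite mule_ge0 ?g0.
Qed.

Lemma nonneg_borelD D g h : nonneg_borel D g -> nonneg_borel D h ->
  nonneg_borel D (fun x => g x + h x)%E.
Proof.
move=> [mg g0] [mh h0]; split; first exact: emeasurable_funD.
by move=> x Dx; rewrite adde_ge0 ?g0 ?h0.
Qed.

Lemma nonneg_borel_esups D (g : nat -> X -> \bar R) n :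
  (forall n, nonneg_borel D (g n)) -> nonneg_borel D (fun x => esups (g^~ x) n).
Proof.
move=> gb; split.
  by apply: measurable_fun_esups => m; exact: (gb m).1.
move=> x Dx; apply: le_trans (esups_ub (g^~ x) (leqnn n)).
exact: (gb n).2.
Qed.

End BorelMeasurability.

Section Modulus.
Context {R : realType} {X : pmetricType R}.
Variable mu : {outer_measure set X -> \bar R}.
Hypothesis mmu : metric_measure mu.
Variables (p : R) (D : set X).
Hypotheses (p0 : 0 < p) (oD : open D).
Implicit Types (g h : X -> \bar R) (gamma : @curve R X).

(** No root is taken, because [p]-th powers are what can be summed and minimized. Meant for
    nonnegative [g]; a real function enters as [|f x|%:E]. *)
Definition energy (r : R) (A : set X) (g : X -> \bar R) : \bar R :=
  (\int[cmeas mu]_(x in A) (g x `^ r))%E.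

Let mD : measurable (D : set (caratheodory_type mu)).
Proof. exact: measurable_open. Qed.

Lemma energy_ge0 r A g : (0 <= energy r A g)%E.
Proof. by apply: integral_ge0 => x _; exact: poweR_ge0. Qed.

Lemma measurable_energy g : nonneg_borel D g ->
  measurable_fun (T := caratheodory_type mu) D (fun x => (g x `^ p)%E).
Proof.
by move=> [mg _]; apply: measurable_fun_poweR; exact: borel_fun_measurable.
Qed.

Lemma le_energy g h : nonneg_borel D g -> nonneg_borel D h ->
  (forall x, D x -> (g x <= h x)%E) -> (energy p D g <= energy p D h)%E.
Proof.
move=> gb hb gh; apply: ge0_le_integral => //.
- by move=> x _; exact: poweR_ge0.
- exact: measurable_energy.
- exact: measurable_energy.
- by move=> x Dx; apply: le_poweR; [exact: ltW|exact: gb.2|exact: gh].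
Qed.

Lemma energyZ g (c : R) : 0 <= c -> nonneg_borel D g ->
  energy p D (fun x => c%:E * g x)%E = ((c `^ p)%:E * energy p D g)%E.
Proof.
move=> c0 gb; rewrite /energy -ge0_integralZl_EFin//.
- by apply: eq_integral => x; rewrite inE => Dx; rewrite poweRM ?poweR_EFin// gb.2.
- by move=> x _; exact: poweR_ge0.
- exact: measurable_energy.
- exact: powR_ge0.
Qed.

Lemma energy_esups (g : nat -> X -> \bar R) :
  (forall n, nonneg_borel D (g n)) ->
  (forall n, (energy p D (g n) <= (1 / (2 ^ n.+1)%:R)%:E)%E) ->
  (energy p D (fun x => esups (g^~ x) 0%N) <= 1%E)%E.
Proof.
move=> gb gE.
apply: (@le_trans _ _ (\int[cmeas mu]_(x in D) \sum_(0 <= m <oo) (g m x `^ p))%E).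
  apply: ge0_le_integral => //.
  - by move=> x _; exact: poweR_ge0.
  - exact/measurable_energy/nonneg_borel_esups.
  - apply: ge0_emeasurable_sum => [*|m _]; first exact: poweR_ge0.
    exact: measurable_energy.
  - by move=> x Dx; apply: esups_poweR_le => // m; exact: (gb m).2.
rewrite integral_nneseries//; last 2 first.
- by move=> m; exact: measurable_energy.
- by move=> *; exact: poweR_ge0.
(* Applied to the zero sequence, [epsilon_trick] sums the geometric bounds to [1]. *)
have := @epsilon_trick R (fun _ => 0%E) 1 xpredT (fun _ => lexx _) ler01.
rewrite [X in (_ <= X + _)%E]eseries0// add0e; apply: le_trans; apply: lee_nneseries => [m _ _|m _].
  exact: energy_ge0.
by rewrite add0e; exact: gE.
Qed.

(* Finite-energy weights detect exceptional families: countable intersections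
   and subcurves are immediate in this form. *)
Lemma ae_curveP (P : @curve R X -> Prop) : ae_curve mu p D P <->
  exists rho, [/\ nonneg_borel D rho, (energy p D rho < +oo)%E &
    forall gamma, rectifiable_curves_in D gamma ->
      (line_integral gamma rho < +oo)%E -> P gamma].
Proof.
split=> [[G [Gr Gm GP]]|[rho [rhob rhoE rhoP]]].
  (* Modulus zero allows weights so cheap that [2 ^ n * rho n] still has energy at most
     [1 / 2 ^ n.+1], while its line integral is at least [2 ^ n] on [G]. The supremum of these
     weights has finite energy and infinite line integral on [G]. *)
  have H n : exists rho, [/\ nonneg_borel D rho,
      forall gamma, G gamma -> (1 <= line_integral gamma rho)%E &
      (energy p D rho <= (1 / (2 ^ n.+1)%:R / (2 ^+ n) `^ p)%:E)%E].
    have : (modulus mu p D G < (1 / (2 ^ n.+1)%:R / (2 ^+ n) `^ p)%:E)%E.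
      by rewrite Gm lte_fin !divr_gt0// powR_gt0// exprn_gt0.
    move=> /ereal_inf_lt[_ [rho [rhob rhoG] <-] /ltW rhoE].
    by exists rho.
  move: H => /choice[rho rhoP].
  pose r n x := (((2 ^+ n) : R)%:E * rho n x)%E.
  have rb n : nonneg_borel D (r n).
    by apply: nonneg_borelZ; [rewrite exprn_ge0|have [] := rhoP n].
  exists (fun x => esups (r^~ x) 0%N); split.
  - exact: nonneg_borel_esups.
  - apply: (@le_lt_trans _ _ 1%E); last exact: ltry.
    apply: energy_esups => // n.
    have [rhob _ rhoE] := rhoP n; rewrite energyZ ?exprn_ge0//.
    apply: (@le_trans _ _ (((2 ^+ n) `^ p)%:E * (1 / (2 ^ n.+1)%:R / (2 ^+ n) `^ p)%:E)%E).
      by rewrite lee_pmul2l// lte_fin powR_gt0// exprn_gt0.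
    by rewrite -EFinM lee_fin mulrC divfK// gt_eqF// powR_gt0// exprn_gt0.
  - move=> gamma gD fin; apply: GP => // Gg.
    have H n : (((2 ^+ n) : R)%:E <= line_integral gamma (fun x => esups (r^~ x) 0%N))%E.
      have [rhob rhoG _] := rhoP n.
      apply: (@le_trans _ _ (line_integral gamma (r n))).
        rewrite (line_integralZ oD rhob gD) ?exprn_ge0//.
        by rewrite -[leLHS]mule1 lee_wpmul2l ?lee_fin ?exprn_ge0//; exact: rhoG.
      apply: (le_line_integral oD (rb n) _ gD); first exact: nonneg_borel_esups.
      by move=> x _; exact: (@esups_ub _ (r^~ x)).
    have l0 : (0 <= line_integral gamma (fun x => esups (r^~ x) 0%N))%E.
      by apply: line_integral_ge0 gD; exact: nonneg_borel_esups.
    move: fin H l0; case: (line_integral _ _) => [l| |]// _ H l0.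
    have := H (Num.Def.truncn l).+1; rewrite lee_fin leNgt => /negP; apply.
    rewrite lee_fin in l0; apply: lt_le_trans (truncnS_gt _) _.
    by rewrite -natrX ler_nat ltnW// ltn_expl.
exists [set gamma | rectifiable_curves_in D gamma /\ line_integral gamma rho = +oo%E].
split.
- by move=> gamma [].
- apply/eqP; rewrite eq_le; apply/andP; split; last first.
    by apply: le_ereal_inf_tmp => _ [g _ <-]; exact: energy_ge0.
  apply/lee_addgt0Pr => e e0; rewrite add0e.
  have rhoF : energy p D rho \is a fin_num by rewrite ge0_fin_numE ?energy_ge0.
  pose E := fine (energy p D rho); have E0 : 0 <= E by rewrite fine_ge0// energy_ge0.
  (* The multiple [c * rho] has energy at most [e], and infinite line integrals stay infinite. *)
  pose c := (e / (E + 1)) `^ p^-1.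
  have c0 : 0 < c by rewrite powR_gt0// divr_gt0// ltr_wpDl.
  apply: (@le_trans _ _ (energy p D (fun x => c%:E * rho x)%E)).
    apply: ereal_inf_lbound; exists (fun x => c%:E * rho x)%E => //; split.
      by apply: nonneg_borelZ => //; exact: ltW.
    move=> gamma [gD gy]; rewrite (line_integralZ oD rhob gD) ?(ltW c0)// gy.
    by rewrite gt0_muley ?lte_fin// leey.
  rewrite energyZ// ?(ltW c0)// -(fineK rhoF) -/E /c -EFinM lee_fin.
  rewrite -powRrM mulVf ?gt_eqF// powRr1 ?divr_ge0 ?(ltW e0)// ?addr_ge0//.
  by rewrite mulrAC ler_pdivrMr ?ltr_wpDl// ler_wpM2l ?(ltW e0)// lerDl.
- move=> gamma gD gG; apply: rhoP => //; rewrite ltNge leye_eq.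
  by apply/negP => /eqP ?; exact: gG.
Qed.

Lemma ae_curve_countable (P : nat -> @curve R X -> Prop) :
  (forall n, ae_curve mu p D (P n)) -> ae_curve mu p D (fun gamma => forall n, P n gamma).
Proof.
move=> aP; have /choice[rho rhoP] : forall n, exists rho,
    [/\ nonneg_borel D rho, (energy p D rho < +oo)%E &
      forall gamma, rectifiable_curves_in D gamma ->
      (line_integral gamma rho < +oo)%E -> P n gamma].
  by move=> n; exact/ae_curveP/aP.
apply/ae_curveP.
pose E n := fine (energy p D (rho n)).
have E0 n : 0 <= E n by rewrite fine_ge0// energy_ge0.
(* Normalizes the [n]-th weight to energy at most [1 / 2 ^ n.+1]; the summand [1] covers
   [E n = 0]. *)
pose c n := (1 / (2 ^ n.+1)%:R / (E n + 1)) `^ p^-1.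
have b0 n : 0 < 1 / (2 ^ n.+1)%:R / (E n + 1) :> R.
  by rewrite !divr_gt0// ltr_wpDl.
have c0 n : 0 < c n by rewrite powR_gt0.
pose r n x := ((c n)%:E * rho n x)%E.
have rb n : nonneg_borel D (r n).
  by apply: nonneg_borelZ; [exact: ltW|have [] := rhoP n].
exists (fun x => esups (r^~ x) 0%N); split.
- exact: nonneg_borel_esups.
- apply: (@le_lt_trans _ _ 1%E); last exact: ltry.
  apply: energy_esups => // n; have [rhob rhoE _] := rhoP n.
  rewrite energyZ ?(ltW (c0 n))// -[energy _ _ _]fineK ?ge0_fin_numE ?energy_ge0//.
  rewrite -/(E n) /c -powRrM mulVf ?gt_eqF// powRr1 ?(ltW (b0 n))// -EFinM lee_fin.
  by rewrite mulrAC ler_pdivrMr ?ltr_wpDl// ler_wpM2l// lerDl.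
- move=> gamma gD fin n; have [rhob _] := rhoP n; apply=> //.
  have : (line_integral gamma (r n) < +oo)%E.
    apply: le_lt_trans fin; apply: (le_line_integral oD (rb n) _ gD).
      exact: nonneg_borel_esups.
    by move=> x _; exact: (@esups_ub _ (r^~ x)).
  rewrite (line_integralZ oD rhob gD) ?(ltW (c0 n))//.
  have : (0 <= line_integral gamma (rho n))%E by exact: line_integral_ge0 rhob gD.
  case: (line_integral gamma (rho n)) => [l _ _|_|//]; first exact: ltry.
  by rewrite gt0_muley ?lte_fin.
Qed.

Lemma ae_curveI (P Q : @curve R X -> Prop) : ae_curve mu p D P ->
  ae_curve mu p D Q -> ae_curve mu p D (fun gamma => P gamma /\ Q gamma).
Proof.
move=> aP aQ.
have : ae_curve mu p D (fun gamma => forall n, (if n is 0%N then P else Q) gamma).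
  by apply: ae_curve_countable => -[|n].
move=> /ae_curveP[rho [? ? H]]; apply/ae_curveP; exists rho; split => //.
by move=> gamma /H/[apply] PQ; split; [exact: PQ 0%N|exact: PQ 1%N].
Qed.

Lemma ae_curveW (P Q : @curve R X -> Prop) : ae_curve mu p D P ->
  (forall gamma, rectifiable_curves_in D gamma -> P gamma -> Q gamma) ->
  ae_curve mu p D Q.
Proof.
move=> [G [GD G0 GP]] PQ; exists G; split => // gamma gD /(GP _ gD); exact: PQ.
Qed.

Lemma ae_curve_lty g : nonneg_borel D g -> (energy p D g < +oo)%E ->
  ae_curve mu p D (fun gamma => (line_integral gamma g < +oo)%E).
Proof. by move=> gb gE; apply/ae_curveP; exists g. Qed.

(** A finite line integral of the weight along [gamma] is finite along each subcurve, so one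
    exceptional family serves all pairs [s], [t] at once. *)
Lemma ae_curve_subcurves (P : @curve R X -> Prop) : ae_curve mu p D P ->
  ae_curve mu p D (fun gamma => forall s t : R, 0 <= s -> s <= t ->
    t <= fine (length gamma) -> exists eta, [/\ P eta,
      eta (cstart eta) = arc_param gamma s, eta (cend eta) = arc_param gamma t &
      forall g, nonneg_borel D g -> line_integral eta g =
        (\int[@lebesgue_measure R]_(r in `[s, t]) g (arc_param gamma r))%E]).
Proof.
move=> /ae_curveP[rho [rhob rhoE rhoP]]; apply/ae_curveP; exists rho; split => //.
move=> gamma gD fin s t s0 st tL.
have [eta [etaD es et eg]] := line_integral_subcurve oD gD s0 st tL.
exists eta; split => //; apply: rhoP => //; apply: le_lt_trans fin.
rewrite eg//; apply: ge0_subset_integral => //.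
- exact: measurable_arc_param rhob.1 gD.
- by move=> r rL; apply: rhob.2; exact: (arc_param_in_set gD).
- by move=> r /=; rewrite !in_itv/= => /andP[sr rt]; rewrite (le_trans s0)// (le_trans rt).
Qed.

End Modulus.

(** * Increments bounded by two densities are bounded by their minimum *)

Lemma cvge0_lt {R : realType} (u : (\bar R)^nat) (e : R) : 0 < e ->
  u @ \oo --> 0%E -> \forall n \near \oo, (u n < e%:E)%E.
Proof.
move=> e0 u0; apply: (u0 [set x | (x < e%:E)%E]).
by apply: open_nbhs_nbhs; split; [exact: open_ereal_lt_ereal|rewrite /= lte_fin].
Qed.

(** Compactness of [[a, b]] as continuous induction: a relation that holds locally and can be
    chained holds between the endpoints. *)
Lemma interval_chain {R : realType} (a b : R) (P : R -> R -> Prop) : a <= b ->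
  (forall x, a <= x -> x <= b -> exists2 d : R, 0 < d & forall s t,
    a <= s -> s <= t -> t <= b -> `|s - x| < d -> `|t - x| < d -> P s t) ->
  (forall s u t, a <= s -> s <= u -> u <= t -> t <= b -> P s u -> P u t -> P s t) ->
  P a b.
Proof.
move=> ab locP addP.
have Paa : P a a.
  by have [d d0] := locP a (lexx _) ab; apply; rewrite ?subrr ?normr0.
pose A := [set t | [/\ a <= t, t <= b & P a t]].
have hsA : has_sup A by split; [exists a|exists b => t []].
pose x := sup A.
have ax : a <= x by apply: ub_le_sup; [case: hsA|].
have xb : x <= b by apply: ge_sup; [case: hsA|move=> t []].
have [d d0 dP] := locP x ax xb.
have [t0 [at0 t0b Pt0] xt0] := sup_adherent d0 hsA.
have t0x : t0 <= x by apply: ub_le_sup; [case: hsA|].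
have t0d : `|t0 - x| < d.
  by rewrite -normrN opprB ger0_norm ?subr_ge0//; move: xt0; rewrite -/x; lra.
(* The chain reaches a point [t0] just before the supremum [x] and continues from there to [t].
   Since [t] cannot exceed [x], it must be [b]. *)
pose t := Num.min b (x + d / 2).
have xt : x <= t by rewrite /t le_min xb lerDl divr_ge0// ltW.
have tb : t <= b by rewrite /t ge_min lexx.
have td : `|t - x| < d.
  rewrite ger0_norm ?subr_ge0//.
  have : t <= x + d / 2 by rewrite /t ge_min lexx orbT.
  lra.
have Pt : P a t.
  apply: (addP _ t0) => //; first exact: le_trans xt.
  by apply: dP => //; exact: le_trans xt.
have tx : t <= x by apply: ub_le_sup; [case: hsA|split => //; exact: le_trans xt].
suff <- : t = b by [].
move: tx; rewrite /t; case: (leP b) => // _ tx; exfalso; lra.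
Qed.

Section MinIncrement.
Context {R : realType}.
Local Notation leb := (@lebesgue_measure R).

Lemma integral_itv_split (s u t : R) (f : R -> \bar R) : s <= u -> u <= t ->
  measurable_fun `[s, t] f -> (forall x, x \in `[s, t] -> (0 <= f x)%E) ->
  (\int[leb]_(x in `[s, t]) f x =
   \int[leb]_(x in `[s, u]) f x + \int[leb]_(x in `[u, t]) f x)%E.
Proof.
move=> su ut mf f0.
have E : `[s, t]%classic = `[s, u] `|` `]u, t].
  apply/seteqP; split => x /=; rewrite !in_itv/=.
    by case: (leP x u) => xu /andP[-> ->]; [left|right].
  by move=> [/andP[-> xu]|/andP[ux ->]]; rewrite ?andbT; [exact: le_trans ut|
     exact/(le_trans su)/ltW].
rewrite E ge0_integral_setU//.
- congr (_ + _)%E; apply: integral_itv_obnd_cbnd.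
  apply: measurable_funS mf => //; rewrite E; exact: subsetUr.
- by rewrite -E.
- by move=> x; rewrite -E => /f0.
- apply/disj_setPS => x [] /=; rewrite !in_itv/= => /andP[_ xu] /andP[ux _].
  by move: ux; rewrite ltNge xu.
Qed.

(** An integrated form of the bound [|F'| <= min g h]. Near each point [x], continuous [L^1]
    approximations of [g] and [h] tell which of the two is smaller up to a small error. That one
    bounds the local increments, the local bounds are chained, and the error terms collected in [K]
    have small integral. *)
Let min_increment_real (L : R) (F g h : R -> R) : 0 <= L ->
  leb.-integrable `[0, L] (EFin \o g) -> leb.-integrable `[0, L] (EFin \o h) ->
  (forall r, 0 <= g r) -> (forall r, 0 <= h r) ->
  (forall s t, 0 <= s -> s <= t -> t <= L ->
    (`|F s - F t|%:E <= \int[leb]_(r in `[s, t]) (g r)%:E)%E /\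
    (`|F s - F t|%:E <= \int[leb]_(r in `[s, t]) (h r)%:E)%E) ->
  (`|F 0 - F L|%:E <= \int[leb]_(r in `[0%R, L]) (Num.min (g r) (h r))%:E)%E.
Proof.
move=> L0 ig ih g0 h0 FP.
have mI : measurable `[0, L]%classic by [].
have finI : (leb `[0%R, L]%classic < +oo)%E.
  by rewrite lebesgue_measure_itv; case: ifP => _; rewrite ?ltry//= -EFinB ltry.
have mg : measurable_fun `[0, L] g by case/integrableP : ig => /measurable_EFinP.
have mh : measurable_fun `[0, L] h by case/integrableP : ih => /measurable_EFinP.
have [g_ [cg ig_ gcvg]] := approximation_continuous_integrable mI finI ig.
have [h_ [ch ih_ hcvg]] := approximation_continuous_integrable mI finI ih.
apply/lee_addgt0Pr => /= e0 e00.
(* The three error terms of [K] integrate to at most [2 * e], [2 * e] and [2 * e * L], in total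
   [e0]. *)
pose e := e0 / (4 + 2 * L).
have den : 0 < 4 + 2 * L by rewrite ltr_wpDr// mulr_ge0.
have e_gt0 : 0 < e by rewrite divr_gt0.
have pick u : u @ \oo --> 0%E -> exists n, (u n < e%:E :> \bar R)%E.
  by move=> /(cvge0_lt e_gt0)[n _ /(_ n (leqnn n)) ?]; exists n.
have [n gn] := pick _ gcvg; have [m hm] := pick _ hcvg.
set g' := g_ n in gn; set h' := h_ m in hm.
have cg' : continuous g' := cg n. have ch' : continuous h' := ch m.
have mg' : measurable_fun `[0, L] g'.
  by apply: measurable_funTS; exact: continuous_measurable_fun.
have mh' : measurable_fun `[0, L] h'.
  by apply: measurable_funTS; exact: continuous_measurable_fun.
pose K r := Num.min (g r) (h r) + 2 * `|g r - g' r| + 2 * `|h r - h' r| + 2 * e.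
have mmin : measurable_fun `[0, L] (fun r => Num.min (g r) (h r)).
  exact: measurable_minr.
have mdg : measurable_fun `[0, L] (fun r => `|g r - g' r|).
  by apply: measurableT_comp => //; exact: measurable_funB.
have mdh : measurable_fun `[0, L] (fun r => `|h r - h' r|).
  by apply: measurableT_comp => //; exact: measurable_funB.
have mK : measurable_fun `[0, L] (EFin \o K).
  apply/measurable_EFinP; rewrite /K.
  by do ![apply: measurable_funD => //]; apply: measurable_funM.
have min0 r : 0 <= Num.min (g r) (h r) by rewrite le_min g0 h0.
have K0 r : 0 <= K r by rewrite /K !addr_ge0// mulr_ge0// ltW.
have subI s t : 0 <= s -> t <= L -> [set` `[s, t]] `<=` [set` `[0, L]].
  move=> s0 tL r /=; rewrite !in_itv/= => /andP[sr rt].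
  by rewrite (le_trans s0)// (le_trans rt).
have mK' s t : 0 <= s -> t <= L -> measurable_fun `[s, t] (EFin \o K).
  by move=> s0 tL; apply: measurable_funS mK => //; exact: subI.
have main : (`|F 0 - F L|%:E <= \int[leb]_(r in `[0%R, L]) (K r)%:E)%E.
  apply: (@interval_chain R 0 L
    (fun s t => (`|F s - F t|%:E <= \int[leb]_(r in `[s, t]) (K r)%:E)%E)) => //.
  - move=> x x0 xL.
    have e40 : 0 < e / 4 by rewrite divr_gt0.
    have /cvgrPdist_lt/(_ _ e_gt0)/nbhs_ballP[d1 d10 d1P] := cg' x.
    have /cvgrPdist_lt/(_ _ e_gt0)/nbhs_ballP[d2 d20 d2P] := ch' x.
    exists (Num.min d1 d2); first by rewrite lt_min d10.
    move=> s t s0 st tL sd td.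
    have near_x r : r \in `[s, t] -> `|x - r| < Num.min d1 d2.
      rewrite in_itv/= => /andP[sr rt]; move: sd td; rewrite !ltr_norml.
      by move=> /andP[? ?] /andP[? ?]; apply/andP; split; lra.
    have K_ge (k : R -> R) : measurable_fun `[0, L] k -> (forall r, 0 <= k r) ->
        (forall r, r \in `[s, t] -> k r <= K r) ->
        (\int[leb]_(r in `[s, t]) (k r)%:E <= \int[leb]_(r in `[s, t]) (K r)%:E)%E.
      move=> mk k0 kK; apply: ge0_le_integral => //.
      - by move=> r _; rewrite lee_fin.
      - by apply/measurable_EFinP; apply: measurable_funS mk => //; exact: subI.
      - exact: mK'.
    have [FG FH] := FP s t s0 st tL.
    have loc r : r \in `[s, t] -> `|g' x - g' r| < e /\ `|h' x - h' r| < e.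
      move=> /near_x; rewrite lt_min => /andP[r1 r2].
      by split; [exact: d1P|exact: d2P].
    have arith : forall gx hx gr hr gr' hr' : R, `|gx - gr'| < e -> `|hx - hr'| < e ->
        gx <= hx -> gr <= Num.min gr hr + 2 * `|gr - gr'| + 2 * `|hr - hr'| + 2 * e.
      clear -e_gt0 => gx hx gr hr gr' hr'; rewrite !ltr_norml => /andP[? ?] /andP[? ?] ?.
      have := ler_norm (gr - gr'); have := ler_norm (hr' - hr).
      have := ler_norm (gr' - gr); rewrite (distrC gr') (distrC hr').
      have := normr_ge0 (gr - gr'); have := normr_ge0 (hr - hr').
      by case: (leP gr hr) => ?; lra.
    have [gh|hg] := leP (g' x) (h' x).
      apply: (le_trans FG); apply: K_ge => // r /loc[gr hr].
      exact: (arith _ _ _ _ _ _ gr hr gh).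
    apply: (le_trans FH); apply: K_ge => // r /loc[gr hr].
    have := arith _ _ (h r) (g r) _ _ hr gr (ltW hg).
    by rewrite /K minC; lra.
  - move=> s u t s0 su ut tL Psu Put.
    rewrite (integral_itv_split su ut); last 2 first.
    + exact: mK'.
    + by move=> r _; rewrite lee_fin.
    apply: le_trans (leeD Psu Put); rewrite -EFinD lee_fin.
    by rewrite (le_trans _ (ler_normD _ _))// addrA subrK.
apply: (le_trans main).
have ED (f1 f2 : R -> R) : measurable_fun `[0, L] f1 -> measurable_fun `[0, L] f2 ->
    (forall r, 0 <= f1 r) -> (forall r, 0 <= f2 r) ->
    (\int[leb]_(r in `[0%R, L]) (f1 r + f2 r)%:E = \int[leb]_(r in `[0%R, L]) (f1 r)%:E
      + \int[leb]_(r in `[0%R, L]) (f2 r)%:E)%E.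
  move=> m1 m2 p1 p2; rewrite -ge0_integralD//.
  - by move=> r _; rewrite lee_fin.
  - exact/measurable_EFinP.
  - by move=> r _; rewrite lee_fin.
  - exact/measurable_EFinP.
have EZ (f1 : R -> R) : measurable_fun `[0, L] f1 -> (forall r, 0 <= f1 r) ->
    (\int[leb]_(r in `[0%R, L]) (2 * f1 r)%:E = 2%:E * \int[leb]_(r in `[0%R, L]) (f1 r)%:E)%E.
  move=> m1 p1; rewrite -ge0_integralZl_EFin//.
  - by move=> r _; rewrite lee_fin.
  - exact/measurable_EFinP.
rewrite /K !ED ?EZ//; last first.
- by move=> r; rewrite mulr_ge0// ltW.
- by move=> r; rewrite !addr_ge0// mulr_ge0.
- by do ![apply: measurable_funD => //]; apply: measurable_funM.
- by move=> r; rewrite !addr_ge0// mulr_ge0.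
- exact: measurable_funM.
- by do ![apply: measurable_funD => //]; apply: measurable_funM.
- exact: measurable_funM.
- by move=> r; exact: ltW.
rewrite integral_cst//= lebesgue_measure_itv/=.
set I := (X in (X + _ + _ + _ <= _)%E).
rewrite -!(addeA I) leeD2l// -addeA.
apply: (@le_trans _ _ (2%:E * e%:E + (2%:E * e%:E + 2%:E * (e%:E * L%:E)))%E).
  apply: leeD; first by rewrite lee_wpmul2l ?lee_fin// ltW.
  apply: leeD; first by rewrite lee_wpmul2l ?lee_fin// ltW.
  rewrite lee_wpmul2l ?lee_fin// lee_wpmul2l ?lee_fin ?(ltW e_gt0)//.
  by rewrite lte_fin; case: ifP => _; rewrite lee_fin// subr0.
rewrite -!EFinM -!EFinD lee_fin /e.
have -> : 2 * (e0 / (4 + 2 * L)) + (2 * (e0 / (4 + 2 * L)) + 2 * (e0 / (4 + 2 * L) * L))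
   = e0 / (4 + 2 * L) * (4 + 2 * L) by ring.
by rewrite divfK// gt_eqF.
Qed.

Lemma min_increment (L : R) (F : R -> R) (g h : R -> \bar R) : 0 <= L ->
  leb.-integrable `[0, L] g -> leb.-integrable `[0, L] h ->
  (forall r, r \in `[0, L] -> (0 <= g r)%E) -> (forall r, r \in `[0, L] -> (0 <= h r)%E) ->
  (forall s t, 0 <= s -> s <= t -> t <= L ->
    (`|F s - F t|%:E <= \int[leb]_(r in `[s, t]) g r)%E /\
    (`|F s - F t|%:E <= \int[leb]_(r in `[s, t]) h r)%E) ->
  (`|F 0 - F L|%:E <= \int[leb]_(r in `[0%R, L]) Order.min (g r) (h r))%E.
Proof.
move=> L0 ig ih g0 h0 FP.
have mI : measurable `[0, L]%classic by [].
(* Integrable functions are finite almost everywhere, so no integral changes; the absolute value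
   makes the real versions nonnegative outside [[0, L]] too, as [min_increment_real] asks. *)
pose fin_part (k : R -> \bar R) r := `|fine (k r)|.
have subI s t : 0 <= s -> t <= L -> [set` `[s, t]] `<=` [set` `[0, L]].
  move=> s0 tL r /=; rewrite !in_itv/= => /andP[sr rt].
  by rewrite (le_trans s0)// (le_trans rt).
have mfin (k : R -> \bar R) : leb.-integrable `[0, L] k ->
    measurable_fun `[0, L] (fin_part k).
  move=> /integrableP[mk _]; apply: measurableT_comp => //.
  exact: measurableT_comp mk.
have le_fin (k : R -> \bar R) r : (0 <= k r)%E -> ((fin_part k r)%:E <= k r)%E.
  rewrite /fin_part; case: (k r) => [x| |]; rewrite ?leey// !lee_fin => x0.
  by rewrite ger0_norm.
have ifin (k : R -> \bar R) : leb.-integrable `[0, L] k ->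
    leb.-integrable `[0, L] (EFin \o fin_part k).
  move=> ik; have mk := mfin _ ik.
  apply: le_integrable ik => //; first exact/measurable_EFinP.
  move=> r _; rewrite /fin_part /= normr_id.
  by case: (k r) => [x| |] /=; rewrite ?normr0 ?leey.
have eq_fin (k : R -> \bar R) s t : leb.-integrable `[0, L] k ->
    (forall r, r \in `[0, L] -> (0 <= k r)%E) -> 0 <= s -> t <= L ->
    (\int[leb]_(r in `[s, t]) k r = \int[leb]_(r in `[s, t]) (fin_part k r)%:E)%E.
  move=> ik k0 s0 tL; have st := subI _ _ s0 tL; apply: ge0_ae_eq_integral => //.
  - by case/integrableP : ik => mk _; exact: measurable_funS mk.
  - by apply/measurable_EFinP; apply: measurable_funS (mfin _ ik).
  - by move=> r /st/k0.
  - by move=> r _; rewrite lee_fin normr_ge0.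
  - have kfin : ae_eq leb [set` `[0, L]] k (EFin \o fine \o k).
      have /integrable_ae : leb.-integrable `[0, L] k := ik.
      move=> /(_ (measurable_itv _)); apply: filterS => r kr /kr.
      by move=> /fineK /= ->.
    apply: (filterS _ kfin) => r kr /st rI.
    by rewrite /fin_part ger0_norm ?fine_ge0 ?k0// kr.
have := @min_increment_real L F (fin_part g) (fin_part h) L0 (ifin _ ig) (ifin _ ih).
move=> /(_ (fun=> normr_ge0 _) (fun=> normr_ge0 _)) H.
apply: (@le_trans _ _ (\int[leb]_(r in `[0%R, L]) (Num.min (fin_part g r) (fin_part h r))%:E)%E).
  apply: H => s t s0 st tL; rewrite -!eq_fin//; exact: FP.
apply: ge0_le_integral => //.
- by move=> r _; rewrite lee_fin le_min !normr_ge0.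
- by apply/measurable_EFinP; apply: measurable_minr; exact: mfin.
- by apply: measurable_mine; [case/integrableP : ig|case/integrableP : ih].
- move=> r rI; rewrite EFin_min le_min !ge_min.
  by rewrite (le_fin g _ (g0 _ rI)) (le_fin h _ (h0 _ rI)) orbT.
Qed.

End MinIncrement.

(** * Weak upper gradients and existence of the minimal one *)

Lemma ae_imply d (T : measurableType d) (R : realType) (mu : {measure set T -> \bar R})
    (P Q : T -> Prop) : {ae mu, forall x, P x} -> (forall x, P x -> Q x) ->
  {ae mu, forall x, Q x}.
Proof. by move=> aP PQ; apply: filterS aP. Qed.

(** The difference [g - f] is formed only on the set where [f < g]: there [f] is finite, and the
    integral of the difference has to vanish. *)
Lemma ge0_integral_le_ae d (T : measurableType d) (R : realType)
    (mu : {measure set T -> \bar R}) (D : set T) (f g : T -> \bar R) :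
  measurable D -> measurable_fun D f -> measurable_fun D g ->
  (forall x, D x -> (0 <= f x)%E) -> (forall x, D x -> (f x <= g x)%E) ->
  (\int[mu]_(x in D) g x < +oo)%E ->
  (\int[mu]_(x in D) g x <= \int[mu]_(x in D) f x)%E ->
  {ae mu, forall x, D x -> (g x <= f x)%E}.
Proof.
move=> mD mf mg f0 fg gfin gf.
pose N := D `&` [set x | (f x < g x)%E].
have mN : measurable N by exact: measurable_lte.
have ND : N `<=` D by move=> x [].
have g0 x : D x -> (0 <= g x)%E by move=> Dx; rewrite (le_trans (f0 _ Dx)) ?fg.
have DE : D = N `|` D `\` N by rewrite setDUK.
have mDN : measurable (D `\` N) by exact: measurableD.
have split_int (h : T -> \bar R) : measurable_fun D h -> (forall x, D x -> (0 <= h x)%E) ->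
    (\int[mu]_(x in D) h x = \int[mu]_(x in N) h x + \int[mu]_(x in D `\` N) h x)%E.
  move=> mh h0; rewrite [in LHS]DE ge0_integral_setU -?DE//.
  by apply/disj_setPS => x [Nx [_ /(_ Nx)]].
have mNf : measurable_fun N f by exact: measurable_funS mf.
have mNg : measurable_fun N g by exact: measurable_funS mg.
pose phi x := (g x - f x)%E.
have ffin x : N x -> f x \is a fin_num.
  move=> [Dx] /= fgx; rewrite ge0_fin_numE ?f0//.
  by rewrite (lt_le_trans fgx)// leey.
have phi0 x : N x -> (0 <= phi x)%E.
  by move=> Nx; rewrite /phi sube_ge0 ?fg ?ffin//; exact: ND.
have mphi : measurable_fun N phi by exact: emeasurable_funB.
have gN : (\int[mu]_(x in N) g x = \int[mu]_(x in N) phi x + \int[mu]_(x in N) f x)%E.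
  rewrite -ge0_integralD//; last by move=> x /ND/f0.
  by apply: eq_integral => x; rewrite inE => Nx; rewrite /phi subeK// ffin.
have phile : (\int[mu]_(x in N) phi x + \int[mu]_(x in D) g x <= \int[mu]_(x in D) g x)%E.
  apply: (le_trans (leeD2l _ gf)); rewrite (split_int f)// (split_int g)// gN addeA.
  rewrite leeD2l// ge0_le_integral//.
  - by move=> x [/f0].
  - by apply: measurable_funS mf.
  - by apply: measurable_funS mg.
  - by move=> x [/fg].
have gint : (\int[mu]_(x in D) g x)%E \is a fin_num by rewrite ge0_fin_numE ?integral_ge0.
have phi_0 : (\int[mu]_(x in N) `|phi x| = 0)%E.
  rewrite (eq_integral phi); last by move=> x; rewrite inE => Nx; rewrite gee0_abs ?phi0.
  apply/eqP; rewrite eq_le integral_ge0 ?andbT//.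
  by rewrite -(leeD2rE _ _ gint) add0e.
have /(ae_eq_integral_abs mu mN mphi) := phi_0.
apply: filterS => x Nphi Dx; rewrite leNgt; apply/negP => fgx.
have Nx : N x by [].
have phix : (0 < phi x)%E by rewrite /phi sube_gt0.
by move: phix; rewrite (Nphi Nx) ltxx.
Qed.

Section WeakUpperGradients.
Context {R : realType} {X : pmetricType R}.
Variable mu : {outer_measure set X -> \bar R}.
Hypothesis mmu : metric_measure mu.
Variables (p : R) (D : set X).
Hypotheses (p0 : 0 < p) (oD : open D).
Implicit Types (f : X -> R) (g h : X -> \bar R) (gamma : @curve R X).

Let mD : measurable (D : set (caratheodory_type mu)).
Proof. exact: measurable_open. Qed.

Lemma Lp_norm_energy (s : R) (A : set X) g : 0 < s ->
  measurable (A : set (caratheodory_type mu)) ->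
  Lp_norm mu s A g = (energy mu s A (abse \o g) `^ s^-1)%E.
Proof.
move=> s0 mA; rewrite /Lp_norm unlock /= /energy [in RHS]integral_mkcond.
congr (poweR _ _); apply: eq_integral => x _; rewrite !patchE.
by case: ifPn => // _; rewrite abse0 poweR0r// gt_eqF.
Qed.

Lemma Lp_norm_nonneg g : nonneg_borel D g ->
  Lp_norm mu p D g = (energy mu p D g `^ p^-1)%E.
Proof.
move=> [_ g0]; rewrite Lp_norm_energy//; congr (poweR _ _).
by apply: eq_integral => x; rewrite inE => /g0 gx; rewrite /= gee0_abs.
Qed.

Lemma Lp_norm_poweR g : nonneg_borel D g ->
  (Lp_norm mu p D g `^ p)%E = energy mu p D g.
Proof. by move=> gb; rewrite Lp_norm_nonneg// poweRVK// energy_ge0. Qed.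

Lemma Lp_norm_lty g : nonneg_borel D g ->
  (Lp_norm mu p D g < +oo)%E <-> (energy mu p D g < +oo)%E.
Proof.
move=> gb; rewrite Lp_norm_nonneg//; split; last exact: poweR_lty.
by apply: lty_poweRy; rewrite invr_eq0 gt_eqF.
Qed.

Lemma Lp_weak_upper_gradientP f g : Lp_weak_upper_gradient mu p D f g <->
  weak_upper_gradient mu p D f g /\ (energy mu p D g < +oo)%E.
Proof. by split=> -[gf] fin; split => //; move: fin; case: (gf) => /Lp_norm_lty ->. Qed.

Lemma nonneg_borel_min g h : nonneg_borel D g -> nonneg_borel D h ->
  nonneg_borel D (fun x => Order.min (g x) (h x)).
Proof.
move=> [mg g0] [mh h0]; split; first exact: measurable_mine.
by move=> x Dx; rewrite le_min g0 ?h0.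
Qed.

Lemma line_integrable g gamma : nonneg_borel D g -> rectifiable_curves_in D gamma ->
  (line_integral gamma g < +oo)%E ->
  (@lebesgue_measure R).-integrable `[0, fine (length gamma)] (g \o arc_param gamma).
Proof.
move=> [mg g0] gD fin; apply/integrableP; split; first exact: measurable_arc_param gD.
suff -> : (\int[@lebesgue_measure R]_(r in `[0%R, fine (length gamma)])
    `|(g \o arc_param gamma) r| = line_integral gamma g)%E by [].
apply: eq_integral => r; rewrite inE => rL.
by rewrite /= gee0_abs//; exact/g0/(arc_param_in_set gD).
Qed.

(** The lattice property behind the minimal weak upper gradient. On almost every curve both
    inequalities hold along all subcurves and both line integrals are finite, which is the input of
    [min_increment]. *)
Lemma weak_upper_gradient_min f g h :
  Lp_weak_upper_gradient mu p D f g -> Lp_weak_upper_gradient mu p D f h ->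
  weak_upper_gradient mu p D f (fun x => Order.min (g x) (h x)).
Proof.
move=> /Lp_weak_upper_gradientP[[gb ag] gE] /Lp_weak_upper_gradientP[[hb ah] hE].
split; first exact: nonneg_borel_min.
have H := ae_curve_subcurves mmu p0 oD (ae_curveI mmu p0 oD ag ah).
have {}H := ae_curveI mmu p0 oD H (ae_curveI mmu p0 oD
  (ae_curve_lty mmu p0 oD gb gE) (ae_curve_lty mmu p0 oD hb hE)).
apply: (ae_curveW H) => gamma gD [sub [gfin hfin]].
have L0 := fine_length_ge0 gamma.
rewrite -(arc_param_start gD.1) -(arc_param_end gD.1).
apply: (min_increment (F := f \o arc_param gamma) L0).
- exact: line_integrable.
- exact: line_integrable.
- by move=> r rL; exact/gb.2/(arc_param_in_set gD).
- by move=> r rL; exact/hb.2/(arc_param_in_set gD).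
- move=> s t s0 st tL; have [eta [[etag etah] es et eI]] := sub s t s0 st tL.
  by rewrite /= -es -et -eI// -eI.
Qed.

Lemma einfs_lb (u : (\bar R)^nat) (n m : nat) : (n <= m)%N -> (einfs u n <= u m)%E.
Proof. by move=> nm; apply: ereal_inf_lbound; exists m. Qed.

Lemma nonneg_borel_einfs (g : nat -> X -> \bar R) n :
  (forall n, nonneg_borel D (g n)) -> nonneg_borel D (fun x => einfs (g^~ x) n).
Proof.
move=> gb; split; first by apply: measurable_fun_einfs => m; exact: (gb m).1.
by move=> x Dx; apply: le_ereal_inf_tmp => _ [m _ <-]; exact: (gb m).2.
Qed.

(** Dominated convergence along almost every curve; finite energy of [g 0] makes it integrable there
    and so supplies the majorant. *)
Lemma weak_upper_gradient_decreasing f (g : nat -> X -> \bar R) :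
  (forall n, weak_upper_gradient mu p D f (g n)) -> (energy mu p D (g 0%N) < +oo)%E ->
  (forall x, D x -> nonincreasing_seq (g^~ x)) ->
  weak_upper_gradient mu p D f (fun x => einfs (g^~ x) 0%N).
Proof.
move=> gf gE gd; have gb n := (gf n).1.
split; first exact: nonneg_borel_einfs.
have H := ae_curveI mmu p0 oD (ae_curve_countable mmu p0 oD (fun n => (gf n).2))
  (ae_curve_lty mmu p0 oD (gb 0%N) gE).
apply: (ae_curveW H) => gamma gD [gn g0fin].
have [|||||_ _ cv] := @dominated_convergence _ _ _ (@lebesgue_measure R)
  `[0, fine (length gamma)]%classic (measurable_itv _) (fun n => g n \o arc_param gamma)
  (fun r => einfs (g^~ (arc_param gamma r)) 0%N) (g 0%N \o arc_param gamma).
- by move=> n; exact: measurable_arc_param (gb n).1 gD.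
- by apply: measurable_fun_einfs => n; exact: measurable_arc_param (gb n).1 gD.
- apply: aeW => r rL; have := gd _ (arc_param_in_set gD rL).
  move=> /ereal_nonincreasing_cvgn.
  set l := ereal_inf _; suff -> : l = einfs (g^~ (arc_param gamma r)) 0%N by [].
  by congr ereal_inf; apply/seteqP; split=> _ [m _ <-]; exists m.
- exact: line_integrable.
- apply: aeW => r n rL; rewrite /= gee0_abs; last first.
    exact/(gb n).2/(arc_param_in_set gD).
  exact: (gd _ (arc_param_in_set gD rL)).
have cv' : line_integral gamma (g n) @[n --> \oo] -->
    line_integral gamma (fun x => einfs (g^~ x) 0%N) by exact: cv.
rewrite -(cvg_lim _ cv')//; apply: lime_ge.
  by apply/cvg_ex; eexists; exact: cv'.
by apply: nearW => n; exact: gn.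
Qed.

(** Running minima of a minimizing sequence decrease to an upper gradient [gm] of least energy. For
    any other [h], [min gm h] competes as well, so its energy is not smaller, and equality of the
    energies forces [gm <= h] almost everywhere. *)
Lemma minimal_weak_upper_gradient_ex f :
  (exists g, Lp_weak_upper_gradient mu p D f g) ->
  exists g, minimal_weak_upper_gradient mu p D f g.
Proof.
move=> [ga gaL]; have [gaf gaE] := (Lp_weak_upper_gradientP _ _).1 gaL.
pose S := [set energy mu p D g | g in [set g | Lp_weak_upper_gradient mu p D f g]].
have S0 : (0 <= ereal_inf S)%E.
  by apply: le_ereal_inf_tmp => _ [g _ <-]; exact: energy_ge0.
have Sfin : ereal_inf S \is a fin_num.
  rewrite ge0_fin_numE//; apply: le_lt_trans gaE; apply: ereal_inf_lbound.
  by exists ga.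
have /choice[g gP] : forall n : nat, exists g, Lp_weak_upper_gradient mu p D f g /\
    (energy mu p D g <= ereal_inf S + n.+1%:R^-1%:E)%E.
  move=> n; have n0 : 0 < n.+1%:R^-1 :> R by [].
  by have [_ [g gf <-] /ltW] := lb_ereal_inf_adherent n0 Sfin; exists g.
pose fix m n := if n is n'.+1 then fun x => Order.min (m n' x) (g n x) else g 0%N.
have mS n : m n.+1 = fun x => Order.min (m n x) (g n.+1 x) by [].
have mL n : Lp_weak_upper_gradient mu p D f (m n).
  elim: n => [|n ih]; first exact: (gP 0%N).1.
  have wm := weak_upper_gradient_min ih (gP n.+1).1.
  apply/Lp_weak_upper_gradientP; split => //.
  have [ihw ihE] := (Lp_weak_upper_gradientP _ _).1 ih.
  apply: le_lt_trans ihE; apply: le_energy => //; [exact: wm.1|exact: ihw.1|].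
  by move=> x _; rewrite mS ge_min lexx.
have mE n : (energy mu p D (m n) <= ereal_inf S + n.+1%:R^-1%:E)%E.
  case: n => [|n]; first exact: (gP 0%N).2.
  apply: le_trans (gP n.+1).2; apply: le_energy => //.
  - exact: (mL n.+1).1.1.
  - exact: (gP n.+1).1.1.1.
  - by move=> x _; rewrite mS ge_min lexx orbT.
have md x : nonincreasing_seq (m^~ x).
  by apply/nonincreasing_seqP => n; rewrite mS ge_min lexx.
pose gm x := einfs (m^~ x) 0%N.
have m0E : (energy mu p D (m 0%N) < +oo)%E by exact: ((Lp_weak_upper_gradientP _ _).1 (mL 0%N)).2.
have gmw : weak_upper_gradient mu p D f gm.
  by apply: weak_upper_gradient_decreasing => // n; exact: (mL n).1.
have gmE : (energy mu p D gm <= ereal_inf S)%E.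
  apply/lee_addgt0Pr => e e0.
  have [n ne] : exists n : nat, n.+1%:R^-1 < e.
    have [n _ /(_ _ (leqnn n)) ne] := near_infty_natSinv_lt (PosNum e0).
    by exists n.
  apply: (@le_trans _ _ (energy mu p D (m n))).
    apply: le_energy => //; [exact: gmw.1|exact: (mL n).1.1|].
    by move=> x _; exact: (@einfs_lb (m^~ x)).
  by apply: (le_trans (mE n)); rewrite leeD2l// lee_fin ltW.
have gmL : Lp_weak_upper_gradient mu p D f gm.
  apply/Lp_weak_upper_gradientP; split => //; apply: (le_lt_trans gmE).
  by rewrite -ge0_fin_numE.
exists gm; split => // h hL.
have kw := weak_upper_gradient_min gmL hL.
have kL : Lp_weak_upper_gradient mu p D f (fun x => Order.min (gm x) (h x)).
  apply/Lp_weak_upper_gradientP; split => //.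
  apply: (@le_lt_trans _ _ (energy mu p D gm)).
    apply: le_energy => //; [exact: kw.1|exact: gmw.1|].
    by move=> x _; rewrite ge_min lexx.
  exact: ((Lp_weak_upper_gradientP _ _).1 gmL).2.
have H : {ae cmeas mu, forall x, D x -> (gm x `^ p <= Order.min (gm x) (h x) `^ p)%E}.
  apply: ge0_integral_le_ae => //.
  - exact: (measurable_energy mmu p oD kw.1).
  - exact: (measurable_energy mmu p oD gmw.1).
  - by move=> x _; exact: poweR_ge0.
  - move=> x Dx; apply: le_poweR; [exact: ltW|exact: kw.1.2|].
    by rewrite ge_min lexx.
  - exact: ((Lp_weak_upper_gradientP _ _).1 gmL).2.
  - by apply: (le_trans gmE); apply: ereal_inf_lbound; exists (fun x => Order.min (gm x) (h x)).
apply: (ae_imply H) => x {}H Dx.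
have p'0 : 0 <= p^-1 by rewrite invr_ge0 ltW.
have := le_poweR p'0 (poweR_ge0 _ _) (H Dx).
by rewrite !poweRK ?(gmw.1.2 x Dx) ?(kw.1.2 x Dx)// le_min => /andP[].
Qed.

Lemma nabla_minP f : (exists g, Lp_weak_upper_gradient mu p D f g) ->
  minimal_weak_upper_gradient mu p D f (nabla_min mu p D f).
Proof.
move=> /minimal_weak_upper_gradient_ex[g gm]; rewrite /nabla_min.
by case: xgetP => [h -> //|/(_ g)].
Qed.

Lemma nabla_min_le f h : Lp_weak_upper_gradient mu p D f h ->
  (energy mu p D (nabla_min mu p D f) <= energy mu p D h)%E.
Proof.
move=> hL; have [gL gmin] : minimal_weak_upper_gradient mu p D f (nabla_min mu p D f).
  by apply: nabla_minP; exists h.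
apply: ae_ge0_le_integral => //.
- by move=> x _; exact: poweR_ge0.
- exact: (measurable_energy mmu p oD gL.1.1).
- by move=> x _; exact: poweR_ge0.
- exact: (measurable_energy mmu p oD hL.1.1).
- apply: (ae_imply (gmin h hL)) => x H Dx.
  by apply: le_poweR (H Dx); [exact: ltW|exact: gL.1.1.2].
Qed.

Lemma weak_upper_gradientD f1 f2 g h : weak_upper_gradient mu p D f1 g ->
  weak_upper_gradient mu p D f2 h ->
  weak_upper_gradient mu p D (fun x => f1 x + f2 x) (fun x => g x + h x)%E.
Proof.
move=> [gb ag] [hb ah]; split; first exact: nonneg_borelD.
apply: (ae_curveW (ae_curveI mmu p0 oD ag ah)) => gamma gD [fg fh].
rewrite (line_integralD oD gb hb gD); apply: le_trans (leeD fg fh).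
rewrite -EFinD lee_fin; apply: le_trans (ler_normD _ _).
by rewrite opprD addrACA.
Qed.

Lemma weak_upper_gradientZ f g (c : R) : weak_upper_gradient mu p D f g ->
  weak_upper_gradient mu p D (fun x => c * f x) (fun x => `|c|%:E * g x)%E.
Proof.
move=> [gb ag]; split; first exact: nonneg_borelZ.
apply: (ae_curveW ag) => gamma gD fg.
rewrite (line_integralZ oD gb gD)// -mulrBr normrM EFinM.
by rewrite lee_wpmul2l.
Qed.

End WeakUpperGradients.

(** * Uniform convexity of powers and of the energy *)

Section PowerConvexity.
Context {R : realType}.
Implicit Types (a b m p x y : R).

Lemma le_powR p x y : 0 <= p -> 0 <= x -> x <= y -> x `^ p <= y `^ p.
Proof.
by move=> p0 x0 xy; apply: ge0_ler_powR; rewrite ?nnegrE// (le_trans x0).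
Qed.

(** Two uses of [1 + t <= exp t]: with [t = (p - 1) * ln x] it bounds [x ^ (p - 1)] from below, and
    with [t = - ln x] it gives [1 - 1 / x < ln x], strictly since [x != 1]. Multiplication by [x]
    combines them. *)
Lemma powR_bernoulli p x : 1 < p -> 0 <= x -> x != 1 ->
  1 + p * (x - 1) < x `^ p.
Proof.
move=> p1; rewrite le_eqVlt => /predU1P[<- _|x0 x1].
  by rewrite powR0 ?gt_eqF ?(lt_trans ltr01)//; lra.
have lnx : 1 - x^-1 < ln x.
  have y0 : ln x^-1 != 0.
    by rewrite lnV ?posrE// oppr_eq0 ln_eq0.
  have := expR_gt1Dx y0; rewrite lnK ?posrE ?invr_gt0// lnV ?posrE//; lra.
rewrite -(mulr_powRB1 (ltW x0)) ?(lt_trans ltr01)//.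
have E : 1 + (p - 1) * ln x <= x `^ (p - 1).
  by rewrite /powR gt_eqF// expR_ge1Dx.
have p10 : 0 < p - 1 by rewrite subr_gt0.
apply: (@lt_le_trans _ _ (x * (1 + (p - 1) * ln x))); last by rewrite ler_pM2l.
apply: (@le_lt_trans _ _ (x * (1 + (p - 1) * (1 - x^-1)))); last first.
  by rewrite ltr_pM2l// ltrD2l ltr_pM2l.
rewrite le_eqVlt; apply/orP; left; apply/eqP.
by field; rewrite gt_eqF.
Qed.

Lemma powR_tangent p m x : 1 < p -> 0 < m -> 0 <= x ->
  m `^ p + p * (m `^ (p - 1)) * (x - m) <= x `^ p.
Proof.
move=> p1 m0 x0.
have mE : m `^ p = m `^ (p - 1) * m.
  by rewrite -(mulr_powRB1 (ltW m0)) ?(lt_trans ltr01)// mulrC.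
have mp : 0 < m `^ (p - 1) by rewrite powR_gt0.
have -> : x `^ p = m `^ (p - 1) * m * (x / m) `^ p.
  by rewrite -mE -powRM ?divr_ge0 ?(ltW m0)// mulrC divfK// gt_eqF.
rewrite mE.
apply: (@le_trans _ _ (m `^ (p - 1) * m * (1 + p * (x / m - 1)))).
  rewrite le_eqVlt; apply/orP; left; apply/eqP.
  by field; rewrite gt_eqF.
rewrite ler_pM2l ?mulr_gt0//.
have [->|xm1] := eqVneq (x / m) 1; first by rewrite powR1 subrr mulr0 addr0.
by apply/ltW/powR_bernoulli; rewrite // divr_ge0// ltW.
Qed.

Lemma powR_midpoint p a b : 1 < p -> 0 <= a -> 0 <= b ->
  ((a + b) / 2) `^ p <= (a `^ p + b `^ p) / 2.
Proof.
move=> p1 a0 b0; have [s0|s0] := eqVneq (a + b) 0.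
  by rewrite s0 mul0r powR0 ?gt_eqF ?(lt_trans ltr01)// divr_ge0 ?addr_ge0 ?powR_ge0.
have m0 : 0 < (a + b) / 2 by rewrite divr_gt0// lt_neqAle eq_sym s0 addr_ge0.
have := powR_tangent p1 m0 a0; have := powR_tangent p1 m0 b0.
(* In the tangent inequalities at the midpoint the linear terms of [a] and [b] cancel. *)
set k := p * _; have -> : k * (a - (a + b) / 2) = - (k * (b - (a + b) / 2)) by field.
lra.
Qed.

(* The modulus of convexity of [t ^ p] on [[0, +oo[], with the same constant at
   all scales by homogeneity; integrated, it yields the uniform convexity of Lp. *)
Lemma powR_uniform_convexity p (d : R) : 1 < p -> 0 < d -> exists2 C, 0 <= C &
  forall a b, 0 <= a -> 0 <= b ->
  `|a - b| `^ p <= d * (a `^ p + b `^ p) +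
     C * ((a `^ p + b `^ p) / 2 - ((a + b) / 2) `^ p).
Proof.
move=> p1 d0; have p0 : 0 < p := lt_trans ltr01 p1.
(* Write [a = m * (1 + t)] and [b = m * (1 - t)] with [m] the midpoint. For [t < t0] the first
   summand suffices, since [(2 * t0) ^ p <= 2 * d]. For [t >= t0] the relative convexity defect is
   at least its value [k] at [t0], and [(2 * t) ^ p <= 2 ^ p] because [t <= 1]. *)
pose t0 := Num.min (1 / 2) ((2 * d) `^ p^-1 / 2).
have t00 : 0 < t0 by rewrite lt_min !divr_gt0// powR_gt0// mulr_gt0.
have t01 : t0 < 1 by rewrite gt_min; apply/orP; left; lra.
have t0d : (2 * t0) `^ p <= 2 * d.
  apply: (@le_trans _ _ (((2 * d) `^ p^-1) `^ p)).
    apply: le_powR; [exact: ltW|by rewrite mulr_ge0// ltW|].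
    have : t0 <= (2 * d) `^ p^-1 / 2 by rewrite ge_min lexx orbT.
    lra.
  by rewrite -powRrM mulVf ?gt_eqF// powRr1// mulr_ge0// ltW.
pose s := 1 + t0; pose r := 1 - t0.
have s0 : 0 < s by rewrite addr_gt0.
have r0 : 0 < r by rewrite subr_gt0.
pose k := (s `^ p + r `^ p) / 2 - 1.
have k0 : 0 < k.
  have s1 : s != 1 by rewrite gt_eqF// ltrDl.
  have r1 : r != 1 by rewrite lt_eqF// ltrBlDr ltrDl.
  have := powR_bernoulli p1 (ltW s0) s1; have := powR_bernoulli p1 (ltW r0) r1.
  have -> : p * (s - 1) = - (p * (r - 1)) by rewrite /s /r; ring.
  rewrite /k; lra.
exists (2 `^ p / k); first by rewrite divr_ge0 ?powR_ge0// ltW.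
suff main a b : 0 <= b -> b <= a -> `|a - b| `^ p <= d * (a `^ p + b `^ p) +
    2 `^ p / k * ((a `^ p + b `^ p) / 2 - ((a + b) / 2) `^ p).
  move=> a b a0 b0; have [ab|/ltW ab] := leP b a; first exact: main.
  by have := main _ _ a0 ab; rewrite distrC addrC (addrC (b `^ p)) (addrC b) addrC.
move=> b0 ba; have a0 := le_trans b0 ba.
have Cge : 0 <= 2 `^ p / k * ((a `^ p + b `^ p) / 2 - ((a + b) / 2) `^ p).
  by rewrite mulr_ge0 ?divr_ge0 ?powR_ge0 ?(ltW k0)// subr_ge0 powR_midpoint.
have [ab0|ab0] := eqVneq (a + b) 0.
  have [-> ->] : a = 0 /\ b = 0 by split; lra.
  rewrite subr0 normr0 powR0 ?gt_eqF//; move: Cge.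
  have -> : a = 0 by lra.
  have -> : b = 0 by lra.
  by rewrite powR0 ?gt_eqF// addr0 mulr0 add0r.
pose m := (a + b) / 2; pose t := (a - b) / (a + b).
have ab_gt0 : 0 < a + b by rewrite lt_neqAle eq_sym ab0 addr_ge0.
have m0 : 0 < m by rewrite divr_gt0.
have tge0 : 0 <= t by rewrite divr_ge0 ?subr_ge0 ?(ltW ab_gt0).
have t1 : t <= 1 by rewrite ler_pdivrMr// mul1r; lra.
have ea : a = m * (1 + t) by rewrite /m /t; field.
have eb : b = m * (1 - t) by rewrite /m /t; field.
have mp : 0 < m `^ p by rewrite powR_gt0.
have eab : `|a - b| `^ p = m `^ p * (2 * t) `^ p.
  have -> : `|a - b| = m * (2 * t).
    by rewrite ger0_norm ?subr_ge0// /m /t; field.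
  by rewrite powRM ?(ltW m0)// mulr_ge0.
have eap : a `^ p = m `^ p * (1 + t) `^ p by rewrite {1}ea powRM ?(ltW m0) ?addr_ge0.
have ebp : b `^ p = m `^ p * (1 - t) `^ p by rewrite {1}eb powRM ?(ltW m0) ?subr_ge0.
have [tt0|tt0] := ltP t t0.
  apply: (@le_trans _ _ (d * (a `^ p + b `^ p))); last by rewrite lerDl.
  rewrite eab; have := powR_midpoint p1 a0 b0; rewrite -/m => mid.
  apply: (@le_trans _ _ (m `^ p * (2 * d))).
    rewrite ler_pM2l//; apply: le_trans t0d; apply: le_powR; [exact: ltW| |]; lra.
  rewrite [leLHS](_ : _ = d * (2 * m `^ p)); last by ring.
  by rewrite ler_pM2l//; lra.
apply: (@le_trans _ _ (2 `^ p / k * ((a `^ p + b `^ p) / 2 - ((a + b) / 2) `^ p))); last first.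
  by rewrite lerDr mulr_ge0 ?(ltW d0)// addr_ge0// powR_ge0.
rewrite -/m eab eap ebp.
(* The defect increases with [t]: among the tangents at [1 + t0] and [1 - t0] the first has the
   larger slope. *)
have psi : k <= ((1 + t) `^ p + (1 - t) `^ p) / 2 - 1.
  have t1' : 0 <= 1 - t by lra.
  have t2' : 0 <= 1 + t by lra.
  have := powR_tangent p1 s0 t2'; have := powR_tangent p1 r0 t1'.
  have : p * r `^ (p - 1) * (t - t0) <= p * s `^ (p - 1) * (t - t0).
    rewrite ler_wpM2r ?subr_ge0// ler_pM2l//; apply: le_powR; rewrite ?(ltW r0)//.
    - by rewrite subr_ge0 ltW.
    - by rewrite /r /s; lra.
  have -> : 1 + t - s = t - t0 by rewrite /s; ring.
  have -> : 1 - t - r = - (t - t0) by rewrite /r; ring.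
  rewrite mulrN /k; lra.
apply: (@le_trans _ _ (m `^ p * 2 `^ p)).
  by rewrite ler_pM2l//; apply: le_powR; lra.
apply: (@le_trans _ _ (2 `^ p / k * (m `^ p * k))).
  by rewrite le_eqVlt; apply/orP; left; apply/eqP; field; rewrite gt_eqF.
rewrite ler_wpM2l ?divr_ge0 ?powR_ge0 ?(ltW k0)//.
rewrite [leRHS](_ : _ = m `^ p * (((1 + t) `^ p + (1 - t) `^ p) / 2 - 1)); last by field.
by rewrite ler_pM2l.
Qed.

End PowerConvexity.

Lemma ae_imply2 d (T : measurableType d) (R : realType) (mu : {measure set T -> \bar R})
    (P Q S : T -> Prop) : {ae mu, forall x, P x} -> {ae mu, forall x, Q x} ->
  (forall x, P x -> Q x -> S x) -> {ae mu, forall x, S x}.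
Proof. by move=> aP aQ PQS; apply: filterS2 aP aQ. Qed.

Section LowerSemicontinuity.
Context {R : realType} {X : pmetricType R}.
Variable mu : {outer_measure set X -> \bar R}.
Hypothesis mmu : metric_measure mu.
Variables (p : R) (D : set X).
Hypotheses (p1 : 1 < p) (oD : open D).
Implicit Types (f u : X -> R) (g h : X -> \bar R).
Local Notation cX := (caratheodory_type mu).
Local Notation E := (energy mu p D).
Let p0 : 0 < p. Proof. exact: lt_trans p1. Qed.
Let mD : measurable (D : set cX). Proof. exact: measurable_open. Qed.

Lemma energy_EFin s (A : set X) f :
  energy mu s A (fun x => `|f x|%:E) = (\int[cmeas mu]_(x in A) (`|f x| `^ s)%:E)%E.
Proof. by []. Qed.

Lemma Lp_normr_energy (s : R) (A : set X) f : 0 < s -> measurable (A : set cX) ->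
  Lp_normr mu s A f = (energy mu s A (fun x => `|f x|%:E) `^ s^-1)%E.
Proof. by move=> s0 mA; rewrite /Lp_normr Lp_norm_energy. Qed.

Lemma Lp_normr_poweR (s : R) (A : set X) f : 0 < s -> measurable (A : set cX) ->
  (Lp_normr mu s A f `^ s)%E = energy mu s A (fun x => `|f x|%:E).
Proof. by move=> s0 mA; rewrite Lp_normr_energy// poweRVK// energy_ge0. Qed.

Lemma measurable_energy_EFin (s : R) (A : set X) f :
  measurable_fun (T := cX) A f -> measurable_fun (T := cX) A (fun x => (`|f x| `^ s)%:E).
Proof.
move=> mf; apply/measurable_EFinP.
apply: (@measurableT_comp _ _ _ _ _ _ (fun x : R => x `^ s)); first exact: measurable_powR.
exact: measurableT_comp.
Qed.

Lemma Lp_normrD (s : R) (A : set X) f f' : 1 <= s -> measurable (A : set cX) ->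
  measurable_fun (T := cX) A f -> measurable_fun (T := cX) A f' ->
  (Lp_normr mu s A (f \+ f')%R <= Lp_normr mu s A f + Lp_normr mu s A f')%E.
Proof.
move=> s1 mA mf mf'.
have EE (h : X -> R) : (EFin \o h) \_ A = EFin \o (h \_ A).
  by apply/funext => x; rewrite /= !patchE; case: ifP.
have ED : (f \+ f') \_ A = (f \_ A) \+ (f' \_ A).
  by apply/funext => x; rewrite /= !patchE; case: ifP; rewrite ?addr0.
rewrite /Lp_normr /Lp_norm !EE ED; apply: minkowski_EFin => //.
- exact/(measurable_restrictT _ _).1.
- exact/(measurable_restrictT _ _).1.
Qed.

Lemma ae_fin_num g : nonneg_borel D g -> (E g < +oo)%E ->
  {ae cmeas mu, forall x, D x -> g x \is a fin_num}.
Proof.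
move=> gb gE; have gi : (cmeas mu).-integrable D (fun x => (g x `^ p)%E).
  apply/integrableP; split; first exact: (measurable_energy mmu p oD gb).
  under eq_integral do rewrite gee0_abs ?poweR_ge0//.
  exact: gE.
apply: (ae_imply (integrable_ae mD gi)) => x H Dx.
have := H Dx; have := gb.2 _ Dx; case: (g x) => //.
by move=> _; rewrite poweRyr// gt_eqF.
Qed.

Lemma energy_ae_eq g h : nonneg_borel D g -> nonneg_borel D h ->
  {ae cmeas mu, forall x, D x -> g x = h x} -> E g = E h.
Proof.
move=> gb hb gh; apply: ge0_ae_eq_integral => //.
- exact: (measurable_energy mmu p oD gb).
- exact: (measurable_energy mmu p oD hb).
- by move=> x _; exact: poweR_ge0.
- by move=> x _; exact: poweR_ge0.
- by apply: (ae_imply gh) => x H Dx; rewrite H.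
Qed.

Lemma nonneg_borel_fine g : nonneg_borel D g ->
  nonneg_borel D (fun x => (fine (g x))%:E).
Proof.
move=> [mg g0]; split; first by apply/measurable_EFinP; exact: measurableT_comp.
by move=> x Dx; rewrite lee_fin fine_ge0// g0.
Qed.

Lemma energy_fine g : nonneg_borel D g -> (E g < +oo)%E ->
  E (fun x => (fine (g x))%:E) = E g.
Proof.
move=> gb gE; apply: energy_ae_eq => //; first exact: nonneg_borel_fine.
by apply: (ae_imply (ae_fin_num gb gE)) => x H Dx; rewrite fineK ?H.
Qed.

(** Convexity of balls of [L^p], for midpoints. *)
Lemma energy_midpoint f f' u (c : R) : measurable_fun (T := cX) D f ->
  measurable_fun (T := cX) D f' -> measurable_fun (T := cX) D u ->
  (E (fun x => `|f x - u x|%:E) <= c%:E)%E ->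
  (E (fun x => `|f' x - u x|%:E) <= c%:E)%E ->
  (E (fun x => `|2^-1 * (f x + f' x) - u x|%:E) <= c%:E)%E.
Proof.
move=> mf mf' mu_ fE fE'.
pose h1 x := `|f x - u x| `^ p; pose h2 x := `|f' x - u x| `^ p.
have mh1 : measurable_fun (T := cX) D (fun x => (h1 x)%:E).
  by apply: measurable_energy_EFin; exact: measurable_funB.
have mh2 : measurable_fun (T := cX) D (fun x => (h2 x)%:E).
  by apply: measurable_energy_EFin; exact: measurable_funB.
apply: (@le_trans _ _ (\int[cmeas mu]_(x in D) ((2^-1)%:E * ((h1 x)%:E + (h2 x)%:E)))%E).
  apply: ge0_le_integral => //.
  - by move=> x _; exact: poweR_ge0.
  - apply: measurable_energy_EFin; apply: measurable_funB => //.
    by apply: measurable_funM => //; exact: measurable_funD.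
  - by apply: measurable_funeM; exact: emeasurable_funD.
  - move=> x Dx; rewrite poweR_EFin -EFinD -EFinM lee_fin [leRHS]mulrC.
    apply: le_trans (powR_midpoint p1 (normr_ge0 _) (normr_ge0 _)).
    apply: le_powR; rewrite ?(ltW p0)//.
    rewrite [in leLHS](_ : _ - _ = ((f x - u x) + (f' x - u x)) / 2); last by field.
    by rewrite normrM (ger0_norm (_ : 0 <= 2^-1)) ?ler_wpM2r ?ler_normD ?invr_ge0.
rewrite ge0_integralZl_EFin//; last 2 first.
- by move=> x _; rewrite adde_ge0// lee_fin powR_ge0.
- exact: emeasurable_funD.
rewrite ge0_integralD//; last 2 first.
- by move=> x _; rewrite lee_fin powR_ge0.
- by move=> x _; rewrite lee_fin powR_ge0.
apply: (@le_trans _ _ ((2^-1)%:E * (c%:E + c%:E))%E).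
  by apply: lee_wpmul2l; [rewrite lee_fin invr_ge0|exact: leeD].
by rewrite -EFinD -EFinM lee_fin; lra.
Qed.

(** Here [m] is a lower bound for the energy of the midpoint. In [key] the subtracted midpoint term
    stands on the left, so that only integrals of nonnegative functions are added. *)
Lemma energy_uniform_convexity (d C : R) : 0 < d -> 0 <= C ->
  (forall a b : R, 0 <= a -> 0 <= b ->
    `|a - b| `^ p <= d * (a `^ p + b `^ p) +
      C * ((a `^ p + b `^ p) / 2 - ((a + b) / 2) `^ p)) ->
  forall g h (a b m : R), nonneg_borel D g -> nonneg_borel D h ->
  (E g <= a%:E)%E -> (E h <= b%:E)%E ->
  (m%:E <= E (fun x => `|2^-1|%:E * (g x + h x))%E)%E ->
  (E (fun x => `|fine (g x) - fine (h x)|%:E) <=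
    (d * (a + b) + C * ((a + b) / 2 - m))%:E)%E.
Proof.
move=> d0 C0 uc g h a b m gb hb ga hb' mgh.
have gE : (E g < +oo)%E by apply: (le_lt_trans ga); exact: ltry.
have hE : (E h < +oo)%E by apply: (le_lt_trans hb'); exact: ltry.
pose r x := fine (g x); pose s x := fine (h x).
have r0 x : D x -> 0 <= r x by move=> Dx; rewrite fine_ge0// gb.2.
have s0 x : D x -> 0 <= s x by move=> Dx; rewrite fine_ge0// hb.2.
have mr : measurable_fun (T := cX) D r.
  by apply: measurableT_comp => //; exact: (borel_fun_measurable mmu oD gb.1).
have ms : measurable_fun (T := cX) D s.
  by apply: measurableT_comp => //; exact: (borel_fun_measurable mmu oD hb.1).
pose t x := `|2^-1| * (r x + s x).
have mt : measurable_fun (T := cX) D t by apply: measurable_funM => //; exact: measurable_funD.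
have et : E (fun x => `|2^-1|%:E * (g x + h x))%E = (\int[cmeas mu]_(x in D) (t x `^ p)%:E)%E.
  have gb' := nonneg_borel_fine gb; have hb'' := nonneg_borel_fine hb.
  have half0 : 0 <= `|2^-1| :> R by [].
  transitivity (E (fun x => `|2^-1|%:E * ((r x)%:E + (s x)%:E))%E); last by [].
  apply: energy_ae_eq; try by apply: nonneg_borelZ => //; exact: nonneg_borelD.
  apply: (ae_imply2 (ae_fin_num gb gE) (ae_fin_num hb hE)) => x Hg Hh Dx.
  by rewrite /r /s !fineK ?Hg ?Hh.
have mP (k : X -> R) : measurable_fun (T := cX) D k ->
    measurable_fun (T := cX) D (fun x => (k x `^ p)%:E).
  move=> mk; apply/measurable_EFinP.
  by apply: (@measurableT_comp _ _ _ _ _ _ (fun x : R => x `^ p)); first exact: measurable_powR.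
pose I := E (fun x => `|r x - s x|%:E).
have mrs : measurable_fun (T := cX) D (fun x => (`|r x - s x| `^ p)%:E).
  by apply: measurable_energy_EFin; exact: measurable_funB.
have key : (I + C%:E * (\int[cmeas mu]_(x in D) (t x `^ p)%:E) <=
    (d + C / 2)%:E * (E g + E h))%E.
  rewrite -(energy_fine gb gE) -(energy_fine hb hE) -/r -/s.
  rewrite -ge0_integralZl_EFin//; last 2 first.
  - by move=> x _; rewrite lee_fin powR_ge0.
  - exact: mP.
  rewrite -ge0_integralD//; last 3 first.
  - by move=> x _; exact: poweR_ge0.
  - by move=> x _; rewrite mule_ge0// lee_fin powR_ge0.
  - by apply: measurable_funeM; exact: mP.
  rewrite -[X in (_ <= _ * X)%E](@ge0_integralD _ _ _ (cmeas mu) D mD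
    (fun x => (r x `^ p)%:E) (fun x => (s x `^ p)%:E)); last 4 first.
  - by move=> x _; rewrite lee_fin powR_ge0.
  - exact: mP.
  - by move=> x _; rewrite lee_fin powR_ge0.
  - exact: mP.
  have dC : 0 <= d + C / 2 by rewrite addr_ge0 ?divr_ge0 ?(ltW d0).
  rewrite -ge0_integralZl_EFin//; last 2 first.
  - by move=> x _; rewrite -EFinD lee_fin addr_ge0// powR_ge0.
  - by apply: emeasurable_funD; exact: mP.
  apply: ge0_le_integral => //.
  - by move=> x _; rewrite adde_ge0 ?mule_ge0 ?lee_fin ?powR_ge0.
  - by apply: emeasurable_funD => //; apply: measurable_funeM; exact: mP.
  - by apply: measurable_funeM; apply: emeasurable_funD; exact: mP.
  - move=> x Dx; suff : `|r x - s x| `^ p + C * (t x `^ p) <=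
        (d + C / 2) * (r x `^ p + s x `^ p) by rewrite -lee_fin.
    rewrite /t ger0_norm ?invr_ge0// (mulrC 2^-1).
    by have := uc _ _ (r0 _ Dx) (s0 _ Dx); lra.
rewrite -/I.
have Cm : ((C * m)%:E <= C%:E * (\int[cmeas mu]_(x in D) (t x `^ p)%:E))%E.
  by rewrite EFinM lee_wpmul2l ?lee_fin// -et.
have {}key : (I + (C * m)%:E <= ((d + C / 2) * (a + b))%:E)%E.
  apply: (le_trans (leeD2l _ Cm)); apply: (le_trans key).
  rewrite EFinM EFinD lee_wpmul2l ?lee_fin ?addr_ge0 ?divr_ge0 ?(ltW d0)//.
  by rewrite EFinD leeD.
rewrite [X in (_ <= X%:E)%E](_ : _ = (d + C / 2) * (a + b) - C * m); last by field.
by rewrite EFinB leeBrDr.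
Qed.

End LowerSemicontinuity.

(** * Functions of nearly minimal energy close to a given limit *)

Section NearMinimizers.
Context {R : realType} {X : pmetricType R}.
Variable mu : {outer_measure set X -> \bar R}.
Hypothesis mmu : metric_measure mu.
Variables (p : R) (D : set X).
Hypotheses (p1 : 1 < p) (oD : open D).
Local Notation cX := (caratheodory_type mu).
Local Notation E := (energy mu p D).
Let p0 : 0 < p. Proof. exact: lt_trans p1. Qed.
Let mD : measurable (D : set cX). Proof. exact: measurable_open. Qed.

Variables (u : X -> R) (l : R).
Hypothesis mu_ : measurable_fun (T := cX) D u.
Hypothesis l0 : 0 <= l.
Hypothesis approx : forall e : R, 0 < e -> exists f, [/\ newtonian mu p D f,
  (E (fun x => `|f x - u x|%:E) <= e%:E)%E &
  (E (nabla_min mu p D f) <= (l + e)%:E)%E].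

(** Pairs of a function and some upper gradient, in place of functions with their minimal gradient:
    midpoints can then be taken in both components, by subadditivity of weak upper gradients. *)
Let B n := [set fg : (X -> R) * (X -> \bar R) |
  [/\ measurable_fun (T := cX) D fg.1, Lp_weak_upper_gradient mu p D fg.1 fg.2 &
    (E (fun x => `|fg.1 x - u x|%:E) <= (1 / (2 ^ n.+1)%:R)%:E)%E]].
Let d n := ereal_inf [set E fg.2 | fg in B n].

Let B_nonincreasing n m : (n <= m)%N -> B m `<=` B n.
Proof.
move=> nm fg [h1 h2 h3]; split => //; apply: (le_trans h3).
by rewrite lee_fin ler_pM2l// lef_pV2 ?posrE// ler_nat leq_pexp2l.
Qed.

Let d_ge0 n : (0 <= d n)%E.
Proof. by apply: le_ereal_inf_tmp => _ [fg _ <-]; exact: energy_ge0. Qed.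

Let d_le n : (d n <= l%:E)%E.
Proof.
apply/lee_addgt0Pr => e e0.
have en0 : 0 < Num.min e (1 / (2 ^ n.+1)%:R) by rewrite lt_min e0 divr_gt0.
have [f [fN fu fg]] := approx en0.
have [nL _] := nabla_minP mmu p0 oD fN.2.
apply: (@le_trans _ _ (E (nabla_min mu p D f))).
  apply: ereal_inf_lbound; exists (f, nabla_min mu p D f) => //; split => //=.
    by case: fN => -[].
  by apply: (le_trans fu); rewrite lee_fin ge_min lexx orbT.
by apply: (le_trans fg); rewrite -EFinD lee_fin lerD2l ge_min lexx.
Qed.

Let d_fin n : d n \is a fin_num.
Proof. by rewrite ge0_fin_numE// (le_lt_trans (d_le n)) ?ltry. Qed.

Let e n : R := fine (d n).
Let eE n : (e n)%:E = d n. Proof. by rewrite /e fineK. Qed.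
Let e_ge0 n : 0 <= e n. Proof. by rewrite -lee_fin eE. Qed.
Let e_le n : e n <= l. Proof. by rewrite -lee_fin eE. Qed.
Let e_homo n m : (n <= m)%N -> e n <= e m.
Proof.
move=> nm; rewrite -lee_fin !eE; apply: le_ereal_inf.
by move=> _ [fg /(B_nonincreasing nm) ? <-]; exists fg.
Qed.

Let near_min : exists F : nat -> (X -> R) * (X -> \bar R),
  forall n, B n (F n) /\ (E (F n).2 <= (e n + n.+1%:R^-1)%:E)%E.
Proof.
suff : forall n, exists fg, B n fg /\ (E fg.2 <= (e n + n.+1%:R^-1)%:E)%E.
  by move=> /choice[F]; exists F.
move=> n; have n0 : 0 < n.+1%:R^-1 :> R by [].
have [_ [fg Bfg <-] /ltW H] := lb_ereal_inf_adherent n0 (d_fin n).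
by exists fg; split => //; rewrite EFinD eE.
Qed.

(** The midpoint stays in [B n], so its energy cannot fall below the infimum. This is the lower
    bound that uniform convexity turns into closeness of the gradients. *)
Let midpoint_le n fg fg' : B n fg -> B n fg' ->
  ((e n)%:E <= E (fun x => `|2^-1|%:E * (fg.2 x + fg'.2 x))%E)%E.
Proof.
move=> [mf [gf gE] fu] [mf' [gf' gE'] fu']; rewrite eE; apply: ereal_inf_lbound.
exists ((fun x => 2^-1 * (fg.1 x + fg'.1 x))%R,
  fun x => `|2^-1|%:E * (fg.2 x + fg'.2 x))%E; last by [].
have wD := weak_upper_gradientD mmu p0 oD gf gf'.
have wZ := weak_upper_gradientZ oD 2^-1 wD.
split => /=.
- by apply: measurable_funM => //; exact: measurable_funD.
- apply/(Lp_weak_upper_gradientP mmu p0 oD); split => //.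
  have {}gE := ((Lp_weak_upper_gradientP mmu p0 oD _ _).1 (conj gf gE)).2.
  have {}gE' := ((Lp_weak_upper_gradientP mmu p0 oD _ _).1 (conj gf' gE')).2.
  apply: (@le_lt_trans _ _ (\int[cmeas mu]_(x in D)
     ((2^-1)%:E * (fg.2 x `^ p + fg'.2 x `^ p)))%E).
    apply: ae_ge0_le_integral => //.
    + by move=> x _; exact: poweR_ge0.
    + exact: (measurable_energy mmu p oD wZ.1).
    + by move=> x _; rewrite mule_ge0 ?adde_ge0 ?poweR_ge0// lee_fin invr_ge0.
    + apply: measurable_funeM; apply: emeasurable_funD.
        exact: (measurable_energy mmu p oD gf.1).
      exact: (measurable_energy mmu p oD gf'.1).
    + apply: (ae_imply2 (ae_fin_num mmu p1 oD gf.1 gE) (ae_fin_num mmu p1 oD gf'.1 gE')).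
      move=> x Hg Hg' Dx; move: (gf.1.2 x Dx) (gf'.1.2 x Dx).
      rewrite -(fineK (Hg Dx)) -(fineK (Hg' Dx)) !lee_fin => r0 s0.
      suff : (2^-1 * (fine (fg.2 x) + fine (fg'.2 x))) `^ p <=
          2^-1 * (fine (fg.2 x) `^ p + fine (fg'.2 x) `^ p).
        by rewrite -lee_fin ger0_norm ?invr_ge0.
      by rewrite mulrC [leRHS]mulrC; exact: powR_midpoint.
  rewrite ge0_integralZl_EFin//; last 2 first.
  - by move=> x _; rewrite adde_ge0 ?poweR_ge0.
  - apply: emeasurable_funD.
      exact: (measurable_energy mmu p oD gf.1).
    exact: (measurable_energy mmu p oD gf'.1).
  rewrite ge0_integralD//; last 4 first.
  - by move=> x _; exact: poweR_ge0.
  - exact: (measurable_energy mmu p oD gf.1).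
  - by move=> x _; exact: poweR_ge0.
  - exact: (measurable_energy mmu p oD gf'.1).
  have a0 := energy_ge0 mu p D fg.2; have b0 := energy_ge0 mu p D fg'.2.
  rewrite -/(energy _ _ _ _) -/(energy _ _ _ _).
  move: gE gE' a0 b0; case: (energy mu p D fg.2) => // r; case: (energy mu p D fg'.2) => // s.
  by move=> *; exact: ltry.
- exact: energy_midpoint.
Qed.

(** The infima [e n] increase and are bounded by [l], so late near-minimizers have energies close to
    the infimum that bounds their midpoints, and their gradients form a Cauchy sequence. Any
    prescribed rate [eps] is met by a subsequence. *)
Lemma near_minimizing_sequence (eps : nat -> R) : (forall j, 0 < eps j) ->
  exists (f : nat -> X -> R) (g : nat -> X -> \bar R), forall j,
  [/\ measurable_fun (T := cX) D (f j), Lp_weak_upper_gradient mu p D (f j) (g j),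
    (E (fun x => `|f j x - u x|%:E) <= (1 / (2 ^ j.+1)%:R)%:E)%E,
    (E (g j) <= (l + j.+1%:R^-1)%:E)%E &
    (E (fun x => `|fine (g j x) - fine (g j.+1 x)|%:E) <= (eps j)%:E)%E].
Proof.
move=> eps0; have [F FP] := near_min.
pose S := [set e n | n in [set: nat]].
have hsS : has_sup S by split; [exists (e 0%N), 0%N|exists l => _ [n _ <-]].
have cauchy (c : R) : 0 < c -> exists N, forall n m, (N <= n)%N -> (n <= m)%N ->
    (E (fun x => `|fine ((F n).2 x) - fine ((F m).2 x)|%:E) <= c%:E)%E.
  move=> c0.
  (* The energies involved are at most [l + 1], so the term with [dl] is at most [c / 2]; [eta] is
     chosen so that the convexity term contributes at most the other half. *)
  pose dl := c / (4 * (l + 1)).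
  have l1 : 0 < l + 1 by rewrite ltr_wpDl.
  have dl0 : 0 < dl by rewrite divr_gt0// mulr_gt0.
  have [C C0 uc] := powR_uniform_convexity p1 dl0.
  pose eta := c / (2 * (C + 1)).
  have C1 : 0 < C + 1 by rewrite ltr_wpDl.
  have eta0 : 0 < eta by rewrite divr_gt0// mulr_gt0.
  (* Beyond [N1] the infima vary by less than [eta], and beyond [N2] the errors [1 / (n + 1)] are
     below [eta / 2]. *)
  have [_ [N1 _ <-] N1P] := sup_adherent eta0 hsS.
  have eta20 : 0 < eta / 2 by rewrite divr_gt0.
  have [N2 _ N2P] := near_infty_natSinv_lt (PosNum eta20).
  exists (maxn N1 N2) => n m; rewrite geq_max => /andP[N1n N2n] nm.
  have [Bn En] := FP n; have [Bm Em] := FP m.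
  have Bgb : nonneg_borel D (F n).2 by case: Bn => _ [[]].
  have Bhb : nonneg_borel D (F m).2 by case: Bm => _ [[]].
  have mid := midpoint_le Bn (B_nonincreasing nm Bm).
  apply: (le_trans (energy_uniform_convexity mmu p1 oD dl0 C0 uc Bgb Bhb En Em mid)).
  have n1 := N2P n N2n; have m1 := N2P m (leq_trans N2n nm).
  rewrite /= in n1 m1; rewrite lee_fin.
  set an := n.+1%:R^-1 in n1 *; set am := m.+1%:R^-1 in m1 *.
  have an1 : an <= 1 by rewrite invf_le1// ler1n.
  have am1 : am <= 1 by rewrite invf_le1// ler1n.
  have enl := e_le n; have eml := e_le m.
  have N1n' := e_homo N1n.
  have emS : e m <= sup S by apply: ub_le_sup; [case: hsS|exists m].
  have b1 : dl * (e n + an + (e m + am)) <= dl * (2 * (l + 1)).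
    by rewrite ler_pM2l//; lra.
  have b2 : C * ((e n + an + (e m + am)) / 2 - e n) <= C * eta.
    by rewrite ler_wpM2l//; lra.
  have b3 : C * eta <= (C + 1) * eta by rewrite ler_pM2r// lerDl.
  have b4 : dl * (2 * (l + 1)) = c / 2 by rewrite /dl; field; rewrite gt_eqF.
  have b5 : (C + 1) * eta = c / 2 by rewrite /eta; field; rewrite gt_eqF.
  lra.
have /choice[N NP] := fun j => cauchy _ (eps0 j).
pose fix k j := if j is j'.+1 then maxn (k j').+1 (N j) else N 0%N.
have kN j : (N j <= k j)%N by case: j => //= j; rewrite leq_maxr.
have kS j : (k j < k j.+1)%N by rewrite /= leq_max leqnn.
have kj j : (j <= k j)%N.
  by elim: j => // j ih; rewrite (leq_ltn_trans ih).
exists (fun j => (F (k j)).1), (fun j => (F (k j)).2) => j.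
have [[Bf Bg Bu] En] := FP (k j); split => //.
- by have [] := B_nonincreasing (kj j) (FP (k j)).1.
- apply: (le_trans En); rewrite lee_fin lerD ?e_le//.
  by rewrite lef_pV2 ?posrE// ler_nat ltnS.
- by apply: NP => //; exact: ltnW.
Qed.

End NearMinimizers.

(** * Lower semicontinuity of the energy *)

Lemma limn_esup_leD {R : realType} (u v : (\bar R)^nat) (c : R) (n : nat) :
  (forall m, (n <= m)%N -> (u m <= v m + c%:E)%E) ->
  (limn_esup u <= limn_esup v + c%:E)%E.
Proof.
move=> uv; rewrite !limn_esup_lim.
have vc : esups v m + c%:E @[m --> \oo] --> (limn (esups v) + c%:E)%E.
  apply: cvgeD; [by rewrite fin_num_adde_defl|exact: is_cvg_esups|exact: cvg_cst].
rewrite -(cvg_lim _ vc)//; apply: lee_lim.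
- exact: is_cvg_esups.
- by apply/cvg_ex; eexists; exact: vc.
- exists n => // m /= nm; apply: esups_le => k mk.
  by apply: (le_trans (uv _ (leq_trans nm mk))); rewrite leeD2r// esups_ub.
Qed.

(* [fine] sends both infinities to [0], so no case distinction between bounded
   and unbounded sequences is needed. *)
Lemma fine_limn_esup_dist {R : realType} (u v : R^nat) (c : R) (n : nat) :
  (forall m, (n <= m)%N -> `|u m - v m| <= c) ->
  `|fine (limn_esup (EFin \o u)) - fine (limn_esup (EFin \o v))| <= c.
Proof.
move=> uv.
have uvc : (limn_esup (EFin \o u) <= limn_esup (EFin \o v) + c%:E)%E.
  apply: (@limn_esup_leD _ _ _ _ n) => m nm; rewrite -EFinD lee_fin -lerBlDl.
  by apply: le_trans (uv m nm); exact: ler_norm.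
have vuc : (limn_esup (EFin \o v) <= limn_esup (EFin \o u) + c%:E)%E.
  apply: (@limn_esup_leD _ _ _ _ n) => m nm; rewrite -EFinD lee_fin -lerBlDl.
  by apply: le_trans (uv m nm); rewrite distrC; exact: ler_norm.
have c0 : 0 <= c by apply: le_trans (uv n (leqnn n)).
move: uvc vuc; case: (limn_esup _) => [x| |]; case: (limn_esup _) => [y| |] //=;
  rewrite ?subrr ?normr0//.
by rewrite -!EFinD !lee_fin => ? ?; rewrite ler_norml; apply/andP; split; lra.
Qed.

Section SummableFamilies.
Context d (T : measurableType d) {R : realType}.
Variables (mu : {measure set T -> \bar R}) (D : set T).
Hypothesis mD : measurable D.

(** The sum [H] serves twice: where it is finite the whole sequence tends to [0], and it is an
    integrable majorant of all [|h n| ^ s]. *)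
Lemma summable_ae (s : R) (h : nat -> T -> R) : 0 < s ->
  (forall n, measurable_fun D (h n)) ->
  (forall n, (\int[mu]_(x in D) (`|h n x| `^ s)%:E <= (1 / (2 ^ n.+1)%:R)%:E)%E) ->
  let H x := (\sum_(0 <= n <oo) (`|h n x| `^ s)%:E)%E in
  [/\ measurable_fun D H, mu.-integrable D H &
    {ae mu, forall x, D x -> h n x @[n --> \oo] --> (0 : R)}].
Proof.
move=> s0 mh hE H.
have mhs n : measurable_fun D (fun x => (`|h n x| `^ s)%:E).
  apply/measurable_EFinP.
  apply: (@measurableT_comp _ _ _ _ _ _ (fun x : R => x `^ s)); first exact: measurable_powR.
  exact: measurableT_comp.
have mH : measurable_fun D H.
  by apply: ge0_emeasurable_sum => [n x _ _|n _] //; rewrite lee_fin powR_ge0.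
have H0 x : (0 <= H x)%E by apply: nneseries_ge0 => n _ _; rewrite lee_fin powR_ge0.
have HE : (\int[mu]_(x in D) H x <= 1%E)%E.
  rewrite integral_nneseries//.
  have := @epsilon_trick R (fun _ => 0%E) 1 xpredT (fun _ => lexx _) ler01.
  rewrite [X in (_ <= X + _)%E]eseries0// add0e; apply: le_trans.
  apply: lee_nneseries => [m _ _|m _]; last by rewrite add0e; exact: hE.
  by apply: integral_ge0 => x _; rewrite lee_fin powR_ge0.
have iH : mu.-integrable D H.
  apply/integrableP; split => //; rewrite (eq_integral H).
    by apply: (le_lt_trans HE); exact: ltry.
  by move=> x _; rewrite gee0_abs.
split => //; apply: (ae_imply (integrable_ae mD iH)) => x Hfin Dx.
have Hx : (H x < +oo)%E by rewrite -ge0_fin_numE// Hfin.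
have hs0 k : true -> (0 <= (`|h k x| `^ s)%:E)%E by rewrite lee_fin powR_ge0.
have tail := nneseries_tail_cvg Hx hs0.
apply/cvgr0Pnorm_lt => e e0.
have es0 : 0 < e `^ s by rewrite powR_gt0.
have [N _ NP] := cvge0_lt es0 tail.
exists N => // n /= Nn; rewrite ltNge; apply/negP => hn.
have := NP n Nn; rewrite ltNge => /negP; apply.
apply: (@le_trans _ _ (`|h n x| `^ s)%:E).
  by rewrite lee_fin; apply: le_powR; rewrite // ltW.
apply: le_trans (nneseries_lim_ge n.+1 _); last by move=> *; rewrite lee_fin powR_ge0.
by rewrite big_nat1.
Qed.

End SummableFamilies.

(** Continuity at [e = 0] by hand. With [m] halfway between the [p]-th roots of [l] and [N], a small
    [e] keeps the root of [l + e] below [m] and leaves room for the second [e]. The shape of the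
    bound is the one that Minkowski's inequality gives for the tail suprema. *)
Lemma le_powR_perturb {R : realType} (p l N : R) : 0 < p -> 0 <= l ->
  (forall e : R, 0 < e -> N <= ((l + e) `^ p^-1 + e) `^ p) -> N <= l.
Proof.
move=> p0 l0 H; rewrite leNgt; apply/negP => lN.
have N0 : 0 <= N by rewrite (le_trans l0)// ltW.
have pV (x : R) : 0 <= x -> (x `^ p^-1) `^ p = x.
  by move=> x0; rewrite -powRrM mulVf ?gt_eqF// powRr1.
have pV' (x : R) : 0 <= x -> (x `^ p) `^ p^-1 = x.
  by move=> x0; rewrite -powRrM divff ?gt_eqF// powRr1.
pose c := l `^ p^-1; pose c1 := N `^ p^-1.
have c0 : 0 <= c by exact: powR_ge0.
have cc1 : c < c1.
  rewrite ltNge; apply/negP => c1c; have := le_powR (ltW p0) (powR_ge0 _ _) c1c.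
  by rewrite /c /c1 !pV// leNgt lN.
pose m := (c + c1) / 2.
have m0 : 0 <= m by rewrite /m; lra.
have ml : l < m `^ p.
  rewrite ltNge; apply/negP => mc.
  have := le_powR (_ : 0 <= p^-1) (powR_ge0 _ _) mc; rewrite invr_ge0 (ltW p0) => /(_ isT).
  by rewrite pV'// -/c /m; lra.
pose e := Num.min (m `^ p - l) ((c1 - m) / 2).
have mc1 : m < c1 by rewrite /m; lra.
have e0 : 0 < e by rewrite lt_min subr_gt0 ml divr_gt0// subr_gt0.
have : (l + e) `^ p^-1 <= m.
  rewrite -[leRHS]pV'//; apply: le_powR; rewrite ?invr_ge0 ?(ltW p0)//.
    by rewrite addr_ge0// ltW.
  by rewrite -lerBrDl ge_min lexx.
have ec1 : e <= (c1 - m) / 2 by rewrite ge_min lexx orbT.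
move=> le_m.
have := H e e0; rewrite leNgt => /negP; apply.
have : (l + e) `^ p^-1 + e < c1 by lra.
rewrite -[X in _ < X -> _]/(N `^ p^-1) => lt.
rewrite ltNge; apply/negP => Ne.
have := le_powR (_ : 0 <= p^-1) N0 Ne; rewrite invr_ge0 (ltW p0) => /(_ isT).
by rewrite pV' ?addr_ge0 ?powR_ge0 ?(ltW e0)// leNgt lt.
Qed.

Section WeakLimit.
Context {R : realType} {X : pmetricType R}.
Variable mu : {outer_measure set X -> \bar R}.
Hypothesis mmu : metric_measure mu.
Variables (p : R) (D : set X).
Hypotheses (p1 : 1 < p) (oD : open D).
Local Notation cX := (caratheodory_type mu).
Local Notation E := (energy mu p D).
Let p0 : 0 < p. Proof. exact: lt_trans p1. Qed.
Let mD : measurable (D : set cX). Proof. exact: measurable_open. Qed.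

(** The tail supremum dominates every [g m] with [m >= n], so along almost every curve the
    increments of all these [f m] share one bound, which the upper limit inherits. *)
Lemma weak_upper_gradient_limn_esup (f : nat -> X -> R) (g : nat -> X -> \bar R) n :
  (forall m, weak_upper_gradient mu p D (f m) (g m)) ->
  weak_upper_gradient mu p D (fun x => fine (limn_esup (EFin \o f^~ x)))
    (fun x => esups (g^~ x) n).
Proof.
move=> fg; have Tb : nonneg_borel D (fun x => esups (g^~ x) n).
  by apply: nonneg_borel_esups => m; exact: (fg m).1.
split => //.
have H := ae_curve_countable mmu p0 oD (fun m => (fg m).2).
apply: (ae_curveW H) => gamma gD {}H.
have T0 := line_integral_ge0 Tb gD.
have HT m : (n <= m)%N -> (`|f m (gamma (cstart gamma)) - f m (gamma (cend gamma))|%:E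
    <= line_integral gamma (fun x => esups (g^~ x) n))%E.
  move=> nm; apply: (le_trans (H m)); apply: (le_line_integral oD (fg m).1 Tb gD).
  by move=> x _; exact: (@esups_ub _ (g^~ x)).
move: T0 HT; case: (line_integral _ _) => [c| |] //; last by move=> _ _; rewrite leey.
move=> _ HT; rewrite lee_fin; apply: (@fine_limn_esup_dist _ _ _ _ n) => m nm.
by rewrite -lee_fin HT.
Qed.

Lemma ae_measurable_fun_EFin (u v : X -> R) : measurable_fun (T := cX) D u ->
  {ae cmeas mu, forall x, D x -> u x = v x} -> measurable_fun (T := cX) D v.
Proof.
move=> mu_ uv; apply/measurable_EFinP.
apply: (@ae_measurable_fun _ _ _ (cmeas mu) _ D (EFin \o u)).
- exact: measure_is_complete_caratheodory.
- by apply: (ae_imply uv) => x H Dx /=; rewrite H.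
- exact/measurable_EFinP.
Qed.

Lemma in_Lp_energy (s : R) (f : X -> R) : 0 < s ->
  in_Lp mu s D f <-> measurable_fun (T := cX) D f /\
    (energy mu s D (fun x => `|f x|%:E) < +oo)%E.
Proof.
move=> s0; rewrite /in_Lp Lp_normr_energy//; split=> -[mf fin]; split => //.
- by apply: lty_poweRy fin; rewrite invr_eq0 gt_eqF.
- exact: poweR_lty.
Qed.

Lemma energy_EFin_ae_eq (s : R) (f f' : X -> R) :
  measurable_fun (T := cX) D f -> measurable_fun (T := cX) D f' ->
  {ae cmeas mu, forall x, D x -> f x = f' x} ->
  energy mu s D (fun x => `|f x|%:E) = energy mu s D (fun x => `|f' x|%:E).
Proof.
move=> mf mf' ff'; apply: ge0_ae_eq_integral => //.
- exact: measurable_energy_EFin.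
- exact: measurable_energy_EFin.
- by move=> x _; exact: poweR_ge0.
- by move=> x _; exact: poweR_ge0.
- by apply: (ae_imply ff') => x H Dx; rewrite H.
Qed.

Lemma in_Lp_ae_eq (s : R) (u v : X -> R) : 0 < s -> in_Lp mu s D u ->
  {ae cmeas mu, forall x, D x -> u x = v x} -> in_Lp mu s D v.
Proof.
move=> s0 /(in_Lp_energy _ s0)[mu_ uE] uv; apply/(in_Lp_energy _ s0).
have mv := ae_measurable_fun_EFin mu_ uv.
by split; [exact: mv|rewrite -(energy_EFin_ae_eq s mu_ mv uv)].
Qed.

(** [u] is only given as an [L^p] function and may itself lack a weak upper gradient; the upper
    limit [v] of near-minimizers is a representative that has one. Their gradients converge so fast
    that the [n]-th tail supremum exceeds the [n]-th gradient by at most [2 ^- n * S], with [S] of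
    finite energy. *)
Lemma newtonian_weak_limit (u : X -> R) (l : R) : in_Lp mu p D u -> 0 <= l ->
  (forall e : R, 0 < e -> exists f, [/\ newtonian mu p D f,
    (E (fun x => `|f x - u x|%:E) <= e%:E)%E &
    (E (nabla_min mu p D f) <= (l + e)%:E)%E]) ->
  exists v, [/\ newtonian mu p D v, {ae cmeas mu, forall x, D x -> u x = v x} &
    (E (nabla_min mu p D v) <= l%:E)%E].
Proof.
move=> uL l0 approx; have mu_ := uL.1.
(* With this rate the increments of the gradients, multiplied by [4 ^ j.+1], still have summable
   energies. Their supremum [S] has energy at most [1] and bounds the [j]-th increment by
   [4 ^- j.+1 * S]. *)
pose eps j : R := 1 / (2 ^ j.+1)%:R / ((4 ^+ j.+1) `^ p).
have eps0 j : 0 < eps j by rewrite !divr_gt0// powR_gt0// exprn_gt0.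
have [f [g fgP]] := near_minimizing_sequence mmu p1 oD mu_ l0 approx eps0.
have fw j : weak_upper_gradient mu p D (f j) (g j) by have [_ []] := fgP j.
have gb j : nonneg_borel D (g j) := (fw j).1.
have gfin j : (E (g j) < +oo)%E.
  by have [_ _ _ h _] := fgP j; apply: (le_lt_trans h); exact: ltry.
pose r j x := fine (g j x).
have mr j : measurable_fun (T := cX) D (r j).
  by apply: measurableT_comp => //; exact: (borel_fun_measurable mmu oD (gb j).1).
pose s j x := (((4 ^+ j.+1) : R)%:E * `|r j x - r j.+1 x|%:E)%E.
have drb j : nonneg_borel D (fun x => `|r j x - r j.+1 x|%:E).
  have mrb k : measurable_fun (T := g_sigma_algebraType (@open X)) D (r k).
    by apply: measurableT_comp => //; exact: (gb k).1.
  split; last by [].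
  by apply/measurable_EFinP; apply: measurableT_comp => //; exact: measurable_funB.
have sb j : nonneg_borel D (s j) by apply: nonneg_borelZ; rewrite ?exprn_ge0.
pose S x := esups (s^~ x) 0%N.
have Sb : nonneg_borel D S by exact: nonneg_borel_esups.
have SE : (E S <= 1%E)%E.
  apply: (energy_esups mmu p0 oD sb) => j.
  rewrite (energyZ mmu p oD _ (drb j)) ?exprn_ge0//.
  have [_ _ _ _ h] := fgP j.
  apply: (@le_trans _ _ (((4 ^+ j.+1) `^ p)%:E * (eps j)%:E)%E).
    by rewrite lee_wpmul2l// lee_fin powR_ge0.
  by rewrite -EFinM lee_fin /eps mulrC divfK// gt_eqF// powR_gt0// exprn_gt0.
have Sfin : (E S < +oo)%E by apply: (le_lt_trans SE); exact: ltry.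
pose v x := fine (limn_esup (EFin \o f^~ x)).
pose T n x := esups (g^~ x) n.
have vT n : weak_upper_gradient mu p D v (T n).
  exact: weak_upper_gradient_limn_esup.
have ms : measurable_fun (T := cX) D (fine \o S).
  by apply: measurableT_comp => //; exact: (borel_fun_measurable mmu oD Sb.1).
have Tae n : {ae cmeas mu, forall x, D x -> (T n x <= (r n x + (2 ^- n) * fine (S x))%:E)%E}.
  have gae := ae_foralln (fun j => ae_fin_num mmu p1 oD (gb j) (gfin j)).
  apply: (ae_imply2 gae (ae_fin_num mmu p1 oD Sb Sfin)) => x gx Sx Dx.
  have S0 : 0 <= fine (S x) by rewrite fine_ge0// Sb.2.
  have rS j : `|r j x - r j.+1 x| <= 4 ^- j.+1 * fine (S x).
    rewrite ler_pdivlMl ?exprn_gt0// -lee_fin fineK ?Sx//.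
    exact: (@esups_ub _ (s^~ x) 0 j).
  apply: esups_le => m nm.
  (* Telescoping: [4 ^- j.+1 <= 2 ^- j.+1 = 2 ^- j - 2 ^- j.+1]. *)
  have : r m x <= r n x + (2 ^- n - 2 ^- m) * fine (S x).
    rewrite -(subnK nm); elim: (m - n)%N => [|k ih]; first by rewrite add0n subrr mul0r addr0.
    rewrite addSn; set j := (k + n)%N in ih *.
    have h4 : 4 ^- j.+1 <= 2 ^- j.+1 :> R.
      by rewrite lef_pV2 ?posrE ?exprn_gt0// lerXn2r ?nnegrE// ler_nat.
    have h2 : 2 ^- j = 2 * 2 ^- j.+1 :> R by rewrite exprS invfM mulVKf.
    have := rS j; rewrite ler_norml => /andP[h _].
    have hS : 4 ^- j.+1 * fine (S x) <= 2 ^- j.+1 * fine (S x) by rewrite ler_wpM2r.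
    rewrite h2 in ih; move: ih h hS; rewrite !mulrBl -(mulrA 2).
    move: (2 ^- j.+1 * _) (4 ^- j.+1 * _) (2 ^- n * _) => a b c; lra.
  rewrite -(fineK (gx m Dx)) lee_fin => /le_trans; apply.
  rewrite lerD2l ler_wpM2r// gerBl invr_ge0 exprn_ge0//.
have Tb n : nonneg_borel D (T n) := (vT n).1.
(* Minkowski's inequality for the almost everywhere bound [Tae], with [S] of norm at most [1]. *)
have TE n : (E (T n) `^ p^-1 <= ((l + n.+1%:R^-1) `^ p^-1 + 2 ^- n)%:E)%E.
  have msn : measurable_fun (T := cX) D (fun x => 2 ^- n * fine (S x)).
    by apply: measurable_funM.
  apply: (@le_trans _ _ (Lp_normr mu p D (r n \+ (fun x => 2 ^- n * fine (S x)))%R)).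
    rewrite Lp_normr_energy//; apply: le_poweR; rewrite ?invr_ge0 ?(ltW p0) ?energy_ge0//.
    apply: ae_ge0_le_integral => //.
    - by move=> x _; exact: poweR_ge0.
    - exact: (measurable_energy mmu p oD (Tb n)).
    - by move=> x _; exact: poweR_ge0.
    - by apply: measurable_energy_EFin; exact: measurable_funD.
    - apply: (ae_imply (Tae n)) => x Tx Dx; apply: le_poweR; rewrite ?(ltW p0) ?(Tb n).2//.
      by apply: (le_trans (Tx Dx)); rewrite lee_fin ler_norm.
  apply: (le_trans (Lp_normrD (ltW p1) mD (mr n) msn)).
  rewrite EFinD; apply: leeD.
    rewrite Lp_normr_energy// -poweR_EFin; apply: le_poweR.
    - by rewrite invr_ge0 ltW.
    - exact: energy_ge0.
    - have [_ _ _ h _] := fgP n; apply: le_trans h; rewrite le_eqVlt; apply/orP; left.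
      apply/eqP; apply: etrans (energy_fine mmu p1 oD (gb n) (gfin n)).
      by apply: eq_integral => x; rewrite inE => Dx; rewrite ger0_norm// fine_ge0// (gb n).2.
  have n20 : 0 <= 2 ^- n :> R by rewrite invr_ge0 exprn_ge0.
  rewrite Lp_normr_energy//.
  have -> : E (fun x => `|2 ^- n * fine (S x)|%:E) =
      E (fun x => (2 ^- n)%:E * (fine (S x))%:E)%E.
    apply: eq_integral => x; rewrite inE => Dx.
    by rewrite ger0_norm// mulr_ge0// fine_ge0// Sb.2.
  rewrite (energyZ mmu p oD _ (nonneg_borel_fine Sb))// (energy_fine mmu p1 oD Sb Sfin).
  rewrite poweRM ?energy_ge0 ?lee_fin ?powR_ge0// poweR_EFin -powRrM divff ?gt_eqF//.
  rewrite powRr1// -[leRHS]mule1 lee_wpmul2l ?lee_fin//.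
  have := le_poweR (_ : 0 <= p^-1) (energy_ge0 _ _ _ _) SE.
  by rewrite invr_ge0 (ltW p0) => /(_ isT); rewrite poweR_EFin powR1.
have uv : {ae cmeas mu, forall x, D x -> u x = v x}.
  have mfu j : measurable_fun (T := cX) D (fun x => f j x - u x).
    by apply: measurable_funB => //; have [] := fgP j.
  have fuE j : (\int[cmeas mu]_(x in D) (`|f j x - u x| `^ p)%:E <= (1 / (2 ^ j.+1)%:R)%:E)%E.
    by have [] := fgP j.
  have [_ _ cv] := summable_ae mD p0 mfu fuE.
  apply: (ae_imply cv) => x fu Dx.
  have fux : f j x @[j --> \oo] --> u x.
    by apply/subr_cvg0; exact: fu.
  have /cvg_limn_einf_sup[_ vx] : (EFin \o f^~ x) j @[j --> \oo] --> (u x)%:E.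
    by apply: cvg_EFin => //; exact: nearW.
  by rewrite /v vx.
exists v; split => //.
  split; first exact: in_Lp_ae_eq uL uv.
  exists (T 0%N); apply/(Lp_weak_upper_gradientP mmu p0 oD); split => //.
  apply: (@lty_poweRy _ _ p^-1); first by rewrite invr_eq0 gt_eqF.
  by apply: (le_lt_trans (TE 0%N)); exact: ltry.
have TL n : Lp_weak_upper_gradient mu p D v (T n).
  apply/(Lp_weak_upper_gradientP mmu p0 oD); split => //.
  apply: (@lty_poweRy _ _ p^-1); first by rewrite invr_eq0 gt_eqF.
  by apply: (le_lt_trans (TE n)); exact: ltry.
have NE n := nabla_min_le mmu p0 oD (TL n).
have Nfin : E (nabla_min mu p D v) \is a fin_num.
  rewrite ge0_fin_numE ?energy_ge0//; apply: (le_lt_trans (NE 0%N)).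
  exact: ((Lp_weak_upper_gradientP mmu p0 oD _ _).1 (TL 0%N)).2.
rewrite -(fineK Nfin) lee_fin; apply: (le_powR_perturb p0 l0) => e e0.
have [n1 _ n1P] := near_infty_natSinv_lt (PosNum e0).
have [n2 _ n2P] : \forall n \near \oo, 2 ^- n < e.
  have := @cvg_expr R 2^-1; rewrite ger0_norm// invf_lt1// ltr1n => /(_ isT).
  move=> /cvgr0Pnorm_lt/(_ e e0); apply: filterS => n.
  by rewrite exprVn ger0_norm// invr_ge0 exprn_ge0.
pose n := maxn n1 n2.
have h1 := n1P n (leq_maxl _ _); have h2 := n2P n (leq_maxr _ _).
rewrite /= in h1 h2.
rewrite -lee_fin fineK//; apply: (le_trans (NE n)).
rewrite -[leLHS](poweRVK p0 (energy_ge0 _ _ _ _)) -poweR_EFin.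
apply: le_poweR; rewrite ?(ltW p0) ?poweR_ge0//.
apply: (le_trans (TE n)); rewrite lee_fin; apply: lerD; last exact: ltW.
apply: le_powR; rewrite ?invr_ge0 ?(ltW p0) ?addr_ge0 ?invr_ge0//.
by rewrite lerD2l ltW.
Qed.

End WeakLimit.

(** * Finite measure of the embedding domain *)

Lemma superlinear_growth_bounded {R : realType} (v : nat -> R) (A K C t : R) :
  1 < t -> 1 <= K -> 0 <= C -> (forall k, 0 <= v k) ->
  (forall k, v k <= A * K ^+ k) -> (forall k, v k `^ t <= C * v k.+1) ->
  exists M, forall k, v k <= M.
Proof.
move=> t1 K1 C0 v0 vA vC.
have t10 : 0 < t - 1 by rewrite subr_gt0.
have K0 : 0 < K by rewrite (lt_le_trans ltr01).
(* Above the threshold [M] the superlinear inequality forces growth by a factor of at least [2 * K]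
   at each step, which outruns [A * K ^ k]. *)
pose M := (2 * K * (C + 1)) `^ (t - 1)^-1; exists M => k.
have C1 : 0 < C + 1 by rewrite ltr_wpDl.
have b0 : 0 < 2 * K * (C + 1) by rewrite !mulr_gt0.
have M0 : 0 < M by rewrite powR_gt0.
rewrite leNgt; apply/negP => Mv.
have step j : M < v j -> 2 * K * v j <= v j.+1.
  move=> Mj; have vj : 0 < v j := lt_trans M0 Mj.
  have := vC j; rewrite -(mulr_powRB1 (v0 j)) ?(lt_trans ltr01)// => h.
  have : M `^ (t - 1) <= v j `^ (t - 1).
    by apply: le_powR; rewrite ltW.
  rewrite /M -powRrM mulVf ?gt_eqF// powRr1 ?(ltW b0)// => h2.
  have h3 : v j * (2 * K * (C + 1)) <= C * v j.+1.
    by apply: le_trans h; rewrite ler_pM2l.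
  have h4 : C * v j.+1 <= (C + 1) * v j.+1 by rewrite ler_wpM2r// lerDl.
  rewrite -(ler_pM2l C1); apply: le_trans h4; apply: le_trans h3.
  by rewrite le_eqVlt; apply/orP; left; apply/eqP; ring.
have grow j : M < v (j + k)%N /\ (2 * K) ^+ j * v k <= v (j + k)%N.
  elim: j => [|j [ih1 ih2]]; first by rewrite add0n expr0 mul1r.
  have h := step _ ih1; have K2 : 1 <= 2 * K by lra.
  split; rewrite addSn.
    apply: (lt_le_trans ih1); apply: le_trans h.
    by rewrite ler_peMl.
  have K20 : 0 <= 2 * K by lra.
  by apply: le_trans h; rewrite exprS -mulrA ler_wpM2l.
have vk : 0 < v k := lt_trans M0 Mv.
have bound j : 2 ^+ j * v k <= A * K ^+ k.
  have [_ h] := grow j; have := le_trans h (vA _).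
  rewrite exprMn exprD mulrAC (mulrCA A) (mulrC (2 ^+ j * _)) ler_pM2l//.
  exact: exprn_gt0.
have := bound (Num.Def.truncn (A * K ^+ k / v k)).+1.
rewrite -ler_pdivlMr// leNgt => /negP; apply.
apply: lt_le_trans (truncnS_gt _) _.
by rewrite -natrX ler_nat ltnW// ltn_expl.
Qed.

Section Lipschitz.
Context {R : realType} {X : pmetricType R}.
Variable mu : {outer_measure set X -> \bar R}.
Hypothesis mmu : metric_measure mu.
Local Notation cX := (caratheodory_type mu).
Implicit Types (D : set X) (f : X -> R).

Definition lipschitz_fun (c : R) f := forall x y, `|f x - f y| <= c * mdist x y.

Lemma lipschitz_fun_dist (z : X) : lipschitz_fun 1 (mdist z).
Proof.
move=> x y; rewrite mul1r ler_norml.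
have := metric_triangle z x y; have := metric_triangle z y x.
rewrite (metric_sym y x); lra.
Qed.

Lemma lipschitz_fun_max0 c f : lipschitz_fun c f ->
  lipschitz_fun c (fun x => Num.max 0 (f x)).
Proof.
move=> fc x y; apply: le_trans (fc x y); move: (f x) (f y) => a b.
rewrite ler_norml; have := ler_norm (a - b); have := ler_norm (b - a).
rewrite distrC; move: `|a - b| (normr_ge0 (a - b)) => n n0 h1 h2.
by case: (leP 0 a) => ?; case: (leP 0 b) => ?; apply/andP; split; lra.
Qed.

Lemma lipschitz_measurable c f D : lipschitz_fun c f ->
  measurable_fun (T := cX) D f.
Proof.
move=> fc; apply: (@measurable_funS _ _ cX _ setT) => //.
apply: (measurability _ (RGenOpens.measurableE R)) => _ [_ [a [b ->]] <-].
rewrite setTI; apply: (measurable_open mmu).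
rewrite openE => x /=; rewrite in_itv/= => /andP[ax xb].
have c0 : 0 < `|c| + 1 by rewrite ltr_wpDl.
pose e := Num.min (f x - a) (b - f x) / (`|c| + 1).
apply/nbhs_ballP; exists e; first by rewrite /= divr_gt0// lt_min !subr_gt0 ax.
move=> y; rewrite ballEmdist/= in_itv/= ltr_pdivlMr// => xy.
have := fc x y.
have cd : c * mdist x y <= mdist x y * (`|c| + 1).
  rewrite mulrC ler_wpM2l ?mdist_ge0//.
  by have := ler_norm c; lra.
move=> /le_trans/(_ cd)/le_lt_trans/(_ xy); rewrite lt_min => /andP[].
rewrite !ltr_norml => /andP[h1 h2] /andP[h3 h4].
by apply/andP; split; lra.
Qed.

Lemma energy_cst (s : R) D (c : R) : 0 <= c -> measurable (D : set cX) ->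
  energy mu s D (cst c%:E) = ((c `^ s)%:E * mu D)%E.
Proof. by move=> c0 mD; rewrite /energy integral_cst. Qed.

Lemma nonneg_borel_cst D (c : R) : 0 <= c -> nonneg_borel D (cst c%:E).
Proof. by move=> c0; split; [exact: measurable_cst|move=> x _; rewrite lee_fin]. Qed.

Lemma lipschitz_weak_upper_gradient (p : R) D c f : 0 < p -> open D -> 0 <= c ->
  lipschitz_fun c f -> weak_upper_gradient mu p D f (cst c%:E).
Proof.
move=> p0 oD c0 fc; split; first exact: nonneg_borel_cst.
apply/(ae_curveP mmu p0 oD); exists (cst 0%E); split.
- exact: nonneg_borel_cst.
- rewrite energy_cst// ?powR0 ?gt_eqF// ?mul0e ?ltry//.
  exact: (@measurable_open _ _ _ mmu).
move=> gamma gD _; rewrite line_integral_cst//; last exact: gD.1.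
rewrite -(fine_lengthK gD.1) -EFinM lee_fin; apply: (le_trans (fc _ _)).
rewrite ler_wpM2l// -lee_fin (fine_lengthK gD.1).
exact/mdist_le_curve_length/curve_le.
Qed.

Lemma lipschitz_newtonian (p : R) D c f (M : R) : 0 < p -> open D -> 0 <= c ->
  lipschitz_fun c f -> (forall x, `|f x| <= M) -> (mu D < +oo)%E ->
  newtonian mu p D f.
Proof.
move=> p0 oD c0 fc fM Dfin.
have mD : measurable (D : set cX) by exact: (measurable_open mmu).
have M0 : 0 <= M by apply: le_trans (fM point).
have cfin (a : R) : 0 <= a -> (energy mu p D (cst a%:E) < +oo)%E.
  by move=> a0; rewrite energy_cst// -ge0_fin_numE ?mule_ge0 ?lee_fin ?powR_ge0//;
    rewrite fin_numM// ge0_fin_numE.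
split; last first.
  exists (cst c%:E); apply/(Lp_weak_upper_gradientP mmu p0 oD); split.
    exact: lipschitz_weak_upper_gradient.
  exact: cfin.
have mf : measurable_fun (T := cX) D f by exact: lipschitz_measurable fc.
apply/(in_Lp_energy mmu oD f p0); split => //.
apply: le_lt_trans (cfin _ M0); apply: ge0_le_integral => //.
- by move=> x _; exact: poweR_ge0.
- exact: measurable_energy_EFin.
- by move=> x _; apply: le_poweR; rewrite ?(ltW p0) ?lee_fin.
Qed.

End Lipschitz.

Section FiniteMeasure.
Context {R : realType} {X : pmetricType R}.
Variable mu : {outer_measure set X -> \bar R}.
Hypothesis mmu : metric_measure mu.
Local Notation cX := (caratheodory_type mu).
Variables (Omega : set X) (p : R).
Hypotheses (oO : open Omega) (p0 : 0 < p).
Let mO : measurable (Omega : set cX). Proof. exact: (measurable_open mmu). Qed.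

Lemma open_mball (x : X) (r : R) : open (ball x r).
Proof.
rewrite openE => y; rewrite ballEmdist/= => xy.
apply/nbhs_ballP; exists (r - mdist x y); first by rewrite /= subr_gt0.
move=> z; rewrite ballEmdist/= => yz.
by rewrite (le_lt_trans (metric_triangle x y z))// -ltrBrDl.
Qed.

(** At least [1] on [ball x0 r] and [0] outside [ball x0 (2 * r)]. The upper gradient [cutoff_grad]
    is generous on purpose: it also dominates the cutoff itself, so one quantity bounds both parts
    of the Newtonian norm. *)
Let cutoff (x0 : X) (r : R) (x : X) : R := Num.max 0 (2 - mdist x0 x / r).
Let cutoff_grad (x0 : X) (r : R) (x : X) : \bar R := (2 * \1_(ball x0 (4 * r)) x)%:E.

Let cutoff_lipschitz x0 r : 0 < r -> lipschitz_fun r^-1 (cutoff x0 r).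
Proof.
move=> r0; apply: lipschitz_fun_max0 => x y.
have -> : 2 - mdist x0 x / r - (2 - mdist x0 y / r) =
   - (r^-1 * (mdist x0 x - mdist x0 y)) by ring.
rewrite normrN normrM gtr0_norm ?invr_gt0// ler_pM2l ?invr_gt0//.
by have := lipschitz_fun_dist x0 x y; rewrite mul1r.
Qed.

Let cutoff_ge0 x0 r x : 0 <= cutoff x0 r x.
Proof. by rewrite /cutoff le_max lexx. Qed.

Let cutoff_le2 x0 r x : 0 < r -> cutoff x0 r x <= 2.
Proof.
move=> r0; rewrite /cutoff ge_max ler0n/= gerBl divr_ge0 ?mdist_ge0 //; exact: ltW.
Qed.

Let cutoff_out x0 r x : 0 < r -> 2 * r <= mdist x0 x -> cutoff x0 r x = 0.
Proof.
by move=> r0 h; rewrite /cutoff max_l// subr_le0 ler_pdivlMr.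
Qed.

Let cutoff_grad_borel x0 r : nonneg_borel Omega (cutoff_grad x0 r).
Proof.
split; last by move=> x _; rewrite lee_fin mulr_ge0.
apply/measurable_EFinP; apply: measurable_funM => //.
by apply: measurable_indic; apply: sub_sigma_algebra; exact: open_mball.
Qed.

(** If an endpoint lies in [ball x0 (2 * r)], the piece of length [m = min L r] at that end stays in
    [ball x0 (4 * r)] and contributes [2 * m]. For [L <= r] this exceeds the Lipschitz bound
    [L / r]; for [L > r] it is [2 * r], and the cutoff varies by at most [2]. Both cases use
    [1 <= r]. *)
Let cutoff_upper_gradient x0 r : 1 <= r ->
  weak_upper_gradient mu p Omega (cutoff x0 r) (cutoff_grad x0 r).
Proof.
move=> r1; have r0 : 0 < r := lt_le_trans ltr01 r1.
split; first exact: cutoff_grad_borel.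
apply/(ae_curveP mmu p0 oO); exists (cst 0%E); split.
- exact: nonneg_borel_cst.
- by rewrite energy_cst// powR0 ?gt_eqF// mul0e ltry.
move=> gamma gD _; set ga := gamma (cstart gamma); set gb := gamma (cend gamma).
have L0 := fine_length_ge0 gamma; have LE := fine_lengthK gD.1.
set L := fine (length gamma) in L0 LE.
have abL : mdist ga gb <= L.
  by rewrite -lee_fin LE; exact/mdist_le_curve_length/curve_le.
pose m := Num.min L r.
have m0 : 0 <= m by rewrite le_min L0 ltW.
have mL : m <= L by rewrite ge_min lexx.
have mr : m <= r by rewrite ge_min lexx orbT.
have [[outa outb]|[s [s0 smL inball]]] :
    (2 * r <= mdist x0 ga /\ 2 * r <= mdist x0 gb) \/
    exists s, [/\ 0 <= s, s + m <= L &
      forall t, t \in `[s, s + m] -> mdist x0 (arc_param gamma t) < 4 * r].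
  have [outa|ina] := leP (2 * r) (mdist x0 ga); last first.
    right; exists 0; split; rewrite ?add0r// => t; rewrite in_itv/= => /andP[t0 tm].
    have := mdist_arc_param gD.1 (lexx 0) t0 (le_trans tm mL).
    rewrite (arc_param_start gD.1) -/ga.
    by have := metric_triangle x0 ga (arc_param gamma t); lra.
  have [outb|inb] := leP (2 * r) (mdist x0 gb); [by left|right].
  exists (L - m); split; rewrite ?subr_ge0 ?subrK// => t; rewrite in_itv/= => /andP[t0 tL].
  have Lm : 0 <= L - m by rewrite subr_ge0.
  have := mdist_arc_param gD.1 (le_trans Lm t0) tL (lexx L).
  rewrite (arc_param_end gD.1) -/gb metric_sym.
  by have := metric_triangle x0 gb (arc_param gamma t); lra.
- rewrite !cutoff_out// subrr normr0.
  exact: line_integral_ge0 (cutoff_grad_borel x0 r) gD.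
- apply: (@le_trans _ _ (2 * m)%:E).
    rewrite lee_fin; have c2a := cutoff_le2 x0 ga r0; have c2b := cutoff_le2 x0 gb r0.
    have c0a := cutoff_ge0 x0 r ga; have c0b := cutoff_ge0 x0 r gb.
    have [Lr|rL] := leP L r; last first.
      rewrite /m min_r ?(ltW rL)// ler_norml; apply/andP; split; lra.
    rewrite /m min_l//; apply: (le_trans (cutoff_lipschitz x0 r0 ga gb)).
    have : 0 <= (r - 1) * L by rewrite mulr_ge0 ?subr_ge0.
    have rL : 0 <= r * L by rewrite mulr_ge0 // ltW.
    rewrite ler_pdivrMl//; lra.
  have sub : [set` `[s, s + m]] `<=` [set` `[0, L]].
    move=> t /=; rewrite !in_itv/= => /andP[st ts].
    by rewrite (le_trans s0 st) (le_trans ts smL).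
  apply: (@le_trans _ _ (\int[@lebesgue_measure R]_(t in `[s, (s + m)%R])
      cutoff_grad x0 r (arc_param gamma t))%E); last first.
    apply: ge0_subset_integral => //.
    - exact: measurable_arc_param (cutoff_grad_borel x0 r).1 gD.
    - by move=> t _; rewrite lee_fin mulr_ge0.
  rewrite (@eq_integral _ _ _ _ _ (cst 2%:E)); last first.
    move=> t; rewrite inE => /= /inball tb; rewrite /cutoff_grad indicE mem_set ?mulr1//.
    by rewrite ballEmdist.
  rewrite integral_cst//= lebesgue_measure_itv/= lte_fin ltrDl.
  have -> : ((s + m)%:E + (- s)%:E)%E = m%:E by congr EFin; ring.
  case: ltP => mm; first by rewrite EFinM.
  by rewrite (le_anti (introT andP (conj mm m0))) mulr0 mule0.
Qed.

Let energy_cutoff_grad x0 r : energy mu p Omega (cutoff_grad x0 r) =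
  ((2 `^ p)%:E * mu (Omega `&` ball x0 (4 * r)))%E.
Proof.
have mB : measurable (ball x0 (4 * r) : set cX).
  exact/(measurable_open mmu)/open_mball.
transitivity (\int[cmeas mu]_(x in Omega) ((2 `^ p)%:E * (\1_(ball x0 (4 * r)) x)%:E))%E.
  apply: eq_integral => x _; rewrite /cutoff_grad poweR_EFin -EFinM powRM//.
  by rewrite indicE; case: (_ \in _); rewrite ?powR1// powR0// gt_eqF.
rewrite ge0_integralZl_EFin//.
- by rewrite integral_indic// setIC.
- by apply/measurable_EFinP; exact: measurable_indic.
Qed.

Hypothesis doubl : doubling mu.

Lemma mu_ball_fin x r : (mu (ball x r) < +oo)%E.
Proof.
have [r0|r0] := ltP 0 r; first by have /andP[] := mmu.2 x r r0.
have -> : ball x r = set0; last by rewrite outer_measure0 ltry.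
apply/seteqP; split => // y; rewrite ballEmdist/= => xy.
by have := mdist_ge0 x y; rewrite leNgt (lt_le_trans xy).
Qed.

Lemma doubling_growth (x0 : X) : exists A K : R, 1 <= K /\
  forall k, (mu (ball x0 (4 ^+ k)) <= (A * K ^+ k)%:E)%E.
Proof.
(* One step from radius [4 ^ k] to [4 ^ k.+1] costs two doublings; [|C| + 1] guarantees a factor of
   at least [1]. *)
have [C Cd] := doubl; pose K := (`|C| + 1) ^+ 2.
have C1 : 1 <= `|C| + 1 by rewrite lerDr.
have C0 : 0 <= `|C| + 1 by rewrite (le_trans ler01).
have Cd' x r : 0 < r -> (mu (ball x (2 * r)) <= (`|C| + 1)%:E * mu (ball x r))%E.
  move=> r0; apply: (le_trans (Cd x r r0)); rewrite lee_wpmul2r ?outer_measure_ge0//.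
  by rewrite lee_fin (le_trans (ler_norm C))// lerDl.
exists (fine (mu (ball x0 1))), K; split; first by rewrite expr_ge1.
elim=> [|k ih].
  by rewrite !expr0 mulr1 fineK// ge0_fin_numE ?mu_ball_fin ?outer_measure_ge0.
have p4 : 0 < 4 ^+ k :> R by rewrite exprn_gt0.
have -> : 4 ^+ k.+1 = 2 * (2 * 4 ^+ k) :> R by rewrite exprS; ring.
apply: (le_trans (Cd' _ _ _)); first by rewrite mulr_gt0.
apply: (@le_trans _ _ ((`|C| + 1)%:E * ((`|C| + 1)%:E * mu (ball x0 (4 ^+ k))))%E).
  by rewrite lee_wpmul2l ?lee_fin// Cd'.
apply: (@le_trans _ _ ((`|C| + 1)%:E * ((`|C| + 1)%:E * (fine (mu (ball x0 1)) * K ^+ k)%:E))%E).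
  by rewrite !lee_wpmul2l ?lee_fin.
by rewrite -!EFinM lee_fin exprS /K; set c := `|C| + 1;
  rewrite le_eqVlt; apply/orP; left; apply/eqP; ring.
Qed.

(* For [s < p], testing the embedding on cutoffs shows that the volume of
   [Omega `&` B(x, 4^k)] grows doubly exponentially once it is large. *)
Lemma bounded_embedding_finite_measure (s : R) : 1 < s -> s < p ->
  bounded_embedding mu p s Omega -> (mu Omega < +oo)%E.
Proof.
move=> s1 sp [C0 emb]; have s0 : 0 < s := lt_trans ltr01 s1.
pose x0 : X := point; pose F k := Omega `&` ball x0 (4 ^+ k).
have mF k : measurable (F k : set cX).
  by apply: measurableI => //; exact/(measurable_open mmu)/open_mball.
have Ffin k : mu (F k) \is a fin_num.
  rewrite ge0_fin_numE ?outer_measure_ge0//.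
  apply: le_lt_trans (mu_ball_fin x0 (4 ^+ k)).
  by apply: le_outer_measure; exact: subIsetr.
pose v k := fine (mu (F k)).
have vE k : (v k)%:E = mu (F k) by rewrite /v fineK.
have v0 k : 0 <= v k by rewrite fine_ge0// outer_measure_ge0.
have [A [K [K1 growth]]] := doubling_growth x0.
have vA k : v k <= A * K ^+ k.
  rewrite -lee_fin vE; apply: le_trans (growth k).
  by apply: le_outer_measure; exact: subIsetr.
pose C := `|C0|.
(* For the cutoff [f] of radius [4 ^ k], the [L^s] norm is at least [v k ^ (1 / s)], and each part
   of the Newtonian norm is at most [2 * v k.+1 ^ (1 / p)]. The embedding compares them, and since
   [s < p] the exponent [p / s] exceeds [1]. *)
have vC k : v k `^ (p / s) <= (C * 4) `^ p * v k.+1.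
  have p4 : 1 <= 4 ^+ k :> R by rewrite exprn_ege1// ler1n.
  have p40 : 0 < 4 ^+ k :> R := lt_le_trans ltr01 p4.
  pose f := cutoff x0 (4 ^+ k); pose g := cutoff_grad x0 (4 ^+ k).
  have gw : weak_upper_gradient mu p Omega f g by exact: cutoff_upper_gradient.
  have gE : energy mu p Omega g = ((2 `^ p) * v k.+1)%:E.
    by rewrite EFinM vE /F exprS energy_cutoff_grad.
  have gL : Lp_weak_upper_gradient mu p Omega f g.
    by apply/(Lp_weak_upper_gradientP mmu p0 oO); split => //; rewrite gE ltry.
  have mf : measurable_fun (T := cX) Omega f.
    exact: (lipschitz_measurable mmu (cutoff_lipschitz x0 p40)).
  have fE : (energy mu p Omega (fun x => `|f x|%:E) <= ((2 `^ p) * v k.+1)%:E)%E.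
    rewrite -gE; apply: ge0_le_integral => //.
    - by move=> x _; exact: poweR_ge0.
    - exact: measurable_energy_EFin.
    - exact: (measurable_energy mmu p oO (cutoff_grad_borel _ _)).
    - move=> x _; apply: le_poweR; rewrite ?(ltW p0)//.
      rewrite /g /cutoff_grad lee_fin ger0_norm ?cutoff_ge0// indicE.
      case: (boolP (x \in _)) => [_|]; first by rewrite mulr1 cutoff_le2.
      rewrite notin_setE ballEmdist/= => /negP; rewrite -leNgt => h.
      by rewrite mulr0 /f cutoff_out//; lra.
  have fN : newtonian mu p Omega f.
    split; last by exists g.
    by apply/(in_Lp_energy mmu oO f p0); split => //; apply: (le_lt_trans fE); exact: ltry.
  have [_ fs] := emb f fN.
  have c0 : 0 <= 2 `^ p * v k.+1 by rewrite mulr_ge0// powR_ge0.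
  have nE : ((2 `^ p * v k.+1) `^ p^-1 = 2 * v k.+1 `^ p^-1)%R.
    by rewrite powRM ?powR_ge0// -powRrM divff ?gt_eqF// powRr1.
  have normE : (newtonian_norm mu p Omega f <= (4 * v k.+1 `^ p^-1)%:E)%E.
    have -> : (4 * v k.+1 `^ p^-1 = 2 * v k.+1 `^ p^-1 + 2 * v k.+1 `^ p^-1)%R by ring.
    rewrite -nE EFinD; apply: leeD.
      rewrite Lp_normr_energy// -poweR_EFin; apply: le_poweR => //.
        by rewrite invr_ge0 ltW.
      exact: energy_ge0.
    have [nL _] := nabla_minP mmu p0 oO fN.2.
    rewrite (Lp_norm_nonneg mmu p0 oO nL.1.1) -poweR_EFin; apply: le_poweR.
    - by rewrite invr_ge0 ltW.
    - exact: energy_ge0.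
    - by rewrite -gE; exact: nabla_min_le.
  have lower : ((v k)%:E <= energy mu s Omega (fun x => `|f x|%:E))%E.
    rewrite vE; apply: (@le_trans _ _ (\int[cmeas mu]_(x in Omega) (\1_(ball x0 (4 ^+ k)) x)%:E)%E).
      rewrite integral_indic//; first by rewrite setIC.
      exact/(measurable_open mmu)/open_mball.
    apply: ge0_le_integral => //.
    - by apply/measurable_EFinP; apply: measurable_indic; exact/(measurable_open mmu)/open_mball.
    - exact: measurable_energy_EFin.
    - move=> x _; rewrite poweR_EFin lee_fin indicE.
      case: (boolP (x \in _)) => [|_]; last exact: powR_ge0.
      rewrite inE ballEmdist/= => h.
      have f1 : 1 <= `|f x|.
        rewrite ger0_norm ?cutoff_ge0// /f /cutoff le_max; apply/orP; right.
        have : mdist x0 x / 4 ^+ k <= 1 by rewrite ler_pdivrMr// mul1r ltW.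
        lra.
      have -> : 1 = 1 `^ s :> R by rewrite powR1.
      by apply: le_powR; rewrite ?(ltW s0).
  have vs : v k `^ s^-1 <= C * 4 * v k.+1 `^ p^-1.
    rewrite -lee_fin -poweR_EFin.
    apply: (@le_trans _ _ (Lp_normr mu s Omega f)).
      by rewrite Lp_normr_energy//; apply: le_poweR; rewrite ?invr_ge0 ?(ltW s0) ?lee_fin.
    apply: (le_trans fs); apply: (@le_trans _ _ (C%:E * newtonian_norm mu p Omega f)%E).
      rewrite lee_wpmul2r ?lee_fin ?ler_norm// adde_ge0//; exact: Lnorm_ge0.
    by rewrite -mulrA EFinM lee_wpmul2l ?lee_fin ?normr_ge0.
  have := le_powR (ltW p0) (powR_ge0 _ _) vs.
  rewrite -powRrM mulrC => /le_trans; apply.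
  rewrite powRM ?mulr_ge0 ?powR_ge0 ?normr_ge0//.
  by rewrite -powRrM mulVf ?gt_eqF// powRr1.
have ps : 1 < p / s by rewrite ltr_pdivlMr// mul1r.
have [M vM] := superlinear_growth_bounded ps K1 (powR_ge0 _ _) v0 vA vC.
have UF : \bigcup_k F k = Omega.
  apply/seteqP; split => [x [k _ []]//|x Ox].
  exists (Num.Def.truncn (mdist x0 x)).+1 => //; split => //; rewrite ballEmdist/=.
  apply: lt_trans (truncnS_gt _) _.
  by rewrite -natrX ltr_nat ltn_expl.
have cv := @nondecreasing_cvg_mu _ _ _ (cmeas mu) F mF.
rewrite UF in cv; have {}cv := cv mO; apply: (@le_lt_trans _ _ M%:E); last exact: ltry.
have cv' : mu (F k) @[k --> \oo] --> mu Omega.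
  apply: cv => n m nm; apply/subsetPset => x [Ox]; rewrite !ballEmdist/= => h.
  by split => //; rewrite ballEmdist/= (lt_le_trans h)// ler_weXn2l// ler1n.
rewrite -(cvg_lim _ cv')//; apply: lime_le.
  by apply/cvg_ex; eexists; exact: cv'.
by apply: nearW => k; rewrite -vE lee_fin.
Qed.

End FiniteMeasure.

(** * Null sets of a doubling space are recognized locally *)

Section LocallyNegligible.
Context {R : realType} {X : pmetricType R}.
Variable mu : {outer_measure set X -> \bar R}.
Hypotheses (mmu : metric_measure mu) (doubl : doubling mu).
Local Notation cX := (caratheodory_type mu).
Implicit Types (x y z : X) (r : R) (s : seq X).

Lemma doubling_iter : exists2 C : R, 0 < C & forall k x r, 0 < r ->
  (mu (ball x (2 ^+ k * r)) <= (C ^+ k)%:E * mu (ball x r))%E.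
Proof.
have [C Cd] := doubl; exists (`|C| + 1); first by rewrite ltr_wpDl.
elim=> [|k ih] x r r0; first by rewrite !expr0 mul1r mul1e.
have -> : 2 ^+ k.+1 * r = 2 * (2 ^+ k * r) by rewrite exprS mulrA.
have kr0 : 0 < 2 ^+ k * r by rewrite mulr_gt0// exprn_gt0.
apply: (le_trans (Cd x _ kr0)).
rewrite exprS EFinM -muleA; apply: (@le_trans _ _ ((`|C| + 1)%:E * mu (ball x (2 ^+ k * r)))%E).
  rewrite lee_wpmul2r ?outer_measure_ge0// lee_fin (le_trans (ler_norm C))// lerDl//.
by rewrite lee_wpmul2l ?ih// lee_fin.
Qed.

Let separated r s := pairwise (fun x y => `[< r <= mdist x y >]) s.
Let union_balls r s : set X := [set z | exists2 y, y \in s & ball y r z].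

Let open_union_balls r s : open (union_balls r s).
Proof.
have -> : union_balls r s = \bigcup_(y in [set` s]) ball y r.
  by apply/seteqP; split=> z [y ys yz]; exists y.
by apply: bigcup_open => y _; exact: open_mball.
Qed.

Let union_balls_cons r x s : union_balls r (x :: s) = ball x r `|` union_balls r s.
Proof.
apply/seteqP; split=> z.
  by case=> y; rewrite inE => /predU1P[->|ys] yz; [left|right; exists y].
by case=> [xz|[y ys yz]]; [exists x|exists y]; rewrite ?mem_head// inE ys orbT.
Qed.

Let separated_measure (d : R) r s : separated (2 * r) s ->
  (forall y, y \in s -> (d%:E <= mu (ball y r))%E) ->
  (((size s)%:R * d)%:E <= mu (union_balls r s))%E.
Proof.
elim: s => [|x s ih] /=; first by rewrite mul0r outer_measure_ge0.
move=> /andP[/allP xs ss] dP; rewrite union_balls_cons.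
have -> : mu (ball x r `|` union_balls r s) = (mu (ball x r) + mu (union_balls r s))%E.
  apply: (@measureU _ _ _ (cmeas mu)).
  - exact/(measurable_open mmu)/open_mball.
  - exact/(measurable_open mmu)/open_union_balls.
  - apply/seteqP; split=> // z [] + [y ys]; rewrite !ballEmdist/= => xz yz.
    have /asboolP := xs y ys; have := metric_triangle x z y.
    by rewrite (metric_sym z y) in yz *; lra.
rewrite -natr1 mulrDl mul1r addrC EFinD; apply: leeD; first by apply: dP; rewrite mem_head.
by apply: ih => // y ys; apply: dP; rewrite inE ys orbT.
Qed.

(** Volume counting: balls of radius [r / 2] around separated points are disjoint, lie in
    [ball x0 (rho + r)], and by doubling each carries a fixed fraction of the measure of
    [ball x0 rho]. *)
Let separated_size x0 (rho r : R) : 0 < r -> exists M : nat, forall s,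
  separated r s -> (forall y, y \in s -> ball x0 rho y) -> (size s <= M)%N.
Proof.
move=> r0; have [rho0|rho0] := ltP 0 rho; last first.
  exists 0%N => -[//|y s] _ /(_ y (mem_head _ _)); rewrite ballEmdist/= => h.
  by have := mdist_ge0 x0 y; rewrite leNgt (lt_le_trans h).
have [C C0 CP] := doubling_iter.
have r20 : 0 < r / 2 by rewrite divr_gt0.
(* After [k] doublings the ball of radius [r / 2] around any point of [ball x0 rho] contains
   [ball x0 rho]. *)
pose k := (Num.Def.truncn (2 * rho / (r / 2))).+1.
have krho : 2 * rho <= 2 ^+ k * (r / 2).
  rewrite -ler_pdivrMr// (le_trans (ltW (truncnS_gt _)))// -natrX ler_nat ltnW// ltn_expl//.
have fin y r' : mu (ball y r') \is a fin_num.
  by rewrite ge0_fin_numE ?outer_measure_ge0// mu_ball_fin.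
pose m := fine (mu (ball x0 rho)); have mE : m%:E = mu (ball x0 rho) by rewrite /m fineK.
have m0 : 0 < m by rewrite -lte_fin mE; have /andP[] := mmu.2 x0 rho rho0.
pose V := fine (mu (ball x0 (rho + r))).
have VE : V%:E = mu (ball x0 (rho + r)) by rewrite /V fineK.
have d0 : 0 < m / C ^+ k by rewrite divr_gt0// exprn_gt0.
exists (Num.Def.truncn (V / (m / C ^+ k))) => s ss sx0.
have lower y : y \in s -> ((m / C ^+ k)%:E <= mu (ball y (r / 2)))%E.
  move=> /sx0; rewrite ballEmdist/= => x0y.
  rewrite -(fineK (fin y (r / 2))) lee_fin ler_pdivrMr ?exprn_gt0//.
  rewrite mulrC -lee_fin EFinM (fineK (fin y _)) mE.
  apply: le_trans (CP k y (r / 2) r20); apply: le_outer_measure => z.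
  rewrite !ballEmdist/= => x0z; apply: lt_le_trans krho.
  by have := metric_triangle y x0 z; rewrite (metric_sym y x0); lra.
have := separated_measure (r := r / 2); rewrite (_ : 2 * (r / 2) = r)//; last by field.
move=> /(_ _ _ ss lower) h.
have {h} : ((size s)%:R * (m / C ^+ k) <= V)%R.
  rewrite -lee_fin VE; apply: (le_trans h); apply: le_outer_measure => z [y /sx0].
  rewrite !ballEmdist/= => x0y yz; have := metric_triangle x0 y z; lra.
by rewrite -ler_pdivlMr// => h; rewrite truncn_ge_nat// (le_trans _ h).
Qed.

(** A maximal separated subset of [N] is finite, and by maximality the balls of radius [r] around
    its points cover [N]. *)
Let locally_negligible_bounded (N : set X) x0 (rho r : R) : 0 < r ->
  N `<=` ball x0 rho -> (forall x, N x -> (cmeas mu).-negligible (N `&` ball x r)) ->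
  (cmeas mu).-negligible N.
Proof.
move=> r0 Nrho Nnull; have [M MP] := separated_size x0 rho r0.
pose P n := `[< exists s, [/\ separated r s, (forall y, y \in s -> N y) & size s = n] >].
have exP : exists n, P n by exists 0%N; apply/asboolP; exists [::].
have ubP n : P n -> (n <= M)%N.
  by move=> /asboolP[s [ss sN <-]]; apply: MP => // y /sN; exact: Nrho.
have [n /asboolP[s [ss sN sn]] nmax] := ex_maxnP exP ubP.
have cover : N `<=` [set z | exists2 y, y \in s & (N `&` ball y r) z].
  move=> z Nz; apply: contrapT => h.
  have : P n.+1.
    apply/asboolP; exists (z :: s); split; rewrite /= ?sn//.
    - rewrite /separated /= [X in _ && X]ss andbT; apply/allP => y ys; apply/asboolP.
      rewrite leNgt; apply/negP => zy; apply: h; exists y => //; split => //.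
      by rewrite ballEmdist/= metric_sym.
    - by move=> y; rewrite inE => /predU1P[->//|]; exact: sN.
  by move=> /nmax; rewrite ltnn.
apply: (@negligibleS _ cX _ (cmeas mu) _ _ cover).
elim: s sN {ss sn cover} => [|x s ih] sN.
  by apply: negligibleS (negligible_set0 _) => z [].
apply: (@negligibleS _ cX _ (cmeas mu) ((N `&` ball x r) `|`
    [set z | exists2 y, y \in s & (N `&` ball y r) z])).
  move=> z [y]; rewrite inE => /predU1P[->|ys] yz; first by left.
  by right; exists y.
apply: negligibleU; first by apply: Nnull; apply: sN; rewrite mem_head.
by apply: ih => y ys; apply: sN; rewrite inE ys orbT.
Qed.

(** Plays the part of the Lindelof property. [F n] collects the points of [N] in a ball of radius
    [n] for which the radius [1 / (n + 1)] works, so that the bounded case with uniform radius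
    applies. *)
Lemma locally_negligible (N : set X) :
  (forall x, N x -> exists2 r : R, 0 < r & (cmeas mu).-negligible (N `&` ball x r)) ->
  (cmeas mu).-negligible N.
Proof.
move=> Nloc; pose x0 : X := point.
pose F n : set X := [set x | [/\ N x, ball x0 n%:R x &
  (cmeas mu).-negligible (N `&` ball x n.+1%:R^-1)]].
apply: (@negligibleS _ cX _ (cmeas mu) (\bigcup_n F n)).
  move=> x Nx; have [r r0 rP] := Nloc x Nx.
  pose n := (maxn (Num.Def.truncn r^-1) (Num.Def.truncn (mdist x0 x)).+1).
  exists n => //; split=> //.
    rewrite ballEmdist/=; apply: lt_le_trans (truncnS_gt _) _.
    by rewrite ler_nat leq_maxr.
  apply: negligibleS rP; apply: setIS => z; rewrite !ballEmdist/= => /lt_le_trans; apply.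
  rewrite -[leRHS]invrK lef_pV2 ?posrE ?invr_gt0//.
  by apply: le_trans (ltW (truncnS_gt _)) _; rewrite ler_nat ltnS leq_maxl.
apply: negligible_bigcup => n.
apply: (@locally_negligible_bounded _ x0 n%:R n.+1%:R^-1) => //.
- by move=> x [].
- by move=> x [Nx _ h]; apply: negligibleS h; apply: setSI => z [].
Qed.

End LocallyNegligible.

(** * Functions with vanishing gradient are constant *)

Lemma powR_le1D {R : realType} (a b t : R) : 0 <= a -> a <= b -> 0 <= t ->
  t `^ a <= 1 + t `^ b.
Proof.
move=> a0 ab t0; have [t1|t1] := leP t 1.
  apply: (@le_trans _ _ (1 `^ a)); first exact: le_powR.
  by rewrite powR1 lerDl powR_ge0.
by apply: le_trans (_ : t `^ b <= _); rewrite ?lerDr//; apply: ler_powR => //; exact: ltW.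
Qed.

Section ZeroGradient.
Context {R : realType} {X : pmetricType R}.
Variable mu : {outer_measure set X -> \bar R}.
Hypotheses (mmu : metric_measure mu) (doubl : doubling mu).
Variable p : R.
Hypotheses (p1 : 1 < p) (poincare : weak_poincare mu p).
Local Notation cX := (caratheodory_type mu).
Let p0 : 0 < p. Proof. exact: lt_trans p1. Qed.

Let mball (x : X) (r : R) : measurable (ball x r : set cX).
Proof. exact/(measurable_open mmu)/open_mball. Qed.

Lemma finite_measure_cst_integrable (D : set X) (c : R) :
  measurable (D : set cX) -> (mu D < +oo)%E -> (cmeas mu).-integrable D (cst c%:E).
Proof.
move=> mD Dfin; apply/integrableP; split; first exact: measurable_cst.
by rewrite /= integral_cst//= lte_mul_pinfty.
Qed.

Lemma integrable_powR_norm (s : R) (D : set X) f : 0 < s -> open D ->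
  in_Lp mu s D f -> (cmeas mu).-integrable D (fun x => (`|f x| `^ s)%:E).
Proof.
move=> s0 oD /(in_Lp_energy mmu oD f s0)[mf fE]; apply/integrableP; split.
  exact: measurable_energy_EFin.
apply: le_lt_trans fE; rewrite energy_EFin le_eqVlt; apply/orP; left; apply/eqP.
by apply: eq_integral => x _; rewrite /= ger0_norm// powR_ge0.
Qed.

Lemma in_Lp_dominated_integrable (s : R) (D : set X) f (h : X -> R) : 0 < s -> open D ->
  (mu D < +oo)%E -> in_Lp mu s D f -> measurable_fun (T := cX) D h ->
  (forall x, `|h x| <= 1 + `|f x| `^ s) -> (cmeas mu).-integrable D (EFin \o h).
Proof.
move=> s0 oD Dfin fL mh hf; have mD := measurable_open mmu oD.
have int1 := finite_measure_cst_integrable 1 mD Dfin.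
apply: le_integrable (integrableD _ int1 (integrable_powR_norm s0 oD fL)) => //.
  exact/measurable_EFinP.
move=> x _ /=; rewrite lee_fin (le_trans (hf x))// ler_norm//.
Qed.

Lemma in_Lp_integrable (s : R) (D : set X) f : 1 <= s -> open D -> (mu D < +oo)%E ->
  in_Lp mu s D f -> (cmeas mu).-integrable D (EFin \o f).
Proof.
move=> s1 oD Dfin fL; have s0 : 0 < s := lt_le_trans ltr01 s1.
apply: (in_Lp_dominated_integrable s0 oD Dfin fL fL.1) => x.
by rewrite -[leLHS]powRr1//; apply: powR_le1D.
Qed.

Lemma weak_upper_gradientS (D D' : set X) f g : open D -> open D' -> D' `<=` D ->
  weak_upper_gradient mu p D f g -> weak_upper_gradient mu p D' f g.
Proof.
move=> oD oD' D'D [[gb g0] fg]; have mD := measurable_open mmu oD.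
have nbS h : nonneg_borel D h -> nonneg_borel D' h.
  move=> [hb h0]; split; last by move=> x /D'D; exact: h0.
  by apply: measurable_funS hb => //; exact: sub_sigma_algebra.
split; first exact: nbS.
have [rho [rb rfin rP]] := (ae_curveP mmu p0 oD _).1 fg.
apply/(ae_curveP mmu p0 oD'); exists rho; split; first exact: nbS.
  apply: le_lt_trans rfin; apply: ge0_subset_integral => //.
  - exact: (measurable_open mmu).
  - exact: (measurable_energy mmu p oD rb).
  - by move=> x _; exact: poweR_ge0.
by move=> gamma [len gD]; apply: rP; split => // t /gD; exact: D'D.
Qed.

Lemma zero_gradient_ball : exists2 sigma : R, 1 < sigma & forall x r f g, 0 < r ->
  (cmeas mu).-integrable (ball x (sigma * r)) (EFin \o f) ->
  weak_upper_gradient mu p (ball x (sigma * r)) f g ->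
  energy mu p (ball x (sigma * r)) g = 0%E ->
  exists c, {ae cmeas mu, forall y, ball x r y -> f y = c}.
Proof.
have [sigma [Cp [s1 _ P]]] := poincare; exists sigma => // x r f g r0 fint fg g0.
exists (mean mu (ball x r) f); set m := mean _ _ _.
have := P x r r0 f g fint fg.
rewrite -/(energy mu p _ g) g0 mule0 poweR0r ?invr_eq0 ?gt_eqF// mule0 -/m.
have /andP[B0 Bfin] := mmu.2 x r r0.
have sub : ball x r `<=` ball x (sigma * r).
  by move=> y; rewrite !ballEmdist/= => /lt_le_trans; apply; rewrite ler_peMl// ltW.
have mf : measurable_fun (T := cX) (ball x r) f.
  apply: (@measurable_funS _ _ cX _ (ball x (sigma * r))) => //.
  by apply/measurable_EFinP; case/integrableP: fint.
move=> le0.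
(* The average is at most [0], and [(mu (ball x r))^-1] is positive because the ball has finite
   measure; hence the integral vanishes. *)
have i0 : (\int[cmeas mu]_(y in ball x r) `|(f y - m)%:E| = 0)%E.
  apply/eqP; rewrite eq_le integral_ge0// andbT leNgt; apply/negP => h.
  move: le0; rewrite leNgt => /negP; apply; apply: mule_gt0 => //.
  by rewrite inve_gt0 ?(gt_eqF B0) ?(lt_eqF Bfin).
have mfm : measurable_fun (T := cX) (ball x r) (fun y => (f y - m)%:E).
  by apply/measurable_EFinP; exact: measurable_funB.
apply: (ae_imply ((ae_eq_integral_abs _ (mball x r) mfm).1 i0)) => y yP yB.
by have [] := yP yB => /eqP; rewrite subr_eq0 => /eqP.
Qed.

(** The two balls share a ball around [y], which has positive measure. *)
Let ae_const_ball_eq (f : X -> R) (c c' : R) x r y r' : ball x r y -> 0 < r' ->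
  {ae cmeas mu, forall z, ball x r z -> f z = c} ->
  {ae cmeas mu, forall z, ball y r' z -> f z = c'} -> c = c'.
Proof.
rewrite ballEmdist/= => xy r'0 fc fc'; apply: contrapT => cc'.
pose r2 := Num.min r' (r - mdist x y).
have r20 : 0 < r2 by rewrite lt_min r'0 subr_gt0.
have N : (cmeas mu).-negligible (ball y r2).
  apply: negligibleS (negligibleU fc fc') => z; rewrite ballEmdist/= => yz.
  apply: contrapT => /not_orP[/contrapT h1 /contrapT h2]; apply: cc'.
  rewrite -h1 ?h2// ?ballEmdist/= ?(lt_le_trans yz) ?ge_min ?lexx//.
  rewrite (le_lt_trans (metric_triangle x y z))// -ltrBrDl (lt_le_trans yz)//.
  by rewrite ge_min lexx orbT.
have /andP[+ _] := mmu.2 y r2 r20.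
by rewrite -[mu _]/(cmeas mu _) (negligibleP _ _).1 ?ltxx.
Qed.

Lemma zero_gradient_const (Omega : set X) f : domain Omega -> (mu Omega < +oo)%E ->
  newtonian mu p Omega f -> energy mu p Omega (nabla_min mu p Omega f) = 0%E ->
  exists c, {ae cmeas mu, forall x, Omega x -> f x = c}.
Proof.
move=> [[x0 Ox0] oO cO] Ofin [fL fg] E0.
have [[fw _] _] := nabla_minP mmu p0 oO fg.
have [sigma s1 sP] := zero_gradient_ball.
have s0 : 0 < sigma := lt_trans ltr01 s1.
have mO := measurable_open mmu oO.
have loc x : Omega x -> exists c r, 0 < r /\ {ae cmeas mu, forall z, ball x r z -> f z = c}.
  move=> Ox; move: (oO); rewrite openE => /(_ x Ox)/nbhs_ballP[r /= r0 rO].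
  (* The ball enlarged by [sigma] still has to fit into [Omega]. *)
  pose r' := r / sigma; have r'0 : 0 < r' by rewrite divr_gt0.
  have sE : sigma * r' = r by rewrite mulrC divfK// gt_eqF.
  have [|||c cP] := sP x r' f (nabla_min mu p Omega f) r'0; rewrite ?sE.
  - apply: integrableS (in_Lp_integrable (ltW p1) oO Ofin fL) => //.
  - apply: weak_upper_gradientS fw => //; exact: open_mball.
  - apply/eqP; rewrite eq_le energy_ge0 andbT -E0; apply: ge0_subset_integral => //.
    + exact: (measurable_energy mmu p oO fw.1).
    + by move=> x1 _; exact: poweR_ge0.
  - by exists c, r'.
have [c [r [r0 fc]]] := loc x0 Ox0; exists c.
(* The points near which [f] has a constant value satisfying [P] form an open set. With [P] being
   equality to [c] and its negation, the set with value [c] is both open and closed in [Omega]. *)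
pose A (P : R -> Prop) := [set x | Omega x /\ exists c' r', [/\ P c', 0 < r' &
  {ae cmeas mu, forall z, ball x r' z -> f z = c'}]].
have oA P : open (A P).
  rewrite openE => x [Ox [c' [r' [Pc' r'0 h]]]].
  move: (oO); rewrite openE => /(_ x Ox)/nbhs_ballP[r1 /= r10 r1O].
  apply/nbhs_ballP; exists (Num.min r' r1) => /=; first by rewrite lt_min r'0.
  move=> y; rewrite ballEmdist/= lt_min => /andP[xy xy1]; split.
    by apply: r1O; rewrite ballEmdist.
  exists c', (r' - mdist x y); split; rewrite ?subr_gt0//.
  apply: (ae_imply h) => z hz; rewrite ballEmdist/= => yz; apply: hz.
  by rewrite ballEmdist/= (le_lt_trans (metric_triangle x y z))// -ltrBrDl.
have AO : A (eq c) = Omega.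
  apply: cO.
  - by exists x0; split => //; exists c, r.
  - exists (A (eq c)) => //; apply/seteqP; split=> x; first by move=> Ax; split => //; case: Ax.
    by case.
  - exists (~` A (fun c' => c <> c')); first exact: open_closedC.
    apply/seteqP; split=> x.
      case=> Ox [_ [r' [<- r'0 h]]]; split => // -[_ [c1 [r1 [cc1 r10 h1]]]]; apply: cc1.
      apply: (ae_const_ball_eq _ r10 h h1); rewrite ballEmdist/= mdistxx//.
    move=> [Ox nA]; split => //; have [c1 [r1 [r10 h1]]] := loc x Ox.
    exists c1, r1; split => //; apply: contrapT => cc1; apply: nA; split => //.
    by exists c1, r1.
rewrite -AO; apply: (locally_negligible mmu doubl) => x /= /not_implyP[[Ox [_ [r' [<- r'0 h]]]] _].
exists r' => //; apply: negligibleS h => z /= [+ zr]; apply: contra_not => h _.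
by apply: h.
Qed.

End ZeroGradient.

(** * Nontriviality of the admissible class *)

Lemma signed_powR_ge0 {R : realType} (q t : R) : 1 < q -> 0 <= t ->
  `|t| `^ (q - 2) * t = t `^ (q - 1).
Proof.
move=> q1; rewrite le_eqVlt => /predU1P[<-|t0].
  by rewrite mulr0 powR0// subr_eq0 gt_eqF.
rewrite gtr0_norm// -[X in _ * X]powRr1 ?ltW// -powRD; last by apply/implyP => _; rewrite gt_eqF.
by congr (_ `^ _); ring.
Qed.

Section TestFunctions.
Context {R : realType} {X : pmetricType R}.
Variable mu : {outer_measure set X -> \bar R}.
Hypothesis mmu : metric_measure mu.
Local Notation cX := (caratheodory_type mu).

Lemma ae_ball_ex (P : X -> Prop) x (r : R) : {ae cmeas mu, forall z, P z} ->
  0 < r -> exists z, ball x r z /\ P z.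
Proof.
move=> aP r0; apply: contrapT => h; have /andP[+ _] := mmu.2 x r r0.
have N : (cmeas mu).-negligible (ball x r).
  by apply: negligibleS aP => z xz /= Pz; apply: h; exists z.
rewrite -[mu _]/(cmeas mu _) (negligibleP _ _).1 ?ltxx//.
exact/(measurable_open mmu)/open_mball.
Qed.

Lemma energy_EFin_eq0 (s : R) (D : set X) (f : X -> R) : 0 < s -> open D ->
  measurable_fun (T := cX) D f -> energy mu s D (fun x => `|f x|%:E) = 0%E ->
  {ae cmeas mu, forall x, D x -> f x = 0}.
Proof.
move=> s0 oD mf; rewrite energy_EFin => f0; have mD := measurable_open mmu oD.
have mfs := measurable_energy_EFin (mu := mu) s mf.
have i0 : (\int[cmeas mu]_(x in D) `|(`|f x| `^ s)%:E| = 0)%E.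
  by rewrite -[RHS]f0; apply: eq_integral => x _; rewrite /= ger0_norm// powR_ge0.
apply: (ae_imply ((ae_eq_integral_abs _ mD mfs).1 i0)) => x h Dx.
by have [] := h Dx => /powR_eq0_eq0/normr0_eq0.
Qed.

(** In a one-point space [1] is a doubling constant, so the minimal one is at most [1] and its
    logarithm is not positive. *)
Lemma hom_dim_gt0_two_points : 0 < hom_dim mu -> forall a : X, exists b, b <> a.
Proof.
move=> + a; apply: contraPP => h.
have Xa (b : X) : b = a by apply: contrapT => ba; apply: h; exists b.
apply/negP; rewrite -leNgt /hom_dim pmulr_lle0 ?invr_gt0 ?ln_gt0 ?ltr1n//.
apply: ln_le0; apply: ge_inf.
  (* [ge_inf] asks for a lower bound: doubling constants are not negative because balls have
     positive measure. *)
  exists 0 => C /(_ a 1 ltr01) h0; rewrite leNgt; apply/negP => C0.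
  have /andP[m0 _] := mmu.2 a (2 * 1) (mulr_gt0 (ltr0n R 2) ltr01).
  move: (lt_le_trans m0 h0); rewrite ltNge => /negP; apply.
  by rewrite mule_le0_ge0// ?outer_measure_ge0// lee_fin ltW.
move=> x r r0; rewrite mul1e; apply: le_outer_measure => y _.
by rewrite (Xa y) (Xa x); exact: ballxx.
Qed.

(** A curve cannot leave an isolated point: the indicator is locally constant along it, and
    [interval_chain] makes it constant. *)
Lemma isolated_point_upper_gradient (p r : R) (a : X) D : 0 < p -> 0 < r -> open D ->
  (forall x, ball a r x -> x = a) ->
  weak_upper_gradient mu p D (\1_(ball a r)) (cst 0%E).
Proof.
move=> p0 r0 oD iso; split; first exact: nonneg_borel_cst.
apply/(ae_curveP mmu p0 oD); exists (cst 0%E); split.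
- exact: nonneg_borel_cst.
- rewrite energy_cst// ?powR0 ?gt_eqF// ?mul0e ?ltry//; exact: (measurable_open mmu).
move=> gamma gD _.
suff -> : \1_(ball a r) (gamma (cstart gamma)) = \1_(ball a r) (gamma (cend gamma)) :> R.
  rewrite subrr normr0; exact: (line_integral_ge0 (nonneg_borel_cst D (lexx 0)) gD).
apply: (interval_chain (P := fun s t => \1_(ball a r) (gamma s) = \1_(ball a r) (gamma t) :> R)).
- exact: curve_le.
- move=> x ax xb; have xab : x \in `[cstart gamma, cend gamma] by rewrite in_itv/= ax.
  have [e e0 eP] : exists2 e, 0 < e & forall z, mdist (gamma x) z < e ->
      \1_(ball a r) z = \1_(ball a r) (gamma x) :> R.
    have [xa|xa] := pselect (gamma x = a).
      exists r => // z; rewrite xa => az.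
      by rewrite (iso z) // ballEmdist.
    have ax0 : 0 < mdist (gamma x) a by rewrite mdist_gt0; exact/eqP.
    exists (mdist (gamma x) a) => // z xz; rewrite !indicE !memNset => [//|/iso//|].
    by move=> /iso za; move: xz; rewrite za ltxx.
  have [d d0 dP] := curve_continuousP (@curve_cont _ _ gamma) xab e0.
  exists d => // s t as_ st tb sx tx.
  have tab : t \in `[cstart gamma, cend gamma] by rewrite in_itv/= tb (le_trans as_).
  have sab : s \in `[cstart gamma, cend gamma] by rewrite in_itv/= as_ (le_trans st).
  by rewrite !eP//; apply: dP.
- by move=> s u t _ _ _ _ -> ->.
Qed.

(** If [Omega] were [{a}], then [a] would be isolated in [X] and its indicator would have zero
    gradient. On a large ball reaching another point [b], the Poincare inequality would make the
    indicator constant almost everywhere. *)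
Lemma open_two_points (p : R) (Omega : set X) a : 1 < p -> weak_poincare mu p ->
  0 < hom_dim mu -> open Omega -> Omega a -> exists2 b, Omega b & b <> a.
Proof.
move=> p1 poin dim0 oO Oa; have p0 : 0 < p := lt_trans ltr01 p1.
apply: contrapT => h; have Oa' x : Omega x -> x = a.
  by move=> Ox; apply: contrapT => xa; apply: h; exists x.
move: (oO); rewrite openE => /(_ a Oa)/nbhs_ballP[r /= r0 rO].
have iso x : ball a r x -> x = a by move=> /rO/Oa'.
have [b ba] := hom_dim_gt0_two_points dim0 a.
have ab0 : 0 < mdist a b by rewrite mdist_gt0 eq_sym; exact/eqP.
have [sigma s1 sP] := zero_gradient_ball mmu p1 poin.
pose rho := mdist a b + 1; have rho0 : 0 < rho by rewrite addr_gt0.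
have oB := open_mball a (sigma * rho).
have mB := measurable_open mmu oB.
have mr : measurable (ball a r : set cX) by exact/(measurable_open mmu)/open_mball.
have [||c cP] := sP a rho (\1_(ball a r)) (cst 0%E) rho0 _
    (isolated_point_upper_gradient p0 r0 oB iso).
- apply: (le_integrable mB _ _ (finite_measure_cst_integrable 1 mB (mu_ball_fin mmu _ _))).
  + by apply/measurable_EFinP; exact: (@measurable_indic _ cX).
  + by move=> x _ /=; rewrite lee_fin !ger0_norm// indicE; case: (_ \in _).
- by rewrite energy_cst// powR0 ?gt_eqF// mul0e.
have [z [az zc]] := ae_ball_ex a cP r0.
have /zc : ball a rho z by rewrite (iso z az) ballEmdist/= mdistxx.
rewrite indicE mem_set// => c1.
(* A ball of this radius around [b] misses [a] and lies in [ball a rho]. *)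
have m0 : 0 < Num.min (mdist a b) 1 by rewrite lt_min ab0 ltr01.
have [y [+ yc]] := ae_ball_ex b cP m0; rewrite ballEmdist/= lt_min => /andP[by1 by2].
have /yc : ball a rho y.
  rewrite ballEmdist/= /rho; have := metric_triangle a b y; lra.
rewrite indicE memNset -?c1; first by move/eqP; rewrite eq_sym oner_eq0.
by move=> /iso ya; move: by1; rewrite ya metric_sym ltxx.
Qed.

Lemma ge0_integral_gt0 (D : set X) (f : X -> R) x (r e : R) : measurable (D : set cX) ->
  measurable_fun (T := cX) D f -> (forall y, 0 <= f y) -> 0 < r -> 0 < e ->
  ball x r `<=` D -> (forall y, ball x r y -> e <= f y) ->
  (0 < \int[cmeas mu]_(y in D) (f y)%:E)%E.
Proof.
move=> mD mf f0 r0 e0 rD ef; have /andP[m0 _] := mmu.2 x r r0.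
have mB : measurable (ball x r : set cX) by exact/(measurable_open mmu)/open_mball.
have mfE : measurable_fun (T := cX) D (fun y => (f y)%:E) by exact/measurable_EFinP.
apply: (@lt_le_trans _ _ (\int[cmeas mu]_(y in ball x r) (f y)%:E)%E); last first.
  by apply: ge0_subset_integral => // y _; rewrite lee_fin.
apply: (@lt_le_trans _ _ (e%:E * mu (ball x r))%E); first by rewrite mule_gt0.
rewrite -[leLHS](integral_cst (cmeas mu) mB); apply: ge0_le_integral => //.
- by move=> y _; rewrite lee_fin ltW.
- exact: measurable_funS mfE.
Qed.

End TestFunctions.

Section Admissible.
Context {R : realType} {X : pmetricType R}.
Variable mu : {outer_measure set X -> \bar R}.
Hypothesis mmu : metric_measure mu.
Local Notation cX := (caratheodory_type mu).
Variables (p q : R) (Omega : set X).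
Hypotheses (p1 : 1 < p) (q1 : 1 < q) (oO : open Omega) (Ofin : (mu Omega < +oo)%E).
Let p0 : 0 < p. Proof. exact: lt_trans p1. Qed.
Let q0 : 0 < q. Proof. exact: lt_trans q1. Qed.
Let mO : measurable (Omega : set cX). Proof. exact: (measurable_open mmu). Qed.

Let bump (a : X) (r : R) (x : X) : R := Num.max 0 (r - mdist a x).

Let bump_lipschitz a r : lipschitz_fun 1 (bump a r).
Proof.
apply: lipschitz_fun_max0 => x y.
have -> : r - mdist a x - (r - mdist a y) = - (mdist a x - mdist a y) by ring.
by rewrite normrN; exact: lipschitz_fun_dist.
Qed.

Let bump_ge0 a r x : 0 <= bump a r x. Proof. by rewrite /bump le_max lexx. Qed.

Let bump_le a r x : 0 <= r -> bump a r x <= r.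
Proof. by move=> r0; rewrite /bump ge_max r0 gerBl mdist_ge0. Qed.

Let bump_out a r x : r <= mdist a x -> bump a r x = 0.
Proof. by move=> h; rewrite /bump max_l// subr_le0. Qed.

Let bump_powR_integrable a r (s : R) : 0 <= s -> 0 <= r ->
  (cmeas mu).-integrable Omega (fun x => (bump a r x `^ s)%:E).
Proof.
move=> s0 r0; apply: (le_integrable mO _ _ (finite_measure_cst_integrable (r `^ s) mO Ofin)).
  apply/measurable_EFinP; apply: (measurableT_comp (measurable_powR s)).
  exact: (lipschitz_measurable mmu (@bump_lipschitz a r)).
by move=> x _ /=; rewrite lee_fin !ger0_norm ?powR_ge0//; apply: le_powR => //; exact: bump_le.
Qed.

Let bump_powR_integral a r (s : R) : 0 <= s -> 0 < r -> Omega a ->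
  exists2 J, 0 < J & (\int[cmeas mu]_(x in Omega) (bump a r x `^ s)%:E)%E = J%:E.
Proof.
move=> s0 r0 Oa; have fin := integrable_fin_num mO (bump_powR_integrable a s0 (ltW r0)).
exists (fine (\int[cmeas mu]_(x in Omega) (bump a r x `^ s)%:E)%E); last by rewrite fineK.
rewrite -lte_fin fineK//.
move: (oO); rewrite openE => /(_ a Oa)/nbhs_ballP[e /= e0 eO].
have m0 : 0 < Num.min e (r / 2) by rewrite lt_min e0 divr_gt0.
apply: (@ge0_integral_gt0 _ _ _ mmu _ _ a (Num.min e (r / 2)) ((r / 2) `^ s)) => //.
- apply: (measurableT_comp (measurable_powR s)).
  exact: (lipschitz_measurable mmu (@bump_lipschitz a r)).
- by move=> y; exact: powR_ge0.
- by apply: powR_gt0; rewrite divr_gt0.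
- move=> y; rewrite ballEmdist/= lt_min => /andP[ye _]; apply: eO.
  by rewrite ballEmdist.
- move=> y; rewrite ballEmdist/= lt_min => /andP[_ yr]; apply: le_powR => //.
    by rewrite divr_ge0// ltW.
  by rewrite /bump le_max; apply/orP; right; lra.
Qed.

(** The competitor is a difference of two bumps with disjoint supports. On each bump the constraint
    is homogeneous of degree [q - 1], so the factor [c] can be chosen to balance the two
    integrals. *)
Lemma admissible_ex a b : Omega a -> Omega b -> a <> b ->
  exists w, admissible mu p q Omega w /\ energy mu q Omega (fun x => `|w x|%:E) <> 0%E.
Proof.
move=> Oa Ob ab; have ab0 : 0 < mdist a b by rewrite mdist_gt0; exact/eqP.
pose r := mdist a b / 2; have r0 : 0 < r by rewrite divr_gt0.
have q10 : 0 < q - 1 by rewrite subr_gt0.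
have [J1 J10 J1E] := bump_powR_integral (ltW q10) r0 Oa.
have [J2 J20 J2E] := bump_powR_integral (ltW q10) r0 Ob.
pose c := (J1 / J2) `^ (q - 1)^-1; have c0 : 0 <= c by exact: powR_ge0.
have cE : c `^ (q - 1) = J1 / J2.
  by rewrite -powRrM mulVf ?gt_eqF// powRr1// divr_ge0// ltW.
pose w x := bump a r x - c * bump b r x.
have disj x : bump a r x = 0 \/ bump b r x = 0.
  have [h|h] := leP r (mdist a x); first by left; exact: bump_out.
  right; apply: bump_out; rewrite leNgt; apply/negP => h'.
  have := metric_triangle a x b; rewrite (metric_sym x b).
  by move: h h'; rewrite /r; lra.
have wE x : `|w x| `^ (q - 2) * w x =
    bump a r x `^ (q - 1) - c `^ (q - 1) * bump b r x `^ (q - 1).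
  rewrite /w; have [->|->] := disj x; last first.
    by rewrite powR0 ?gt_eqF// !mulr0 !subr0 signed_powR_ge0.
  rewrite !sub0r powR0 ?gt_eqF// sub0r normrN mulrN signed_powR_ge0 ?mulr_ge0//.
  by rewrite powRM.
have wL : lipschitz_fun (1 + c) w.
  move=> x y; rewrite /w.
  have -> : bump a r x - c * bump b r x - (bump a r y - c * bump b r y) =
    (bump a r x - bump a r y) - c * (bump b r x - bump b r y) by ring.
  apply: (le_trans (ler_normB _ _)); rewrite mulrDl; apply: lerD; first exact: bump_lipschitz.
  rewrite normrM ger0_norm// ler_wpM2l//.
  by have := @bump_lipschitz b r x y; rewrite mul1r.
have mw : measurable_fun (T := cX) Omega w := lipschitz_measurable mmu wL.
have wM x : `|w x| <= r + c * r.
  rewrite /w; apply: (le_trans (ler_normB _ _)); rewrite normrM (ger0_norm c0).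
  rewrite (ger0_norm (bump_ge0 _ _ _)) (ger0_norm (bump_ge0 _ _ _)).
  by apply: lerD; rewrite ?ler_wpM2l//; apply: bump_le; exact: ltW.
have wN : newtonian mu p Omega w.
  by apply: (lipschitz_newtonian mmu p0 oO _ wL wM) => //; rewrite addr_ge0.
have wn0 (s : R) : 0 < s -> energy mu s Omega (fun x => `|w x|%:E) <> 0%E.
  move=> s0 /(energy_EFin_eq0 mmu s0 oO mw) w0.
  move: (oO); rewrite openE => /(_ a Oa)/nbhs_ballP[e /= e0 eO].
  have m0 : 0 < Num.min e r by rewrite lt_min e0.
  have [z [+ wz]] := ae_ball_ex mmu a w0 m0; rewrite ballEmdist/= lt_min => /andP[ze zr].
  have {}wz : w z = 0 by apply: wz; apply: eO; rewrite ballEmdist.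
  have bz : 0 < bump a r z by rewrite /bump lt_max; apply/orP; right; rewrite subr_gt0.
  have [bz0|bz0] := disj z; first by rewrite bz0 ltxx in bz.
  by move: wz; rewrite /w bz0 mulr0 subr0 => wz; rewrite wz ltxx in bz.
exists w; split; last exact: wn0.
split => //.
- move=> n0; apply: (wn0 p p0); rewrite -Lp_normr_poweR//.
  have -> : Lp_normr mu p Omega w = 0%E.
    apply/eqP; rewrite eq_le Lnorm_ge0 andbT -n0; apply: leeDl.
    exact: Lnorm_ge0.
  by rewrite poweR0r// gt_eqF.
- under eq_integral do rewrite wE EFinB EFinM.
  have I1 := bump_powR_integrable a (ltW q10) (ltW r0).
  have I2 := bump_powR_integrable b (ltW q10) (ltW r0).
  rewrite integralB//; last exact: integrableZl.
  rewrite integralZl// J1E J2E -EFinM -EFinB cE divfK ?subrr// gt_eqF//.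
Qed.

End Admissible.

(** * Passage to the limit in norms and in the constraint *)

Lemma powR_cvg {R : realType} (u : nat -> R) (l a : R) : 0 < a ->
  (forall n, 0 <= u n) -> u n @[n --> \oo] --> l -> u n `^ a @[n --> \oo] --> l `^ a.
Proof.
move=> a0 u0 ul; have l0 : 0 <= l.
  by rewrite -(cvg_lim _ ul)//; apply: limr_ge; [apply/cvg_ex; exists l|exact: nearW].
move: l0; rewrite le_eqVlt => /predU1P[l0|l0].
  (* At [0] the power may fail to be differentiable, so this limit is treated directly, by taking
     roots. *)
  rewrite -l0 in ul *; rewrite powR0 ?gt_eqF//.
  apply/cvgr0Pnorm_lt => e e0; have ea0 : 0 < e `^ a^-1 by rewrite powR_gt0.
  move/cvgr0Pnorm_lt : ul => /(_ _ ea0); apply: filterS => n.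
  rewrite !ger0_norm ?powR_ge0// => h; rewrite ltNge; apply/negP => eu.
  move: h; rewrite ltNge => /negP; apply.
  have := le_powR (_ : 0 <= a^-1) (ltW e0) eu; rewrite invr_ge0 (ltW a0) => /(_ isT).
  by rewrite -powRrM divff ?gt_eqF// powRr1.
apply: (@continuous_cvg _ _ _ _ _ _ (fun x : R => x `^ a)) => //.
apply: differentiable_continuous; apply/derivable1_diffP.
by have [] := is_derive1_powR a l0.
Qed.

Lemma signed_powR_cvg {R : realType} (q : R) (u : nat -> R) (l : R) : 1 < q ->
  u n @[n --> \oo] --> l ->
  `|u n| `^ (q - 2) * u n @[n --> \oo] --> `|l| `^ (q - 2) * l.
Proof.
move=> q1 ul; have q10 : 0 < q - 1 by rewrite subr_gt0.
(* The signed power is a difference of powers of the positive and the negative part with the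
   positive exponent [q - 1], whereas [q - 2] may be negative. *)
have E t : `|t| `^ (q - 2) * t =
    ((`|t| + t) / 2) `^ (q - 1) - ((`|t| - t) / 2) `^ (q - 1).
  have [t0|t0] := leP 0 t.
    rewrite (ger0_norm t0) subrr mul0r powR0 ?gt_eqF// subr0.
    have -> : (t + t) / 2 = t by field.
    by rewrite -(signed_powR_ge0 q1 t0) (ger0_norm t0).
  have nt0 : 0 <= - t by rewrite oppr_ge0 ltW.
  rewrite (ltr0_norm t0) addNr mul0r powR0 ?gt_eqF// sub0r.
  have -> : (- t - t) / 2 = - t by field.
  by rewrite -(signed_powR_ge0 q1 nt0) (ger0_norm nt0) mulrN opprK.
have ua : `|u n| @[n --> \oo] --> `|l| by exact: cvg_norm.
under eq_fun do rewrite E; rewrite E; apply: cvgB; apply: powR_cvg => //.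
- by move=> n; rewrite divr_ge0//; have := ler_norm (- u n); rewrite normrN; lra.
- by apply: cvgM; [exact: (cvgD ua ul)|exact: cvg_cst].
- by move=> n; rewrite divr_ge0// subr_ge0 ler_norm.
- by apply: cvgM; [exact: (cvgB ua ul)|exact: cvg_cst].
Qed.

Lemma norm_signed_powR {R : realType} (q t : R) : 1 < q ->
  `|(`|t| `^ (q - 2) * t)| = `|t| `^ (q - 1).
Proof.
move=> q1; rewrite -(signed_powR_ge0 q1 (normr_ge0 t)) normr_id normrM.
by rewrite ger0_norm// powR_ge0.
Qed.

Lemma powR_normD_le {R : realType} (s a b : R) : 0 < s ->
  `|a + b| `^ s <= 2 `^ s * (`|a| `^ s + `|b| `^ s).
Proof.
move=> s0; apply: (@le_trans _ _ ((2 * Num.max `|a| `|b|) `^ s)).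
  apply: le_powR; rewrite ?(ltW s0)//; apply: (le_trans (ler_normD _ _)).
  have : `|a| <= Num.max `|a| `|b| by rewrite le_max lexx.
  have : `|b| <= Num.max `|a| `|b| by rewrite le_max lexx orbT.
  lra.
rewrite powRM// ?le_max ?normr_ge0// ler_wpM2l ?powR_ge0//.
by case: (leP `|a| `|b|) => _; rewrite ?lerDr ?lerDl; exact: powR_ge0.
Qed.

Lemma near_infty_half_exp_lt {R : realType} (e : R) : 0 < e ->
  \forall n \near \oo, 1 / (2 ^ n.+1)%:R < e.
Proof.
move=> e0; have := @cvg_expr R 2^-1; rewrite ger0_norm// invf_lt1// ltr1n => /(_ isT).
move=> /cvgr0Pnorm_lt/(_ _ e0); apply: filterS => n.
rewrite exprVn ger0_norm ?invr_ge0 ?exprn_ge0//; apply: le_lt_trans.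
by rewrite mul1r natrX lef_pV2 ?posrE ?exprn_gt0// ler_weXn2l// ler1n.
Qed.

Section Limits.
Context {R : realType} {X : pmetricType R}.
Variable mu : {outer_measure set X -> \bar R}.
Hypothesis mmu : metric_measure mu.
Local Notation cX := (caratheodory_type mu).
Variable D : set X.
Hypothesis oD : open D.
Let mD : measurable (D : set cX). Proof. exact: (measurable_open mmu). Qed.
Implicit Types (f u w : X -> R) (s c : R).

Lemma in_Lp_fineK s f : in_Lp mu s D f ->
  (fine (Lp_normr mu s D f))%:E = Lp_normr mu s D f.
Proof. by move=> fL; rewrite fineK// ge0_fin_numE ?Lnorm_ge0//; case: fL. Qed.

Lemma energyZ_EFin s f c : 0 < s -> measurable_fun (T := cX) D f ->
  energy mu s D (fun x => `|c * f x|%:E) =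
  ((`|c| `^ s)%:E * energy mu s D (fun x => `|f x|%:E))%E.
Proof.
move=> s0 mf; rewrite !energy_EFin.
under eq_integral do rewrite normrM powRM// EFinM.
rewrite ge0_integralZl_EFin ?powR_ge0//.
exact: measurable_energy_EFin.
Qed.

Lemma in_LpZ s f c : 0 < s -> in_Lp mu s D f -> in_Lp mu s D (fun x => c * f x).
Proof.
move=> s0 /(in_Lp_energy mmu oD f s0)[mf fE]; apply/(in_Lp_energy mmu oD _ s0); split.
  exact: measurable_funM.
by rewrite energyZ_EFin//; apply: lte_mul_pinfty => //; rewrite ?lee_fin ?powR_ge0.
Qed.

Lemma in_LpD s f u : 1 <= s -> in_Lp mu s D f -> in_Lp mu s D u ->
  in_Lp mu s D (f \+ u)%R.
Proof.
move=> s1 [mf fE] [mu_ uE]; split; first exact: measurable_funD.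
by apply: (le_lt_trans (Lp_normrD s1 mD mf mu_)); rewrite lte_add_pinfty.
Qed.

Lemma Lp_normrN s f : 0 < s ->
  Lp_normr mu s D (\- f)%R = Lp_normr mu s D f.
Proof.
move=> s0; have E : energy mu s D (fun x => `|(\- f)%R x|%:E) =
    energy mu s D (fun x => `|f x|%:E).
  by apply: eq_integral => x _; rewrite /= normrN.
by rewrite (Lp_normr_energy _ s0 mD) E (Lp_normr_energy _ s0 mD).
Qed.

Lemma Lp_normr_dist s f u : 1 <= s -> in_Lp mu s D f -> in_Lp mu s D u ->
  `|fine (Lp_normr mu s D f) - fine (Lp_normr mu s D u)| <=
  fine (Lp_normr mu s D (f \- u)%R).
Proof.
move=> s1 fL uL; have s0 : 0 < s := lt_le_trans ltr01 s1.
have NuL : in_Lp mu s D (\- u)%R.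
  by split; [exact: measurableT_comp uL.1|rewrite Lp_normrN//; exact: uL.2].
have fuL : in_Lp mu s D (f \- u)%R by exact: in_LpD.
have H g h : in_Lp mu s D g -> in_Lp mu s D h -> fine (Lp_normr mu s D (g \+ h)%R) <=
    fine (Lp_normr mu s D g) + fine (Lp_normr mu s D h).
  move=> gL hL; rewrite -lee_fin EFinD !in_Lp_fineK//; last exact: in_LpD.
  by apply: Lp_normrD => //; [case: gL|case: hL].
have h1 := H _ _ fuL uL.
have NfuL : in_Lp mu s D (\- (f \- u))%R.
  by split; [exact: measurableT_comp fuL.1|rewrite Lp_normrN//; exact: fuL.2].
have h2 := H _ _ NfuL fL.
rewrite (_ : (f \- u) \+ u = f)%R in h1; last by apply/funext => x /=; rewrite subrK.
rewrite (_ : (\- (f \- u)) \+ f = u)%R in h2; last first.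
  by apply/funext => x /=; rewrite opprB subrK.
rewrite Lp_normrN// in h2.
by rewrite ler_norml; apply/andP; split; lra.
Qed.

Lemma Lp_normr_cvg s (f : nat -> X -> R) u : 1 <= s -> (forall n, in_Lp mu s D (f n)) ->
  in_Lp mu s D u ->
  (forall n, (energy mu s D (fun x => `|f n x - u x|%:E) <= (1 / (2 ^ n.+1)%:R)%:E)%E) ->
  fine (Lp_normr mu s D (f n)) @[n --> \oo] --> fine (Lp_normr mu s D u).
Proof.
move=> s1 fL uL fuE; have s0 : 0 < s := lt_le_trans ltr01 s1.
apply/subr_cvg0/cvgr0Pnorm_lt => e e0; have es0 : 0 < e `^ s by rewrite powR_gt0.
have [N _ NP] := near_infty_half_exp_lt es0.
exists N => // n /NP nP; apply: (le_lt_trans (Lp_normr_dist s1 (fL n) uL)).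
have fuL : in_Lp mu s D (f n \- u)%R.
  apply: in_LpD => //; split; first exact: measurableT_comp uL.1.
  by rewrite Lp_normrN//; exact: uL.2.
rewrite ltNge; apply/negP => h; move: (fuE n); rewrite leNgt => /negP; apply.
apply: (@lt_le_trans _ _ (e `^ s)%:E); first by rewrite lte_fin.
rewrite -Lp_normr_poweR// -poweR_EFin; apply: le_poweR; rewrite ?(ltW s0) ?lee_fin ?(ltW e0)//.
by rewrite -in_Lp_fineK// lee_fin.
Qed.

(** The geometric rates give pointwise convergence of the whole sequence to both limits. *)
Lemma energy_limit_ae (s r : R) (f : nat -> X -> R) u w : 0 < s -> 0 < r ->
  (forall n, measurable_fun (T := cX) D (f n)) ->
  measurable_fun (T := cX) D u -> measurable_fun (T := cX) D w ->
  (forall n, (energy mu s D (fun x => `|f n x - u x|%:E) <= (1 / (2 ^ n.+1)%:R)%:E)%E) ->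
  (forall n, (energy mu r D (fun x => `|f n x - w x|%:E) <= (1 / (2 ^ n.+1)%:R)%:E)%E) ->
  {ae cmeas mu, forall x, D x -> u x = w x}.
Proof.
move=> s0 r0 mf mu_ mw fu fw.
have mfu n : measurable_fun (T := cX) D (fun x => f n x - u x) by exact: measurable_funB.
have mfw n : measurable_fun (T := cX) D (fun x => f n x - w x) by exact: measurable_funB.
have [_ _ cu] := summable_ae mD s0 mfu fu.
have [_ _ cw] := summable_ae mD r0 mfw fw.
apply: (ae_imply2 cu cw) => x cux cwx Dx.
have fux : f n x @[n --> \oo] --> u x by apply/subr_cvg0; exact: cux.
have fwx : f n x @[n --> \oo] --> w x by apply/subr_cvg0; exact: cwx.
exact: (cvg_unique _ fux fwx).
Qed.

(** The integrand has size [|f| ^ (q - 1) <= 1 + |f| ^ q], and [1] is integrable on a set of finite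
    measure. *)
Lemma constraint_integrable (q : R) f : 1 < q -> (mu D < +oo)%E -> in_Lp mu q D f ->
  (cmeas mu).-integrable D (fun x => (`|f x| `^ (q - 2) * f x)%:E).
Proof.
move=> q1 Dfin fL; apply: (in_Lp_dominated_integrable mmu (lt_trans ltr01 q1) oD Dfin fL).
- apply: measurable_funM; last by case: fL.
  apply: (measurableT_comp (measurable_powR _)); apply: measurableT_comp => //.
  by case: fL.
- move=> x; rewrite norm_signed_powR//; apply: powR_le1D => //; first by rewrite subr_ge0 ltW.
  by rewrite gerBl.
Qed.

Lemma constraint_limit (q : R) (f : nat -> X -> R) u : 1 < q -> (mu D < +oo)%E ->
  (forall n, in_Lp mu q D (f n)) -> in_Lp mu q D u ->
  (forall n, (energy mu q D (fun x => `|f n x - u x|%:E) <= (1 / (2 ^ n.+1)%:R)%:E)%E) ->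
  (forall n, \int[cmeas mu]_(x in D) (`|f n x| `^ (q - 2) * f n x)%:E = 0)%E ->
  (\int[cmeas mu]_(x in D) (`|u x| `^ (q - 2) * u x)%:E = 0)%E.
Proof.
move=> q1 Dfin fL uL fu f0; have q0 : 0 < q := lt_trans ltr01 q1.
pose H x := (\sum_(0 <= n <oo) (`|f n x - u x| `^ q)%:E)%E.
have mfu n : measurable_fun (T := cX) D (fun x => f n x - u x).
  by apply: measurable_funB; [case: (fL n)|case: uL].
have [mH iH cv] := summable_ae mD q0 mfu fu.
(* A majorant for all [n]: bound [|f n| ^ (q - 1)] by [1 + |f n| ^ q], split [f n] into [u] and
   [f n - u], and bound the power of the latter by the sum [H]. *)
pose g x := (1%:E + (2 `^ q)%:E * ((`|u x| `^ q)%:E + H x))%E.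
have ig : (cmeas mu).-integrable D g.
  apply: integrableD => //; first exact: finite_measure_cst_integrable.
  by apply: integrableZl => //; apply: integrableD => //; exact: integrable_powR_norm.
have [||||_ _] := dominated_convergence (mu := cmeas mu) mD
    (f_ := fun n x => (`|f n x| `^ (q - 2) * f n x)%:E)
    (f := fun x => (`|u x| `^ (q - 2) * u x)%:E) _ _ _ ig.
- by move=> n; case/integrableP: (constraint_integrable q1 Dfin (fL n)).
- by case/integrableP: (constraint_integrable q1 Dfin uL).
- apply: (ae_imply cv) => x fux Dx; apply: cvg_EFin; first exact: nearW.
  by apply: signed_powR_cvg => //; apply/subr_cvg0; exact: fux.
- apply: aeW => x n Dx; rewrite abse_EFin norm_signed_powR//.
  apply: (@le_trans _ _ (1 + `|f n x| `^ q)%:E).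
    by rewrite lee_fin powR_le1D// ?gerBl// subr_ge0 ltW.
  rewrite EFinD leeD2l//.
  have := powR_normD_le (u x) (f n x - u x) q0; rewrite addrC subrK -lee_fin => /le_trans; apply.
  rewrite EFinM lee_wpmul2l ?lee_fin ?powR_ge0// EFinD leeD2l//.
  apply: le_trans (nneseries_lim_ge n.+1 _); last by move=> *; rewrite lee_fin powR_ge0.
  rewrite big_nat_recr//= leeDr// sume_ge0// => *; rewrite lee_fin powR_ge0//.
under eq_fun do rewrite f0.
by move/(cvg_unique _ (cvg_cst 0%E)) => <-.
Qed.

End Limits.

(** * Subsequences converging in [L^p] and in [L^q] *)

Section Minimization.
Context {R : realType} {X : pmetricType R}.
Variable mu : {outer_measure set X -> \bar R}.
Hypothesis mmu : metric_measure mu.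
Local Notation cX := (caratheodory_type mu).
Variables (p q : R) (Omega : set X).
Hypotheses (p1 : 1 < p) (q1 : 1 < q) (oO : open Omega).
Hypotheses (compact_p : compact_embedding mu p p Omega)
  (compact_q : compact_embedding mu p q Omega).
Local Notation E s f := (energy mu s Omega (fun x => `|f x|%:E)).
Local Notation G f := (energy mu p Omega (nabla_min mu p Omega f)).
Implicit Types (f u w : X -> R).
Let p0 : 0 < p. Proof. exact: lt_trans p1. Qed.
Let q0 : 0 < q. Proof. exact: lt_trans q1. Qed.
Let mO : measurable (Omega : set cX). Proof. exact: (measurable_open mmu). Qed.

Let newtonian_norm_le f (M : R) : newtonian mu p Omega f ->
  (E p f <= M%:E)%E -> (G f <= M%:E)%E ->
  (newtonian_norm mu p Omega f <= (2 * M `^ p^-1)%:E)%E.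
Proof.
move=> [_ fg] fM gM; have pV : 0 <= p^-1 by rewrite invr_ge0 ltW.
have [[gw _] _] := nabla_minP mmu p0 oO fg.
have -> : 2 * M `^ p^-1 = M `^ p^-1 + M `^ p^-1 by ring.
rewrite EFinD /newtonian_norm (Lp_normr_energy _ p0 mO) (Lp_norm_nonneg mmu p0 oO gw.1).
by rewrite -poweR_EFin; apply: leeD; apply: le_poweR => //; exact: energy_ge0.
Qed.

Let increasing_ge (phi : nat -> nat) : increasing_seq phi -> forall n, (n <= phi n)%N.
Proof.
move=> phiI; elim=> // n ih; apply: (leq_ltn_trans ih).
by rewrite ltnNge -leEnat phiI -ltnNge.
Qed.

Let cvg_energy (s e : R) (f : nat -> X -> R) u : 0 < s -> 0 < e ->
  Lp_normr mu s Omega (f n \- u)%R @[n --> \oo] --> 0%E ->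
  \forall n \near \oo, (E s (f n \- u)%R <= e%:E)%E.
Proof.
move=> s0 e0 cv; have es0 : 0 < e `^ s^-1 by rewrite powR_gt0.
have := cvge0_lt es0 cv; apply: filterS => n h.
rewrite -(Lp_normr_poweR _ s0 mO).
have -> : e%:E = ((e `^ s^-1)%:E `^ s)%E.
  by rewrite poweR_EFin -powRrM mulVf ?gt_eqF// powRr1// ltW.
by apply: le_poweR; rewrite ?(ltW s0)//; [exact: Lnorm_ge0|exact: ltW].
Qed.

(** The [L^p] limit [u] and the [L^q] limit [w] of a common subsequence agree almost everywhere, so
    [u] serves for both. The geometric rates prepare the use of [summable_ae]. *)
Lemma compact_subsequence (f : nat -> X -> R) (M : R) :
  (forall n, [/\ newtonian mu p Omega (f n), (E p (f n) <= M%:E)%E & (G (f n) <= M%:E)%E]) ->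
  exists (chi : nat -> nat) u, [/\ forall n, (n <= chi n)%N,
    in_Lp mu p Omega u, in_Lp mu q Omega u,
    forall n, (E p (fun x => f (chi n) x - u x)%R <= (1 / (2 ^ n.+1)%:R)%:E)%E &
    forall n, (E q (fun x => f (chi n) x - u x)%R <= (1 / (2 ^ n.+1)%:R)%:E)%E].
Proof.
move=> fM; pose N := 2 * M `^ p^-1.
have fN n : newtonian mu p Omega (f n) /\ (newtonian_norm mu p Omega (f n) <= N%:E)%E.
  by have [h1 h2 h3] := fM n; split => //; exact: newtonian_norm_le.
have [phi [u [phiI uL cu]]] := compact_p.2 f N fN.
have [psi [w [psiI wL cw]]] := compact_q.2 (fun n => f (phi n)) N (fun n => fN (phi n)).
have e0 k : 0 < 1 / (2 ^ k.+1)%:R :> R by rewrite divr_gt0// ltr0n expn_gt0.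
have cup : Lp_normr mu p Omega (f (phi (psi n)) \- u)%R @[n --> \oo] --> 0%E.
  apply: (cvg_comp psi _ _ cu).
  move=> A [m _ mA]; exists m => // n /= mn; apply: mA.
  by rewrite /= (leq_trans mn)// increasing_ge.
have /choice[k kP] j : exists k, [/\ (j <= k)%N,
    (E p (f (phi (psi k)) \- u)%R <= (1 / (2 ^ j.+1)%:R)%:E)%E &
    (E q (f (phi (psi k)) \- w)%R <= (1 / (2 ^ j.+1)%:R)%:E)%E].
  have [m1 _ m1P] := cvg_energy p0 (e0 j) cup.
  have [m2 _ m2P] := cvg_energy q0 (e0 j) cw.
  exists (maxn j (maxn m1 m2)); split; first exact: leq_maxl.
    by apply: m1P; rewrite /= maxnCA leq_maxl.
  by apply: m2P; rewrite /= maxnC -maxnA maxnC -maxnA leq_maxl.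
exists (fun j => phi (psi (k j))), u.
have mf n : measurable_fun (T := cX) Omega (f n) by have [[[]]] := fM n.
have uw : {ae cmeas mu, forall x, Omega x -> u x = w x}.
  apply: (energy_limit_ae mmu oO p0 q0 (fun j => mf (phi (psi (k j)))) uL.1 wL.1).
    by move=> n; have [_ h _] := kP n; exact: h.
  by move=> n; have [_ _ h] := kP n; exact: h.
split => //.
- move=> n; have [nk _ _] := kP n.
  exact: leq_trans nk (leq_trans (increasing_ge psiI _) (increasing_ge phiI _)).
- apply: (in_Lp_ae_eq mmu oO q0 wL); apply: (ae_imply uw) => x h Ox.
  by rewrite h.
- by move=> n; have [_ h _] := kP n; exact: h.
- move=> n; have [_ _ +] := kP n; apply: le_trans; rewrite le_eqVlt; apply/orP; left; apply/eqP.
  apply: energy_EFin_ae_eq => //.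
  - by apply: measurable_funB => //; case: uL.
  - by apply: measurable_funB => //; case: wL.
  - by apply: (ae_imply uw) => x h Ox; rewrite /= h.
Qed.

End Minimization.

(** * Scaling and normalization of the Rayleigh quotient *)

Section Homogeneity.
Context {R : realType} {X : pmetricType R}.
Variable mu : {outer_measure set X -> \bar R}.
Hypothesis mmu : metric_measure mu.
Local Notation cX := (caratheodory_type mu).
Variables (p q : R) (Omega : set X).
Hypotheses (p0 : 0 < p) (q1 : 1 < q) (oO : open Omega).
Local Notation E s f := (energy mu s Omega (fun x => `|f x|%:E)).
Local Notation G f := (energy mu p Omega (nabla_min mu p Omega f)).
Implicit Types (f u w : X -> R) (c s : R).
Let q0 : 0 < q. Proof. exact: lt_trans q1. Qed.
Let mO : measurable (Omega : set cX). Proof. exact: (measurable_open mmu). Qed.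

Lemma newtonianZ f c : newtonian mu p Omega f ->
  newtonian mu p Omega (fun x => c * f x) /\
  (G (fun x => c * f x)%R <= (`|c| `^ p)%:E * G f)%E.
Proof.
move=> [fL fg]; have [gL _] := nabla_minP mmu p0 oO fg.
have [gw gE] := (Lp_weak_upper_gradientP mmu p0 oO _ _).1 gL.
have cE := energyZ mmu p oO (normr_ge0 c) gw.1.
have cgL : Lp_weak_upper_gradient mu p Omega (fun x => c * f x)
    (fun x => `|c|%:E * nabla_min mu p Omega f x)%E.
  apply/(Lp_weak_upper_gradientP mmu p0 oO); split.
    exact: weak_upper_gradientZ.
  by rewrite cE; apply: lte_mul_pinfty => //; rewrite lee_fin powR_ge0.
split; last by rewrite -cE; exact: nabla_min_le.
split; first exact: in_LpZ.
by exists (fun x => `|c|%:E * nabla_min mu p Omega f x)%E.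
Qed.

Lemma Lp_normrZ s f c : 0 < s -> measurable_fun (T := cX) Omega f ->
  Lp_normr mu s Omega (fun x => c * f x) = (`|c|%:E * Lp_normr mu s Omega f)%E.
Proof.
move=> s0 mf; rewrite (Lp_normr_energy (fun x => c * f x)%R s0 mO).
rewrite energyZ_EFin// poweRM ?energy_ge0 ?lee_fin ?powR_ge0//.
rewrite poweR_EFin -powRrM divff ?gt_eqF// powRr1//.
by rewrite (Lp_normr_energy f s0 mO).
Qed.

Lemma energy_ae_cst s f c : 0 < s -> measurable_fun (T := cX) Omega f ->
  {ae cmeas mu, forall x, Omega x -> f x = c} ->
  E s f = ((`|c| `^ s)%:E * mu Omega)%E.
Proof.
move=> s0 mf fc; rewrite -(energy_cst s (normr_ge0 c) mO).
have -> : energy mu s Omega (cst `|c|%:E) = E s (cst c) by [].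
exact: energy_EFin_ae_eq.
Qed.

Lemma rayleighE f : newtonian mu p Omega f ->
  rayleigh mu p q Omega f = (G f / (Lp_normr mu q Omega f `^ p))%E.
Proof.
move=> [_ fg]; have [[gw _] _] := nabla_minP mmu p0 oO fg.
by rewrite /rayleigh (Lp_norm_poweR mmu p0 oO gw.1).
Qed.

Lemma Lp_normr_eq1 s f : 0 < s -> E s f = 1%E -> Lp_normr mu s Omega f = 1%E.
Proof. by move=> s0 f1; rewrite (Lp_normr_energy f s0 mO) f1 poweR_EFin powR1. Qed.

Lemma rayleigh_normalized f : newtonian mu p Omega f -> E q f = 1%E ->
  rayleigh mu p q Omega f = G f.
Proof.
by move=> fN f1; rewrite rayleighE// Lp_normr_eq1// poweR_EFin powR1 inver oner_eq0 invr1 mule1.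
Qed.

(** Such a [w] vanishes almost everywhere, so its nonzero norm comes from the gradient, and a
    positive numerator is multiplied by [0^-1 = +oo]. These functions cannot occur in a minimizing
    sequence. *)
Lemma rayleigh_normr_eq0 w : newtonian mu p Omega w -> newtonian_norm mu p Omega w <> 0%E ->
  E q w = 0%E -> rayleigh mu p q Omega w = +oo%E.
Proof.
move=> wN wn0 w0; rewrite rayleighE//.
have -> : Lp_normr mu q Omega w = 0%E.
  by rewrite (Lp_normr_energy w q0 mO) w0 poweR0r// invr_eq0 gt_eqF.
rewrite poweR0r ?gt_eqF// inve0 gt0_muley//.
rewrite lt_neqAle energy_ge0 andbT eq_sym; apply/eqP => Gw0; apply: wn0.
have mw := wN.1.1; have wae := energy_EFin_eq0 mmu q0 oO mw w0.
have [[gw _] _] := nabla_minP mmu p0 oO wN.2.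
rewrite /newtonian_norm (Lp_norm_nonneg mmu p0 oO gw.1) Gw0.
rewrite (Lp_normr_energy w p0 mO) (energy_ae_cst p0 mw wae) normr0 powR0 ?gt_eqF//.
by rewrite mul0e poweR0r ?adde0// invr_eq0 gt_eqF.
Qed.

Lemma rayleigh_normalize w : (mu Omega < +oo)%E -> in_Lp mu q Omega w ->
  admissible mu p q Omega w -> E q w <> 0%E ->
  exists f, [/\ newtonian mu p Omega f, E q f = 1%E,
    (\int[cmeas mu]_(x in Omega) (`|f x| `^ (q - 2) * f x)%:E = 0)%E &
    (G f <= rayleigh mu p q Omega w)%E].
Proof.
move=> Ofin wL [wN _ w0] wn0.
pose N := fine (Lp_normr mu q Omega w).
have NE : N%:E = Lp_normr mu q Omega w := in_Lp_fineK wL.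
have wE : E q w = (N `^ q)%:E by rewrite -(Lp_normr_poweR w q0 mO) -NE poweR_EFin.
have N0 : 0 < N.
  rewrite lt_neqAle fine_ge0 ?Lnorm_ge0// andbT; apply/eqP => N0; apply: wn0.
  by rewrite wE -N0 powR0// gt_eqF.
have [fN fG] := newtonianZ N^-1 wN.
exists (fun x => N^-1 * w x); split => //.
- rewrite energyZ_EFin//; last by case: wL.
  rewrite wE -EFinM -powRM ?normr_ge0 ?ltW// ger0_norm ?invr_ge0 ?ltW//.
  by rewrite mulVf ?gt_eqF// powR1.
- rewrite (eq_integral (fun x : cX => ((`|N^-1| `^ (q - 2) * N^-1)%:E *
      (`|w x| `^ (q - 2) * w x)%:E)%E)); last first.
    by move=> x _; rewrite -EFinM normrM powRM//; congr EFin; ring.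
  by rewrite integralZl ?w0 ?mule0//; exact: constraint_integrable.
- apply: (le_trans fG); rewrite rayleighE// -NE poweR_EFin inver gt_eqF ?powR_gt0//.
  by rewrite muleC gtr0_norm ?invr_gt0// -powR_inv1 ?(ltW N0)// -powRrM mulN1r powRN.
Qed.

End Homogeneity.

(** * Existence of a minimizer and positivity of the infimum *)

Section Minimizer.
Context {R : realType} {X : pmetricType R}.
Variable mu : {outer_measure set X -> \bar R}.
Hypothesis mmu : metric_measure mu.
Local Notation cX := (caratheodory_type mu).
Variables (p q : R) (Omega : set X).
Hypotheses (p1 : 1 < p) (q1 : 1 < q) (oO : open Omega).
Hypotheses (compact_p : compact_embedding mu p p Omega)
  (compact_q : compact_embedding mu p q Omega).
Local Notation E s f := (energy mu s Omega (fun x => `|f x|%:E)).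
Local Notation G f := (energy mu p Omega (nabla_min mu p Omega f)).
Local Notation norm s f := (fine (Lp_normr mu s Omega f)).
Implicit Types (f u w : X -> R).
Let p0 : 0 < p. Proof. exact: lt_trans p1. Qed.
Let q0 : 0 < q. Proof. exact: lt_trans q1. Qed.
Let mO : measurable (Omega : set cX). Proof. exact: (measurable_open mmu). Qed.

Lemma Lp_bound_of_Lq_gradient_bound (M : R) : 0 <= M -> exists C : R, forall f,
  newtonian mu p Omega f -> E q f = 1%E -> (G f <= M%:E)%E -> (E p f <= C%:E)%E.
Proof.
move=> M0; apply: contrapT => h.
have /choice[f fP] (n : nat) : exists f, [/\ newtonian mu p Omega f, E q f = 1%E,
    (G f <= M%:E)%E & ((n.+1%:R `^ p)%:E < E p f)%E].
  apply: contrapT => h'; apply: h; exists (n.+1%:R `^ p) => f fN f1 fM.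
  by rewrite leNgt; apply/negP => fn; apply: h'; exists f.
have fL n : in_Lp mu p Omega (f n) by have [[]] := fP n.
pose A n := norm p (f n).
have AE n : (A n)%:E = Lp_normr mu p Omega (f n) := in_Lp_fineK (fL n).
have An n : n.+1%:R < A n.
  have [_ _ _] := fP n; rewrite -(Lp_normr_poweR _ p0 mO) -AE poweR_EFin lte_fin.
  apply: contraTT; rewrite -!leNgt => h1; apply: le_powR => //; first exact: ltW.
  by rewrite fine_ge0// Lnorm_ge0.
have A1 n : 1 <= A n by apply: le_trans (ltW (An n)); rewrite ler1n.
have A0 n : 0 < A n by apply: lt_le_trans (A1 n).
pose h_ n x := (A n)^-1 * f n x.
have hN n : newtonian mu p Omega (h_ n) /\ (G (h_ n) <= (`|(A n)^-1| `^ p)%:E * G (f n))%E.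
  by apply: (newtonianZ mmu p0 oO); case: (fP n).
have hp n : Lp_normr mu p Omega (h_ n) = 1%E.
  rewrite (Lp_normrZ mmu oO _ p0 (fL n).1) -AE -EFinM gtr0_norm ?invr_gt0//.
  by rewrite mulVf// gt_eqF.
have hq n : Lp_normr mu q Omega (h_ n) = (A n)^-1%:E.
  rewrite (Lp_normrZ mmu oO _ q0 (fL n).1) (Lp_normr_eq1 mmu oO q0); last by case: (fP n).
  by rewrite mule1 gtr0_norm ?invr_gt0.
have hM n : [/\ newtonian mu p Omega (h_ n), (E p (h_ n) <= (1 + M)%:E)%E &
    (G (h_ n) <= (1 + M)%:E)%E].
  have [hn hG] := hN n; split => //.
    by rewrite -(Lp_normr_poweR _ p0 mO) hp poweR_EFin powR1 lee_fin lerDl.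
  apply: (le_trans hG); have [_ _ fM _] := fP n.
  apply: (@le_trans _ _ (1%:E * M%:E)%E); last by rewrite mul1e lee_fin lerDr.
  apply: lee_pmul => //; rewrite ?energy_ge0 ?lee_fin ?powR_ge0//.
  apply: (@le_trans _ _ (1 `^ p)); last by rewrite powR1.
  apply: le_powR => //; first exact: ltW.
  by rewrite gtr0_norm ?invr_gt0// invf_le1.
have [chi [u [chin uLp uLq up uq]]] := compact_subsequence mmu p1 q1 oO compact_p compact_q hM.
have hLp n : in_Lp mu p Omega (h_ (chi n)) by case: (hN (chi n)) => -[].
have hLq n : in_Lp mu q Omega (h_ (chi n)) by apply: compact_q.1; case: (hN (chi n)).
have cp := Lp_normr_cvg mmu oO (ltW p1) hLp uLp up.
have cq := Lp_normr_cvg mmu oO (ltW q1) hLq uLq uq.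
have u1 : norm p u = 1.
  by rewrite -(cvg_lim _ cp)//; under eq_fun do rewrite hp; rewrite lim_cst.
have u0 : norm q u = 0.
  (* The [L^q] norm [1 / A (chi n)] is at most [1 / (n + 1)], because [n <= chi n]. *)
  apply: (cvg_unique _ cq) => //; apply: (@squeeze_cvgr _ _ _ _ (cst 0) (@harmonic R)).
  - apply: nearW => n; rewrite hq /= invr_ge0 (ltW (A0 _))/=.
    rewrite lef_pV2 ?posrE//; apply: le_trans (ltW (An _)).
    by rewrite ler_nat ltnS.
  - exact: cvg_cst.
  - exact: cvg_harmonic.
have uq0 : E q u = 0%E.
  by rewrite -(Lp_normr_poweR _ q0 mO) -(in_Lp_fineK uLq) u0 poweR_EFin powR0// gt_eqF.
have uae := energy_EFin_eq0 mmu q0 oO uLq.1 uq0.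
have : Lp_normr mu p Omega u = 0%E.
  rewrite (Lp_normr_energy u p0 mO) (energy_ae_cst mmu oO p0 uLp.1 uae) normr0.
  by rewrite powR0 ?gt_eqF// mul0e poweR0r// invr_eq0 gt_eqF.
by rewrite -(in_Lp_fineK uLp) u1 => -[] /eqP; rewrite oner_eq0.
Qed.

Lemma normalized_admissible f : newtonian mu p Omega f -> E q f = 1%E ->
  (\int[cmeas mu]_(x in Omega) (`|f x| `^ (q - 2) * f x)%:E = 0)%E ->
  admissible mu p q Omega f.
Proof.
move=> fN f1 f0; split => // fn0; have mf := fN.1.1.
have Ep0 : E p f = 0%E.
  rewrite -(Lp_normr_poweR f p0 mO).
  have -> : Lp_normr mu p Omega f = 0%E.
    by apply/eqP; rewrite eq_le Lnorm_ge0 andbT -fn0 leeDl// Lnorm_ge0.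
  by rewrite poweR0r// gt_eqF.
have fae := energy_EFin_eq0 mmu p0 oO mf Ep0.
move: f1; rewrite (energy_ae_cst mmu oO q0 mf fae) normr0 powR0 ?gt_eqF// mul0e.
by move=> [] /eqP; rewrite eq_sym oner_eq0.
Qed.

Lemma rayleigh_ge0 w : (0 <= rayleigh mu p q Omega w)%E.
Proof. by rewrite /rayleigh mule_ge0 ?inve_ge0 ?poweR_ge0. Qed.

Lemma lambda_ge0 : (0 <= lambda mu p q Omega)%E.
Proof. by apply: le_ereal_inf_tmp => _ [w _ <-]; exact: rayleigh_ge0. Qed.

Lemma rayleigh_minimizer w0 : (mu Omega < +oo)%E ->
  admissible mu p q Omega w0 -> E q w0 <> 0%E ->
  exists u, [/\ admissible mu p q Omega u, E q u = 1%E &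
    lambda mu p q Omega = rayleigh mu p q Omega u].
Proof.
move=> Ofin w0A w0n0; have lq w : admissible mu p q Omega w -> in_Lp mu q Omega w.
  by case=> wN _ _; exact: compact_q.1.
have Gfin f : newtonian mu p Omega f -> (G f < +oo)%E.
  move=> [_ fg]; have [gL _] := nabla_minP mmu p0 oO fg.
  exact: ((Lp_weak_upper_gradientP mmu p0 oO _ _).1 gL).2.
have lam_le f : newtonian mu p Omega f -> E q f = 1%E ->
    (\int[cmeas mu]_(x in Omega) (`|f x| `^ (q - 2) * f x)%:E = 0)%E ->
    (lambda mu p q Omega <= G f)%E.
  move=> fN f1 f0; apply: ereal_inf_lbound; exists f; first exact: normalized_admissible.
  exact: rayleigh_normalized.
(* The competitor [w0], once normalized, bounds the infimum by a finite energy. *)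
have lfin : lambda mu p q Omega \is a fin_num.
  rewrite ge0_fin_numE ?lambda_ge0//.
  have [f [fN f1 f0 _]] := rayleigh_normalize mmu p0 q1 oO Ofin (lq _ w0A) w0A w0n0.
  by apply: (le_lt_trans (lam_le f fN f1 f0)); exact: Gfin.
pose l := fine (lambda mu p q Omega); have lE : l%:E = lambda mu p q Omega by rewrite /l fineK.
have l0 : 0 <= l by rewrite -lee_fin lE lambda_ge0.
have /choice[f fP] (n : nat) : exists f, [/\ newtonian mu p Omega f, E q f = 1%E,
    (\int[cmeas mu]_(x in Omega) (`|f x| `^ (q - 2) * f x)%:E = 0)%E &
    (G f <= (l + n.+1%:R^-1)%:E)%E].
  have n0 : 0 < n.+1%:R^-1 :> R by rewrite invr_gt0.
  have [_ [w wA <-] wl] := lb_ereal_inf_adherent n0 lfin.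
  have wn0 : E q w <> 0%E.
    move=> Ew0; case: (wA) => wN wnn _.
    by move: wl; rewrite (rayleigh_normr_eq0 mmu p0 q1 oO wN wnn Ew0) ltNge leey.
  have [f [fN f1 f0 fG]] := rayleigh_normalize mmu p0 q1 oO Ofin (lq _ wA) wA wn0.
  exists f; split => //; apply: (le_trans fG).
  by rewrite EFinD lE; exact: ltW.
have M0 : 0 <= l + 1 by rewrite addr_ge0.
have fG n : (G (f n) <= (l + 1)%:E)%E.
  have [_ _ _ h] := fP n; apply: (le_trans h); rewrite lee_fin lerD2l.
  by rewrite invf_le1// ler1n.
have [C CP] := Lp_bound_of_Lq_gradient_bound M0.
have fM n : [/\ newtonian mu p Omega (f n), (E p (f n) <= (`|C| + (l + 1))%:E)%E &
    (G (f n) <= (`|C| + (l + 1))%:E)%E].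
  have [fN f1 _ _] := fP n; split => //.
    apply: (le_trans (CP _ fN f1 (fG n))); rewrite lee_fin (le_trans (ler_norm C))//.
    by rewrite lerDl.
  by apply: (le_trans (fG n)); rewrite lee_fin lerDr.
have [chi [u [chin uLp uLq up uq]]] := compact_subsequence mmu p1 q1 oO compact_p compact_q fM.
have fLq n : in_Lp mu q Omega (f (chi n)) by apply: compact_q.1; case: (fP (chi n)).
have Eu1 : E q u = 1%E.
  have cq := Lp_normr_cvg mmu oO (ltW q1) fLq uLq uq.
  have fn n : Lp_normr mu q Omega (f n) = 1%E.
    by apply: (Lp_normr_eq1 mmu oO q0); case: (fP n).
  rewrite -(Lp_normr_poweR u q0 mO) -(in_Lp_fineK uLq) -(cvg_lim _ cq)//.
  by under eq_fun do rewrite fn; rewrite lim_cst// poweR_EFin powR1.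
have u0 : (\int[cmeas mu]_(x in Omega) (`|u x| `^ (q - 2) * u x)%:E = 0)%E.
  by apply: (constraint_limit mmu oO q1 Ofin fLq uLq uq) => n; case: (fP (chi n)).
(* The compactness limit [u] is replaced by the Newtonian representative [v]; normalization and
   constraint depend only on the class modulo null sets. *)
have [e e0|v [vN uv vG]] := newtonian_weak_limit mmu p1 oO uLp l0.
  have [n1 _ n1P] := near_infty_natSinv_lt (PosNum e0).
  have [n2 _ n2P] := near_infty_half_exp_lt e0.
  pose n := maxn n1 n2; exists (f (chi n)).
  have [fN _ _ fGn] := fP (chi n); split => //.
    apply: (le_trans (up n)); rewrite lee_fin; apply: ltW.
    by apply: n2P; exact: leq_maxr.
  apply: (le_trans fGn); rewrite lee_fin lerD2l; apply: ltW.
  apply: (n1P (chi n)); apply: leq_trans (chin n); exact: leq_maxl.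
have mv := vN.1.1.
have Ev1 : E q v = 1%E.
  rewrite -Eu1; apply: energy_EFin_ae_eq => //; first by case: uLq.
  by apply: (ae_imply uv) => x h Ox; rewrite h.
have v0 : (\int[cmeas mu]_(x in Omega) (`|v x| `^ (q - 2) * v x)%:E = 0)%E.
  rewrite -u0; apply: ae_eq_integral => //.
  - by case/integrableP: (constraint_integrable mmu oO q1 Ofin (compact_q.1 _ vN)).
  - by case/integrableP: (constraint_integrable mmu oO q1 Ofin uLq).
  - by apply: (ae_imply uv) => x h Ox; rewrite h.
exists v; split => //; first exact: normalized_admissible.
rewrite (rayleigh_normalized mmu p0 q1 oO)//; apply/eqP; rewrite eq_le.
by rewrite lam_le//= -lE.
Qed.

Lemma lambda_gt0 u : doubling mu -> weak_poincare mu p -> domain Omega ->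
  (mu Omega < +oo)%E -> admissible mu p q Omega u -> E q u = 1%E ->
  lambda mu p q Omega = rayleigh mu p q Omega u -> (0 < lambda mu p q Omega)%E.
Proof.
move=> doubl poin dO Ofin [uN _ u0] Eu1 lu.
rewrite lt_neqAle lambda_ge0 andbT eq_sym; apply/eqP.
rewrite lu (rayleigh_normalized mmu p0 q1 oO)// => Gu0.
have [c uc] := zero_gradient_const mmu doubl p1 poin dO Ofin uN Gu0.
have mu_ := uN.1.1.
(* The normalization excludes both [c = 0] and [mu Omega = 0], while the constraint reads
   [|c| ^ (q - 2) * c * mu Omega = 0]. *)
have c0 : c <> 0.
  move=> c0; move: Eu1; rewrite (energy_ae_cst mmu oO q0 mu_ uc) c0 normr0.
  by rewrite powR0 ?gt_eqF// mul0e => -[] /eqP; rewrite eq_sym oner_eq0.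
have O0 : mu Omega <> 0%E.
  by move=> O0; move: Eu1; rewrite (energy_ae_cst mmu oO q0 mu_ uc) O0 mule0 => -[] /eqP;
    rewrite eq_sym oner_eq0.
move: u0; rewrite (ae_eq_integral (cst (`|c| `^ (q - 2) * c)%:E))//; last 2 first.
- by case/integrableP: (constraint_integrable mmu oO q1 Ofin (compact_q.1 _ uN)).
- by apply: (ae_imply uc) => x h Ox; rewrite h.
rewrite integral_cst// => /eqP; rewrite mule_eq0 => /orP[|/eqP//].
rewrite eqe mulf_eq0 => /orP[|/eqP//] /eqP/powR_eq0_eq0/normr0_eq0//.
Qed.

End Minimizer.

Theorem theorem3p2 (R : realType) (X : pmetricType R)
    (mu : {outer_measure set X -> \bar R}) (p q : R) (Omega : set X) :
  metric_measure mu ->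
  doubling mu ->
  weak_poincare mu p ->
  1 < p ->
  p < hom_dim mu ->
  sobolev_embedding_domain mu p (sobolev_exponent mu p) Omega ->
  1 < q ->
  q < sobolev_exponent mu p ->
  (exists u : X -> R,
     admissible mu p q Omega u /\
     lambda mu p q Omega = rayleigh mu p q Omega u) /\
  (0 < lambda mu p q Omega)%E.
Proof.
move=> mmu doubl poin p1 pnu [dO bounded compact] q1 qs.
have p0 : 0 < p := lt_trans ltr01 p1; have nu0 := lt_trans p0 pnu.
(* Puts [L^p] itself within the compact range of the embedding. *)
have ps : p < sobolev_exponent mu p.
  by rewrite /sobolev_exponent ltr_pdivlMr ?subr_gt0// mulrC ltr_pM2r// gtrBl.
have [[a Oa] oO _] := dO.
have Ofin : (mu Omega < +oo)%E.
  (* Any exponent strictly between [1] and [p] serves in the volume growth argument. *)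
  have s1 : 1 < (1 + p) / 2 by lra.
  have sp : (1 + p) / 2 < p by lra.
  by apply: (bounded_embedding_finite_measure mmu oO p0 doubl s1 sp); apply: bounded => //; lra.
(* On a single point the constraint would force the function to vanish, leaving no competitor. *)
have [b Ob ba] := open_two_points mmu p1 poin nu0 oO Oa.
have [w [wA wn0]] := admissible_ex mmu p1 q1 oO Ofin Ob Oa ba.
have [u [uA u1 lu]] := rayleigh_minimizer mmu p1 q1 oO (compact p p1 ps) (compact q q1 qs)
  Ofin wA wn0.
split; first by exists u.
exact: (lambda_gt0 mmu p1 q1 oO (compact q q1 qs) doubl poin dO Ofin uA u1 lu).
Qed.
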